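(* Let $\mathcal L$ be a lamination by complex manifolds of a compact space $X$, having no vanishing cycle, and let $E\to\mathcal L$ be a positive holomorphic line bundle. If the topological dimension of $X$ is finite, then there exist an integer $N$ and a symplectic embedding $\pi:X\to\mathbb{C}P^N$ for the standard symplectic structure of $\mathbb{C}P^N$.
   Context: Compact spaces are Hausdorff. A lamination by complex manifolds $\mathcal L$ of a space $X$ is a maximal atlas of homeomorphisms $\varphi:U\to B\times T$ from open sets $U$ covering $X$ onto the product of the unit ball $B\subset\mathbb{C}^n$ with a topological space $T$, such that the changes of charts have the form $(z,t)\mapsto(z'(z,t),t'(t))$ with $z'$ holomorphic in $z$. The leaves are the complex manifolds obtained by gluing the plaques $B\times\{t\}$. Holomorphic functions on open sets of $X$ are the continuous functions holomorphic along the leaves (sheaf $\mathcal O$); a holomorphic line bundle on $\mathcal L$ is an element of $H^1(X,\mathcal O^* )$. A function (or map to a manifold) is smooth if it is smooth along leaves and all its derivatives in the leaf coordinate $z$ are continuous in $(z,t)$; a hermitian metric is smooth if norms of local nowhere zero holomorphic sections are smooth. A holomorphic line bundle is positive if it has a smooth hermitian metric whose curvature along leaves $\Omega=\sqrt{-1}\,\overline\partial\partial\log|s|^2$ ($s$ a local nowhere zero holomorphic section) satisfies $\Omega(u,\sqrt{-1}u)>0$ for each nonzero vector $u$ tangent to a leaf. Vanishing cycle: a loop contained in a leaf, not homotopic to a point in its leaf, which is a uniform limit of loops contained in nearby leaves that are homotopic to a point in their leaf. A compact space has finite topological dimension iff it embeds topologically in a euclidean space. The standard symplectic form on $\mathbb{C}P^N$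 is the Fubini–Study form $\omega_{FS}$. A symplectic embedding $\pi:X\to\mathbb{C}P^N$ is a smooth map, injective (hence a topological embedding), which immerses each leaf symplectically, i.e. the restriction to each leaf is an immersion and $\pi^*\omega_{FS}$ is nondegenerate on each leaf. *)

(* Defs.v *)
From HB Require Import structures.
From mathcomp Require Import all_boot all_order all_algebra.
From mathcomp Require Import complex.
From mathcomp Require Import all_classical all_reals all_analysis.
Set Implicit Arguments.
Unset Strict Implicit.
Unset Printing Implicit Defensive.
Import Order.TTheory GRing.Theory Num.Theory.
Import numFieldNormedType.Exports.
Local Open Scope classical_set_scope.
Local Open Scope ring_scope.

(* R[i] under a name that exposes its numClosedFieldType structure, from which
   its canonical topology and complex normed module structure are inferred. *)
Definition CC (R : realType) : numClosedFieldType := R[i].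

Definition imC (R : realType) : CC R := Complex 0 1.

Definition realC (R : realType) (x : R) : CC R := Complex x 0.

Definition ReC (R : realType) (z : CC R) : R := complex.Re z.

Definition ImC (R : realType) (z : CC R) : R := complex.Im z.

Definition absC (R : realType) (z : CC R) : R :=
  Num.sqrt (ReC z ^+ 2 + ImC z ^+ 2).

(** Differential calculus on C^m seen as a real vector space *)

Definition line (R : realType) (m : nat) (z u : 'rV[CC R]_m) (h : R) :
  'rV[CC R]_m := z + realC h *: u.

Definition Dreal (R : realType) (m : nat) (f : 'rV[CC R]_m -> R)
    (z u : 'rV[CC R]_m) : R :=
  derive1 (fun h : R => f (line z u h)) 0.

Definition Dcplx (R : realType) (m : nat) (f : 'rV[CC R]_m -> CC R)
    (z u : 'rV[CC R]_m) : CC R :=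
  realC (Dreal (fun w => ReC (f w)) z u)
  + imC R * realC (Dreal (fun w => ImC (f w)) z u).

Definition del (R : realType) (m : nat) (f : 'rV[CC R]_m -> CC R)
    (z u : 'rV[CC R]_m) : CC R :=
  2^-1 * (Dcplx f z u - imC R * Dcplx f z (imC R *: u)).

Definition delbar (R : realType) (m : nat) (f : 'rV[CC R]_m -> CC R)
    (z u : 'rV[CC R]_m) : CC R :=
  2^-1 * (Dcplx f z u + imC R * Dcplx f z (imC R *: u)).

(* The value at z, on the pair of vectors (u, v), of the 2-form
   delbar (del f) = \sum_j delbar (d f / d z_j) /\ dz_j. *)
Definition delbar_del (R : realType) (m : nat) (f : 'rV[CC R]_m -> CC R)
    (z u v : 'rV[CC R]_m) : CC R :=
  delbar (fun w => del f w v) z u - delbar (fun w => del f w u) z v.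

(** Laminations *)

(* The norm of the library on row vectors is the sup norm; the balls of charts
   are euclidean. *)
Definition unit_ball (R : realType) (n : nat) : set 'rV[CC R]_n :=
  [set z | \sum_(j < n) absC (z 0 j) ^+ 2 < 1].

Definition box (R : realType) (n : nat) (T : topologicalType) :
    set ('rV[CC R]_n * T) :=
  [set p | unit_ball p.1].

(* A homeomorphism phi from an open set of X onto B * T, with inverse psi.  The
   values of phi and psi outside of the domain and of B * T are irrelevant.
   (When X is not empty, T is not empty either: the chart with empty domain,
   which contains no information, is not represented.) *)
Record chart (R : realType) (X : topologicalType) (n : nat) := Chart {
  transv : topologicalType;
  dom : set X;
  phi : X -> 'rV[CC R]_n * transv;
  psi : 'rV[CC R]_n * transv -> X;
  dom_open : open dom;
  phi_box : forall x, dom x -> box (phi x);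
  psi_dom : forall p, box p -> dom (psi p);
  phiK : forall x, dom x -> psi (phi x) = x;
  psiK : forall p, box p -> phi (psi p) = p;
  phi_continuous : {within dom, continuous phi};
  psi_continuous : {within @box R n transv, continuous psi} }.

Arguments transv {R X n} _.
Arguments dom {R X n} _.
Arguments phi {R X n} _ _.
Arguments psi {R X n} _ _.

Definition overlap (R : realType) (X : topologicalType) (n : nat)
    (c d : chart R X n) : set ('rV[CC R]_n * transv c) :=
  [set p | box p /\ dom d (psi c p)].

(* The change of charts has the form (z, t) |-> (z'(z, t), t'(t)) with z'
   holomorphic in z.  As usual for foliations, the form t'(t) is required
   locally on the overlap: a plaque of c may cut several plaques of d. *)
Definition compatible (R : realType) (X : topologicalType) (n : nat)
    (c d : chart R X n) : Prop :=
  forall p, overlap d p ->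
    differentiable (fun z => (phi d (psi c (z, p.2))).1) p.1
    /\ exists t' : transv c -> transv d,
         \forall q \near p, overlap d q -> (phi d (psi c q)).2 = t' q.2.

Record lamination (R : realType) (X : topologicalType) (n : nat) := Lamination {
  atlas : chart R X n -> Prop;
  atlas_cover : forall x, exists2 c, atlas c & dom c x;
  atlas_compatible : forall c d, atlas c -> atlas d -> compatible c d;
  atlas_maximal : forall c,
    (forall d, atlas d -> compatible c d /\ compatible d c) -> atlas c }.

(** Leaves, loops in leaves and vanishing cycles *)

(* X with the leaf topology: the finest topology for which all the plaques
   z |-> psi c (z, t), z in B, are continuous.  The leaves are the connected
   components of this space. *)
Definition leafspace (R : realType) (X : topologicalType) (n : nat)
  (L : lamination R X n) : Type := X.

HB.instance Definition _ (R : realType) (X : topologicalType) (n : nat)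
  (L : lamination R X n) := Choice.copy (leafspace L) X.

Definition leaf_open (R : realType) (X : topologicalType) (n : nat)
    (L : lamination R X n) : set_system (leafspace L) :=
  fun A => forall c, atlas L c -> forall t z, unit_ball z -> A (psi c (z, t)) ->
    \forall w \near z, A (psi c (w, t)).

Lemma leaf_openT (R : realType) (X : topologicalType) (n : nat)
  (L : lamination R X n) : @leaf_open R X n L setT.
Proof. by move=> c _ t z _ _; apply: filterE. Qed.

Lemma leaf_openI (R : realType) (X : topologicalType) (n : nat)
  (L : lamination R X n) : setI_closed (@leaf_open R X n L).
Proof.
move=> A A' oA oA' c Lc t z Bz [Az A'z].
by apply: filterI; [exact: oA Lc t z Bz Az | exact: oA' Lc t z Bz A'z].
Qed.

Lemma leaf_open_bigU (R : realType) (X : topologicalType) (n : nat)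
    (L : lamination R X n) (I : Type) (A : I -> set (leafspace L)) :
  (forall i, leaf_open (A i)) -> leaf_open (\bigcup_i A i).
Proof.
move=> oA c Lc t z Bz [i _ Aiz].
by apply: filterS (oA i c Lc t z Bz Aiz) => w Aw; exists i.
Qed.

HB.instance Definition _ (R : realType) (X : topologicalType) (n : nat)
    (L : lamination R X n) :=
  isOpenTopological.Build (leafspace L) (@leaf_openT R X n L)
    (@leaf_openI R X n L) (@leaf_open_bigU R X n L).

Definition leaf (R : realType) (X : topologicalType) (n : nat)
    (L : lamination R X n) (x : leafspace L) : set (leafspace L) :=
  connected_component [set: leafspace L] x.

Definition leaf_loop (R : realType) (X : topologicalType) (n : nat)
    (L : lamination R X n) (g : R -> leafspace L) : Prop :=
  [/\ {within `[0, 1], continuous g}, g 0 = g 1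
    & forall s, s \in `[0, 1] -> leaf (g 0) (g s)].

(* A homotopy of loops (s is the parameter of the loops) from g to a constant
   loop, inside of the leaf which contains g. *)
Definition null_homotopic (R : realType) (X : topologicalType) (n : nat)
    (L : lamination R X n) (g : R -> leafspace L) : Prop :=
  exists H : R * R -> leafspace L,
    [/\ {within `[0, 1] `*` `[0, 1], continuous H},
        forall r s, r \in `[0, 1] -> s \in `[0, 1] -> leaf (g 0) (H (r, s)),
        forall s, s \in `[0, 1] -> H (0, s) = g s,
        forall s, s \in `[0, 1] -> H (1, s) = H (1, 0)
      & forall r, r \in `[0, 1] -> H (r, 0) = H (r, 1)].

(* Uniform convergence on [0, 1] in X: a compact Hausdorff space has a unique
   uniform structure, whose entourages are the neighborhoods of the diagonal. *)
Definition uniform_limit (R : realType) (X : topologicalType)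
    (g_ : nat -> R -> X) (g : R -> X) : Prop :=
  forall W : set (X * X), open W -> (forall x, W (x, x)) ->
    \forall k \near \oo, forall s, s \in `[0, 1] -> W (g s, g_ k s).

Definition vanishing_cycle (R : realType) (X : topologicalType) (n : nat)
    (L : lamination R X n) (g : R -> leafspace L) : Prop :=
  [/\ leaf_loop g, ~ null_homotopic g
    & exists g_ : nat -> R -> leafspace L,
        (forall k, leaf_loop (g_ k) /\ null_homotopic (g_ k)) /\
        @uniform_limit R X g_ g].

(** Holomorphic and smooth functions *)

(* V is meant to be open in this definition and the next ones. *)
Definition holomorphic (R : realType) (X : topologicalType) (n : nat)
    (L : lamination R X n) (V : set X) (f : X -> CC R) : Prop :=
  {within V, continuous f} /\
  forall c, atlas L c -> forall p, box p -> V (psi c p) ->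
    differentiable (fun z => f (psi c (z, p.2))) p.1.

Definition leaf_derivative (R : realType) (n : nat) (T : Type)
    (u : 'rV[CC R]_n) (f : 'rV[CC R]_n * T -> R) : 'rV[CC R]_n * T -> R :=
  fun p => Dreal (fun z => f (z, p.2)) p.1 u.

(* All the iterated derivatives of f in the variable z, in real directions us,
   exist and are continuous in (z, t) on the open set W. *)
Definition smooth_box (R : realType) (n : nat) (T : topologicalType)
    (W : set ('rV[CC R]_n * T)) (f : 'rV[CC R]_n * T -> R) : Prop :=
  forall (us : seq 'rV[CC R]_n) p, W p ->
    let F := foldr (@leaf_derivative R n T) f us in
    {for p, continuous F} /\
    forall u, derivable (fun h : R => F (line p.1 u h, p.2)) 0 1.

Definition smooth (R : realType) (X : topologicalType) (n : nat)
    (L : lamination R X n) (V : set X) (f : X -> R) : Prop :=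
  forall c, atlas L c ->
    smooth_box [set p | box p /\ V (psi c p)] (fun p => f (psi c p)).

(** Line bundles *)

(* A Cech cocycle with values in O^*, over the open cover (co_set i). *)
Record cocycle (R : realType) (X : topologicalType) (n : nat)
    (L : lamination R X n) := Cocycle {
  co_index : Type;
  co_set : co_index -> set X;
  co_fun : co_index -> co_index -> X -> CC R;
  co_open : forall i, open (co_set i);
  co_cover : forall x, exists i, co_set i x;
  co_holomorphic : forall i j,
    holomorphic L (co_set i `&` co_set j) (co_fun i j);
  co_neq0 : forall i j x, co_set i x -> co_set j x -> co_fun i j x != 0;
  co_mul : forall i j k x, co_set i x -> co_set j x -> co_set k x ->
    co_fun i k x = co_fun i j x * co_fun j k x }.

Arguments co_index {R X n L} _.
Arguments co_set {R X n L} _ _ _.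
Arguments co_fun {R X n L} _ _ _ _.

(* The cocycles g and h become cohomologous over the cover
   (co_set g i `&` co_set h a), hence define the same element of H^1(X, O^* ). *)
Definition cohomologous (R : realType) (X : topologicalType) (n : nat)
    (L : lamination R X n) (g h : cocycle L) : Prop :=
  exists l : co_index h -> co_index g -> X -> CC R,
    [/\ forall a i, holomorphic L (co_set h a `&` co_set g i) (l a i),
        forall a i x, co_set h a x -> co_set g i x -> l a i x != 0
      & forall a b i j x, co_set h a x -> co_set h b x ->
          co_set g i x -> co_set g j x ->
          l a i x * co_fun g i j x = co_fun h a b x * l b j x].

(* An element of H^1(X, O^* ), as a class of cocycles. *)
Record line_bundle (R : realType) (X : topologicalType) (n : nat)
    (L : lamination R X n) := LineBundle {
  lb_class : set (cocycle L);
  lb_classP : exists g, lb_class = cohomologous g }.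

(* A nowhere zero holomorphic section s over the open set V of the bundle
   defined by g is given by its coordinates s i on V `&` co_set g i, with
   s i = co_fun g i j * s j. *)
Definition nonvanishing_section (R : realType) (X : topologicalType) (n : nat)
    (L : lamination R X n) (g : cocycle L) (V : set X)
    (s : co_index g -> X -> CC R) : Prop :=
  [/\ open V,
      forall i, holomorphic L (V `&` co_set g i) (s i),
      forall i x, V x -> co_set g i x -> s i x != 0
    & forall i j x, V x -> co_set g i x -> co_set g j x ->
        s i x = co_fun g i j x * s j x].

(* A hermitian metric is given by the norms h i of the local frames of the
   bundle over the sets co_set g i: the norm of the section s at x is
   h i x * |s i x| for any i with x in co_set g i. *)
Definition hermitian_metric (R : realType) (X : topologicalType) (n : nat)
    (L : lamination R X n) (g : cocycle L) (h : co_index g -> X -> R) : Prop :=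
  (forall i x, co_set g i x -> 0 < h i x) /\
  (forall i j x, co_set g i x -> co_set g j x ->
     h j x = h i x * absC (co_fun g i j x)).

Definition section_norm (R : realType) (X : topologicalType) (n : nat)
    (L : lamination R X n) (g : cocycle L) (h : co_index g -> X -> R)
    (s : co_index g -> X -> CC R) (i : co_index g) (x : X) : R :=
  h i x * absC (s i x).

Definition smooth_metric (R : realType) (X : topologicalType) (n : nat)
    (L : lamination R X n) (g : cocycle L) (h : co_index g -> X -> R) : Prop :=
  forall V s, nonvanishing_section V s ->
    forall i, smooth L (V `&` co_set g i) (section_norm h s i).

(* The curvature sqrt(-1) delbar del log |s|^2 along the leaves, in the
   coordinate z of the chart c, where N x = |s|(x). *)
Definition curvature (R : realType) (X : topologicalType) (n : nat)
    (c : chart R X n) (N : X -> R) (p : 'rV[CC R]_n * transv c)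
    (u v : 'rV[CC R]_n) : CC R :=
  imC R * delbar_del (fun z => realC (ln (N (psi c (z, p.2)) ^+ 2))) p.1 u v.

Definition positive (R : realType) (X : topologicalType) (n : nat)
    (L : lamination R X n) (E : line_bundle L) : Prop :=
  exists2 g, lb_class E g & exists h : co_index g -> X -> R,
    [/\ hermitian_metric h, smooth_metric h
      & forall V s, nonvanishing_section V s -> forall i c, atlas L c ->
          forall p, box p -> V (psi c p) -> co_set g i (psi c p) ->
          forall u, u != 0 ->
            0 < curvature (section_norm h s i) p u (imC R *: u)].

(** The complex projective space *)

(* Complex lines through 0 in C^(N+1). *)
Definition CP (R : realType) (N : nat) :=
  {V : {vspace 'rV[CC R]_N.+1} | \dim V == 1%N}.

(* Homogeneous coordinates, up to a factor. *)
Definition homogeneous (R : realType) (N : nat) (l : CP R N) :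
  'rV[CC R]_N.+1 := vpick (val l).

Definition affine_open (R : realType) (N : nat) (k : 'I_N.+1) : set (CP R N) :=
  [set l | homogeneous l 0 k != 0].

(* The affine chart affine_open k -> C^N, where C^N is the set of the vectors of
   C^(N+1) of k-th coordinate 1. *)
Definition affine (R : realType) (N : nat) (k : 'I_N.+1) (l : CP R N) :
  'rV[CC R]_N.+1 := (homogeneous l 0 k)^-1 *: homogeneous l.

(* The form (sqrt(-1) / 2) del delbar log |w|^2 = - (sqrt(-1) / 2) delbar del
   log |w|^2 on C^(N+1) \ 0, which is the pull-back of the Fubini-Study form;
   its restriction to the affine hyperplane w_k = 1 is the Fubini-Study form in
   the k-th affine chart. *)
Definition fubini_study (R : realType) (N : nat) (w a b : 'rV[CC R]_N.+1) :
    CC R :=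
  - (imC R / 2) *
  delbar_del (fun w => realC (ln (\sum_(j < N.+1) absC (w 0 j) ^+ 2))) w a b.

(** Maps to the projective space *)

(* The first condition and the continuity of the affine coordinates amount to
   the continuity of f for the topology of CP^N. *)
Definition smooth_CP (R : realType) (X : topologicalType) (n : nat)
    (L : lamination R X n) (N : nat) (f : X -> CP R N) : Prop :=
  forall k, open (f @^-1` affine_open k) /\
    forall j,
      smooth L (f @^-1` affine_open k) (fun x => ReC (affine k (f x) 0 j)) /\
      smooth L (f @^-1` affine_open k) (fun x => ImC (affine k (f x) 0 j)).

(* The derivative along the leaves of f, in the coordinate z of the chart c and
   the k-th affine chart of CP^N. *)
Definition leaf_diff (R : realType) (X : topologicalType) (n N : nat)
    (c : chart R X n) (k : 'I_N.+1) (f : X -> CP R N)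
    (p : 'rV[CC R]_n * transv c) (u : 'rV[CC R]_n) : 'rV[CC R]_N.+1 :=
  \row_j Dcplx (fun z => affine k (f (psi c (z, p.2))) 0 j) p.1 u.

Definition pullback_FS (R : realType) (X : topologicalType) (n N : nat)
    (c : chart R X n) (k : 'I_N.+1) (f : X -> CP R N)
    (p : 'rV[CC R]_n * transv c) (u v : 'rV[CC R]_n) : CC R :=
  fubini_study (affine k (f (psi c p))) (leaf_diff k f p u) (leaf_diff k f p v).

Definition symplectic_embedding (R : realType) (X : topologicalType) (n : nat)
    (L : lamination R X n) (N : nat) (f : X -> CP R N) : Prop :=
  [/\ smooth_CP L f, injective f
    & forall c, atlas L c -> forall p k, box p -> affine_open k (f (psi c p)) ->
        (forall u, leaf_diff k f p u = 0 -> u = 0) /\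
        (forall u, u != 0 -> exists v, pullback_FS k f p u v != 0)].

(** Finite topological dimension *)

(* For a compact space: X embeds topologically in a euclidean space. *)
Definition finite_topological_dimension (R : realType) (X : topologicalType) :
    Prop :=
  exists (m : nat) (f : X -> 'rV[R]_m),
    [/\ injective f, continuous f
      & forall U : set X, open U ->
          exists2 V : set 'rV[R]_m, open V & U = f @^-1` V].

(* Main.v *)
(** Narasimhan and Ramanan's construction of connections from maps to a projective
    space.  Put [A_i (u) = - D_{iu} (ln h_i^2) / 2] over [co_set g i], where [h] is the
    metric of positive curvature.  Suppose that finite families [w^(i)] of smooth complex
    functions satisfy [w^(j) = g_ij w^(i)], without common zeros, and
    [Im <D_u w^(i), w^(i)> = |w^(i)|^2 A_i (u)] along the leaves.  Then they define a smooth
    map to the projective space, which pulls the Fubini-Study form back to [dA / 2]; since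
    [dA (u, iu)] is half the Laplacian of [ln h_i^2] in the plane of [u] and [iu], which is
    negative by positivity, the map is immersive and symplectic on the leaves.
    Such families exist because the connection forms of products of families add up:
    by the Cauchy-Riemann equations the cocycle [g_ai] itself has the form [A_i - A_a], so
    one may take the products of the [g_ai] with a local family with form [A_a], with cut-off
    functions [r_a], and with real smooth functions, whose connection form is zero and which
    are chosen to separate the points of [X] by means of the euclidean embedding. *)

Require Import Defs.
From HB Require Import structures.
From mathcomp Require Import all_boot all_order all_algebra.
From mathcomp Require Import complex.
From mathcomp Require Import all_classical all_reals all_analysis.
From mathcomp Require Import ring lra.
Set Implicit Arguments.
Unset Strict Implicit.
Unset Printing Implicit Defensive.
Import Order.TTheory GRing.Theory Num.Theory.
Import numFieldNormedType.Exports.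
Local Open Scope classical_set_scope.
Local Open Scope ring_scope.

(** * Complex numbers *)

(** The condition on Im <D_u w, w> is an exact identity, and this is why patching costs nothing.
    Multiplying a family by a real function multiplies both sides by its square, the derivative of
    the function contributing only a real multiple of |w|^2, and concatenating families adds the
    identities. So the cut-off functions need not sum to 1, no estimate on their derivatives is
    required, and finitely many of them with no common zero suffice. Two obstacles shape the
    analysis. Holomorphic functions are only known to be continuous and complex differentiable along
    the leaves, while smoothness asks for continuity in (z, t) of all leaf derivatives; instead of
    Cauchy integrals with a parameter, the smoothness of the metric is exploited. And the euclidean
    embedding of X is merely continuous, also along the leaves, so it is composed with the
    projection of a chart onto a fixed transversal before it enters any smooth function. *)

Section ComplexBasics.
Variable R : realType.
Implicit Types (x y z : CC R) (a b : R).

Lemma CC_ext x y : ReC x = ReC y -> ImC x = ImC y -> x = y.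
Proof. by case: x y => [a b] [c d]; rewrite /ReC /ImC /= => -> ->. Qed.

Lemma ReCD x y : ReC (x + y) = ReC x + ReC y.
Proof. by case: x y => [a b] [c d]. Qed.
Lemma ImCD x y : ImC (x + y) = ImC x + ImC y.
Proof. by case: x y => [a b] [c d]. Qed.
Lemma ReCN x : ReC (- x) = - ReC x.
Proof. by case: x. Qed.
Lemma ImCN x : ImC (- x) = - ImC x.
Proof. by case: x. Qed.
Lemma ReCM x y : ReC (x * y) = ReC x * ReC y - ImC x * ImC y.
Proof. by case: x y => [a b] [c d]. Qed.
Lemma ImCM x y : ImC (x * y) = ReC x * ImC y + ImC x * ReC y.
Proof. by case: x y => [a b] [c d]. Qed.
Lemma ReC_real a : ReC (realC a) = a. Proof. by []. Qed.
Lemma ImC_real a : ImC (realC a) = 0. Proof. by []. Qed.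
Lemma ReC_im : ReC (imC R) = 0. Proof. by []. Qed.
Lemma ImC_im : ImC (imC R) = 1. Proof. by []. Qed.
Lemma ReC0 : ReC (0 : CC R) = 0. Proof. by []. Qed.
Lemma ImC0 : ImC (0 : CC R) = 0. Proof. by []. Qed.
Lemma ReC1 : ReC (1 : CC R) = 1. Proof. by []. Qed.
Lemma ImC1 : ImC (1 : CC R) = 0. Proof. by []. Qed.
Definition ReImE := (ReCD, ImCD, ReCN, ImCN, ReCM, ImCM, ReC_real, ImC_real,
  ReC_im, ImC_im, ReC0, ImC0, ReC1, ImC1).

Lemma ReC_sum (I : Type) (r : seq I) (P : pred I) (F : I -> CC R) :
  ReC (\sum_(i <- r | P i) F i) = \sum_(i <- r | P i) ReC (F i).
Proof. exact: (big_morph (@ReC R) ReCD ReC0). Qed.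
Lemma ImC_sum (I : Type) (r : seq I) (P : pred I) (F : I -> CC R) :
  ImC (\sum_(i <- r | P i) F i) = \sum_(i <- r | P i) ImC (F i).
Proof. exact: (big_morph (@ImC R) ImCD ImC0). Qed.

Lemma realCD a b : realC (a + b) = realC a + realC b.
Proof. by apply: CC_ext; rewrite !ReImE ?addr0. Qed.
Lemma realCM a b : realC (a * b) = realC a * realC b.
Proof. by apply: CC_ext; rewrite !ReImE ?mulr0 ?mul0r ?subr0 ?addr0. Qed.
Lemma realCN a : realC (- a) = - realC a.
Proof. by apply: CC_ext; rewrite !ReImE ?oppr0. Qed.
Lemma realC0 : realC (0 : R) = 0. Proof. by []. Qed.
Lemma realC1 : realC (1 : R) = 1. Proof. by []. Qed.
Lemma imCK : imC R * imC R = -1.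
Proof. by apply: CC_ext; rewrite !ReImE ?oppr0; ring. Qed.

Lemma absCE x : absC x ^+ 2 = ReC x ^+ 2 + ImC x ^+ 2.
Proof. by rewrite sqr_sqrtr // addr_ge0 ?sqr_ge0. Qed.
Lemma absC_ge0 x : 0 <= absC x. Proof. exact: sqrtr_ge0. Qed.
Lemma absCM x y : absC (x * y) = absC x * absC y.
Proof.
apply/eqP; rewrite -(@eqrXn2 _ 2) ?absC_ge0 ?mulr_ge0 ?absC_ge0 //; apply/eqP.
by rewrite exprMn !absCE !ReImE; ring.
Qed.
Lemma absC_eq0 x : (absC x == 0) = (x == 0).
Proof.
rewrite -sqrf_eq0 absCE paddr_eq0 ?sqr_ge0 // !sqrf_eq0.
apply/idP/eqP => [/andP[/eqP a0 /eqP b0]|->]; last by rewrite !ReImE eqxx.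
exact: CC_ext.
Qed.
Lemma absC_gt0 x : (0 < absC x) = (x != 0).
Proof. by rewrite lt0r absC_ge0 andbT absC_eq0. Qed.
Lemma absC1 : absC (1 : CC R) = 1.
Proof. by rewrite /absC !ReImE expr1n expr0n addr0 sqrtr1. Qed.
Lemma normCE x : `|x| = realC (absC x).
Proof. exact: normc_def. Qed.
Lemma absC_ReIm x : `|ReC x| <= absC x /\ `|ImC x| <= absC x.
Proof.
split; rewrite -(@ler_pXn2r _ 2) ?nnegrE ?absC_ge0 // real_normK ?num_real // absCE.
  by rewrite lerDl sqr_ge0.
by rewrite lerDr sqr_ge0.
Qed.
Lemma absC_real a : absC (realC a) = `|a|.
Proof. by rewrite /absC !ReImE expr0n addr0 sqrtr_sqr. Qed.
Lemma ltC_real x y : x < y -> ReC x < ReC y /\ ImC x = ImC y.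
Proof. by rewrite ltcE => /andP[/eqP h1 h2]. Qed.
Lemma ltRC a b : (realC a < realC b) = (a < b).
Proof. by rewrite ltcE eqxx. Qed.
(** The order of [CC R] only compares numbers with equal imaginary parts. Radii of balls in complex
    normed modules live in [CC R], and this turns them into real radii. *)
Lemma posC x : 0 < x -> exists2 a, x = realC a & 0 < a.
Proof.
move=> /ltC_real[h1 h2]; exists (ReC x) => //.
by apply: CC_ext; rewrite // -h2.
Qed.

Lemma ReC_cont : continuous (@ReC R).
Proof.
move=> x; apply/(@cvgrPdist_lt _ _ _ _ (nbhs_filter x)) => e e0.
have e0' : 0 < realC e by rewrite -realC0 ltRC.
have /(@cvgrPdist_lt _ _ _ _ (nbhs_filter x))/(_ _ e0') : (y @[y --> x] --> (x : CC R)) by exact: cvg_id.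
apply: filterS => y /=; rewrite normCE ltRC; apply: le_lt_trans.
rewrite (_ : ReC x - ReC y = ReC (x - y)); last by rewrite !ReImE.
by have [] := absC_ReIm (x - y).
Qed.
Lemma ImC_cont : continuous (@ImC R).
Proof.
move=> x; apply/(@cvgrPdist_lt _ _ _ _ (nbhs_filter x)) => e e0.
have e0' : 0 < realC e by rewrite -realC0 ltRC.
have /(@cvgrPdist_lt _ _ _ _ (nbhs_filter x))/(_ _ e0') : (y @[y --> x] --> (x : CC R)) by exact: cvg_id.
apply: filterS => y /=; rewrite normCE ltRC; apply: le_lt_trans.
rewrite (_ : ImC x - ImC y = ImC (x - y)); last by rewrite !ReImE.
by have [] := absC_ReIm (x - y).
Qed.
Lemma realC_cont : continuous (@realC R).
Proof.
move=> x; apply/(@cvgrPdist_lt _ _ _ _ (nbhs_filter x)) => e e0.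
have [d -> d0] := posC e0.
have /cvgrPdist_lt/(_ _ d0) : (y @[y --> x] --> (x : R)) by exact: cvg_id.
apply: filterS => y /=.
by rewrite -realCN -realCD normCE absC_real ltRC.
Qed.

End ComplexBasics.

(** * Real lines, neighbourhoods and euclidean balls in C^m *)

Section Topology.
Variable R : realType.

Lemma line_cont m (z u : 'rV[CC R]_m) : continuous (line z u).
Proof.
move=> h; rewrite /line; apply: cvgD; first exact: cvg_cst.
by apply: cvgZr_tmp; exact: realC_cont.
Qed.
Lemma line0 m (z u : 'rV[CC R]_m) : line z u 0 = z.
Proof. by rewrite /line realC0 scale0r addr0. Qed.

Lemma near_line m (T : topologicalType) (W : set ('rV[CC R]_m * T)) p u :
  open W -> W p -> \forall h \near (0 : R), W (line p.1 u h, p.2).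
Proof.
move=> oW Wp; have : (fun h => (line p.1 u h, p.2)) @ (0 : R) --> p.
  rewrite {2}[p]surjective_pairing; apply: (@cvg_pair _ _ _ (nbhs (0:R)) (nbhs p.1) (nbhs p.2)); last exact: cvg_cst.
  by rewrite -{2}(line0 p.1 u); exact: line_cont.
by apply; apply: open_nbhs_nbhs.
Qed.

(** The norm of row vectors is the sup norm; sums of squares are used instead because the cut-off
    functions need a smooth radius. *)
Lemma nbhs_rV m (z : 'rV[CC R]_m) (A : set 'rV[CC R]_m) : nbhs z A ->
  exists2 d : R, 0 < d & forall w : 'rV[CC R]_m, \sum_(j < m) absC (w 0 j - z 0 j) ^+ 2 < d -> A w.
Proof.
move=> /nbhs_ballP[e /= e0 eA]; have [d ed d0] := posC e0.
exists (d ^+ 2); first by rewrite exprn_gt0.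
move=> w wd; apply: eA; split => // i j.
rewrite -ball_normE /= ed normCE ltRC -(@ltr_pXn2r _ 2) ?nnegrE ?absC_ge0 ?(ltW d0) //.
rewrite (ord1 i); apply: le_lt_trans wd.
rewrite (bigD1 j) //= (_ : absC (w 0 j - z 0 j) = absC (z 0 j - w 0 j)).
  by rewrite lerDl sumr_ge0 // => k _; rewrite sqr_ge0.
by rewrite -(opprB (z 0 j)) -mulN1r absCM -realC1 -realCN absC_real normrN normr1 mul1r.
Qed.

Lemma sum_continuous (T : topologicalType) (x : T) (I : Type) (r : seq I) (F : I -> T -> R) :
  (forall i, {for x, continuous (F i)}) ->
  {for x, continuous (fun y => \sum_(i <- r) F i y)}.
Proof.
move=> cF; elim: r => [|i r IH].
  rewrite (_ : (fun y => _) = cst 0); first exact: cst_continuous.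
  by apply/funext => y; rewrite big_nil.
rewrite (_ : (fun y => _) = (fun y => F i y + \sum_(j <- r) F j y)); last first.
  by apply/funext => y; rewrite big_cons.
apply: (@continuousD _ _ _ (F i) (fun y => \sum_(j <- r) F j y)); [exact: cF|exact: IH].
Qed.

Lemma coordC_cont m (j : 'I_m) : continuous (fun z : 'rV[CC R]_m => z 0 j).
Proof. exact: coord_continuous. Qed.

Lemma sqr_cont (T : topologicalType) (x : T) (f : T -> R) :
  {for x, continuous f} -> {for x, continuous (fun y => f y ^+ 2)}.
Proof.
move=> cf; rewrite (_ : (fun y => _) = (fun y => f y * f y)).
  exact: continuousM.
by apply/funext => y; rewrite expr2.
Qed.

Lemma unit_ball_open m : open (@unit_ball R m).
Proof.
rewrite /unit_ball.
rewrite -[X in open X]/((fun z : 'rV[CC R]_m => \sum_(j < m) absC (z 0 j) ^+ 2) @^-1` [set x | x < 1]).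
apply: open_comp; last exact: open_lt.
move=> z _; apply: sum_continuous => j.
rewrite (_ : (fun y => _) = (fun y : 'rV[CC R]_m => ReC (y 0 j) ^+ 2 + ImC (y 0 j) ^+ 2)); last first.
  by apply/funext => y; rewrite absCE.
apply: continuousD; apply: sqr_cont.
  by apply: (@continuous_comp _ _ _ (fun z : 'rV[CC R]_m => z 0 j) (@ReC R)); [exact: coordC_cont|exact: ReC_cont].
by apply: (@continuous_comp _ _ _ (fun z : 'rV[CC R]_m => z 0 j) (@ImC R)); [exact: coordC_cont|exact: ImC_cont].
Qed.

Lemma box_open m (T : topologicalType) : open (@box R m T).
Proof.
rewrite -[X in open X]/(fst @^-1` @unit_ball R m).
apply: open_comp; last exact: unit_ball_open.
by move=> p _; exact: cvg_fst.
Qed.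

End Topology.

(** * Iterated derivatives along the leaves *)

Section Ck.
Variables (R : realType) (n : nat) (T : topologicalType).
Implicit Types (W : set ('rV[CC R]_n * T)) (F G : 'rV[CC R]_n * T -> R).

Definition leafD F (p : 'rV[CC R]_n * T) (u : 'rV[CC R]_n) (d : R) :=
  is_derive (0 : R) (1 : R) (fun h : R => F (line p.1 u h, p.2)) d.

Lemma leafDE F p u d : leafD F p u d -> leaf_derivative u F p = d.
Proof. by move=> Fd; rewrite /leaf_derivative /Dreal derive1E; case: Fd. Qed.

Lemma derivable_leafD F p u :
  derivable (fun h : R => F (line p.1 u h, p.2)) 0 1 ->
  leafD F p u (leaf_derivative u F p).
Proof. by move=> dF; rewrite /leaf_derivative /Dreal derive1E; exact: derivableP. Qed.

Lemma leafD_near W F G p u d : open W -> W p ->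
  (forall q, W q -> F q = G q) -> leafD F p u d -> leafD G p u d.
Proof.
move=> oW Wp FG; apply: near_eq_is_derive.
by apply: filterS (near_line u oW Wp) => h; exact: FG.
Qed.

Lemma leaf_derivative_near W F G p u : open W -> W p ->
  (forall q, W q -> F q = G q) -> leaf_derivative u F p = leaf_derivative u G p.
Proof.
move=> oW Wp FG; rewrite /leaf_derivative /Dreal !derive1E; apply: near_eq_derive.
by apply: filterS (near_line u oW Wp) => h; exact: FG.
Qed.

Lemma cont_near W F G p : open W -> W p ->
  (forall q, W q -> F q = G q) -> {for p, continuous F} -> {for p, continuous G}.
Proof.
move=> oW Wp FG; rewrite /prop_for /continuous_at -(FG p Wp) => cF.
apply: cvg_trans cF; apply: near_eq_cvg.
by apply: filterS (open_nbhs_nbhs (conj oW Wp)) => q Wq; rewrite FG.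
Qed.

(** Recursion on the order, instead of the lists of directions of [smooth_box], lets products and
    compositions be treated by induction, one derivative at a time. *)
Fixpoint Ck (k : nat) W F : Prop :=
  (forall p, W p -> {for p, continuous F}) /\
  if k is k'.+1 then forall u,
    (forall p, W p -> derivable (fun h : R => F (line p.1 u h, p.2)) 0 1) /\
    Ck k' W (leaf_derivative u F)
  else True.

Lemma Ck_cont k W F : Ck k W F -> forall p, W p -> {for p, continuous F}.
Proof. by case: k => [|k] []. Qed.

Lemma CkS_leafD k W F p u : Ck k.+1 W F -> W p ->
  leafD F p u (leaf_derivative u F p).
Proof. by move=> [_ /(_ u)[dF _]] /dF /derivable_leafD. Qed.

Lemma CkS_D k W F u : Ck k.+1 W F -> Ck k W (leaf_derivative u F).
Proof. by move=> [_ /(_ u)[]]. Qed.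

Lemma Ck_eq k W F G : open W -> (forall p, W p -> F p = G p) -> Ck k W F -> Ck k W G.
Proof.
move=> oW; elim: k F G => [|k IH] F G FG /= [cF dF].
  by split => // p Wp; apply: (cont_near oW Wp FG); exact: cF.
split=> [p Wp|u]; first by apply: (cont_near oW Wp FG); exact: cF.
have [dFu CF] := dF u; split => [p Wp|].
  have := dFu p Wp; apply: near_eq_derivable.
  by apply: filterS (near_line u oW Wp) => h; exact: FG.
apply: IH CF => p Wp; exact: (leaf_derivative_near _ oW Wp FG).
Qed.

Lemma Ck_le k W F : Ck k.+1 W F -> Ck k W F.
Proof.
elim: k F => [|k IH] F /= [cF dF]; first by split.
split=> // u; have [dFu CF] := dF u; split => //; exact: IH.
Qed.

Lemma Ck_sub k W W' F : W' `<=` W -> Ck k W F -> Ck k W' F.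
Proof.
move=> WW'; elim: k F => [|k IH] F /= [cF dF].
  by split => // p /WW'; exact: cF.
split=> [p /WW'|u]; first exact: cF.
have [dFu CF] := dF u; split => [p /WW'|]; [exact: dFu|exact: IH].
Qed.

Lemma Ck_local k W F :
  (forall p, W p -> exists2 W', W' p & Ck k W' F) -> Ck k W F.
Proof.
elim: k F => [|k IH] F loc /=.
  split=> // p /loc[W' W'p [cF _]]; exact: cF.
split=> [p /loc[W' W'p [cF _]]|u]; first exact: cF.
split=> [p /loc[W' W'p [_ /(_ u)[dF _]]]|]; first exact: dF.
apply: IH => p /loc[W' W'p [_ /(_ u)[_ CF]]]; by exists W'.
Qed.

Lemma Ck_intro k W F (G : 'rV[CC R]_n -> 'rV[CC R]_n * T -> R) : open W ->
  (forall p, W p -> {for p, continuous F}) ->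
  (forall u p, W p -> leafD F p u (G u p)) ->
  (forall u, Ck k W (G u)) -> Ck k.+1 W F.
Proof.
move=> oW cF dF CG; split=> // u; split=> [p Wp|]; first by case: (dF u p Wp).
by apply: Ck_eq (CG u) => // p Wp; rewrite (leafDE (dF u p Wp)).
Qed.

Lemma smooth_boxP W F : smooth_box W F <-> forall k, Ck k W F.
Proof.
split=> [sF k|CF].
  (* Each further derivative lengthens the list, so the induction on k must range over all lists. *)
  suff: forall us, Ck k W (foldr (@leaf_derivative R n T) F us) by move/(_ [::]).
  elim: k => [|k IH] us.
    by split => // p /(sF us)[].
  split=> [p /(sF us)[]//|u]; split=> [p /(sF us)[_]|]; first exact.
  exact: (IH (u :: us)).
move=> us; suff H : forall k, Ck k W (foldr (@leaf_derivative R n T) F us).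
  move=> p Wp; have [cF dF] := H 1%N; split; first exact: cF.
  by move=> u; have [] := dF u => /(_ p Wp).
elim: us => [|u us IH] //= k.
exact: (@CkS_D k _ _ u (IH k.+1)).
Qed.

Lemma leafD_cst a p u : leafD (fun=> a) p u 0.
Proof. exact: is_derive_cst. Qed.

Lemma leafDD F G p u a b : leafD F p u a -> leafD G p u b ->
  leafD (fun q => F q + G q) p u (a + b).
Proof. by move=> Fa Gb; exact: is_deriveD. Qed.

Lemma leafDN F p u a : leafD F p u a -> leafD (fun q => - F q) p u (- a).
Proof. by move=> Fa; exact: is_deriveN. Qed.

Lemma leafDM F G p u a b : leafD F p u a -> leafD G p u b ->
  leafD (fun q => F q * G q) p u (a * G p + F p * b).
Proof.
move=> Fa Gb; have := @is_deriveM _ _ _ _ _ _ _ _ Fa Gb.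
by rewrite line0 -surjective_pairing addrC /GRing.scale /= (mulrC a).
Qed.

Lemma leafD_comp g F p u a b : is_derive (F p) 1 g a -> leafD F p u b ->
  leafD (fun q => g (F q)) p u (a * b).
Proof.
move=> ga Fb; apply: (@is_derive1_comp _ g (fun h => F (line p.1 u h, p.2))) => //.
by rewrite line0 -surjective_pairing.
Qed.

Lemma Ck_cst k W a : Ck k W (fun=> a).
Proof.
elim: k a => [|k IH] a; first by split=> // p _; exact: cst_continuous.
split=> [p _|u]; first exact: cst_continuous.
split=> [p _|]; first exact: derivable_cst.
rewrite (_ : leaf_derivative _ _ = fun=> 0) //.
by apply/funext => p; exact: leafDE (leafD_cst _ _ _).
Qed.

Lemma CkD k W F G : open W -> Ck k W F -> Ck k W G -> Ck k W (fun p => F p + G p).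
Proof.
move=> oW; elim: k F G => [|k IH] F G CF CG.
  by split=> // p Wp; apply: continuousD; [exact: Ck_cont CF p Wp|exact: Ck_cont CG p Wp].
apply: (@Ck_intro k _ _ (fun u p => leaf_derivative u F p + leaf_derivative u G p) oW).
- by move=> p Wp; apply: continuousD; [exact: Ck_cont CF p Wp|exact: Ck_cont CG p Wp].
- by move=> u p Wp; exact: leafDD (CkS_leafD u CF Wp) (CkS_leafD u CG Wp).
- by move=> u; apply: IH; exact: CkS_D.
Qed.

Lemma CkM k W F G : open W -> Ck k W F -> Ck k W G -> Ck k W (fun p => F p * G p).
Proof.
move=> oW; elim: k F G => [|k IH] F G CF CG.
  by split=> // p Wp; apply: continuousM; [exact: Ck_cont CF p Wp|exact: Ck_cont CG p Wp].
apply: (@Ck_intro k _ _ (fun u p => leaf_derivative u F p * G p + F p * leaf_derivative u G p) oW).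
- by move=> p Wp; apply: continuousM; [exact: Ck_cont CF p Wp|exact: Ck_cont CG p Wp].
- by move=> u p Wp; exact: leafDM (CkS_leafD u CF Wp) (CkS_leafD u CG Wp).
- move=> u; apply: CkD => //; apply: IH; first exact: CkS_D.
  + exact: Ck_le. + exact: Ck_le. + exact: CkS_D.
Qed.

(** Only [g'] composed with F is required at order k. The derivatives of the inverse, square root,
    logarithm and flat functions are built from such functions again, which closes the inductions on
    k. *)
Lemma Ck_comp k W F g g' : open W ->
  (forall p, W p -> is_derive (F p) 1 g (g' (F p))) ->
  Ck k.+1 W F -> Ck k W (fun p => g' (F p)) -> Ck k.+1 W (fun p => g (F p)).
Proof.
move=> oW gg' CF Cg'.
apply: (@Ck_intro k _ _ (fun u p => g' (F p) * leaf_derivative u F p) oW).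
- move=> p Wp; apply: (@continuous_comp _ _ _ F g); first exact: Ck_cont CF p Wp.
  apply/differentiable_continuous/derivable1_diffP; by case: (gg' p Wp).
- by move=> u p Wp; apply: leafD_comp; [exact: gg'|exact: (CkS_leafD u CF Wp)].
- by move=> u; apply: CkM => //; exact: CkS_D.
Qed.

Lemma Ck0_comp W F g : (forall p, W p -> {for F p, continuous g}) ->
  Ck 0 W F -> Ck 0 W (fun p => g (F p)).
Proof.
move=> cg CF; split=> // p Wp; apply: (@continuous_comp _ _ _ F g).
  exact: Ck_cont CF p Wp.
exact: cg.
Qed.

Lemma Ck_inv k W F : open W -> (forall p, W p -> F p != 0) -> Ck k W F ->
  Ck k W (fun p => (F p)^-1).
Proof.
move=> oW F0; elim: k => [|k IH] CF.
  apply: Ck0_comp CF => p Wp; apply: continuousV; [exact: F0|exact: cvg_id].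
apply: (@Ck_comp k W F GRing.inv (fun x => - 1 * (x^-1 * x^-1)) oW) => //.
  move=> p Wp; have := @is_deriveV R id (F p) 1 1 (F0 p Wp) (is_derive_id _ _).
  by rewrite /GRing.scale /= mulr1 mulN1r -expr2 exprVn.
apply: CkM => //; first exact: Ck_cst.
by apply: CkM => //; apply: IH; exact: Ck_le.
Qed.

Lemma Ck_sqrt k W F : open W -> (forall p, W p -> 0 < F p) -> Ck k W F ->
  Ck k W (fun p => Num.sqrt (F p)).
Proof.
move=> oW F0; elim: k => [|k IH] CF.
  apply: Ck0_comp CF => p Wp; exact: sqrt_continuous.
apply: (@Ck_comp k W F Num.sqrt (fun x => (2 * Num.sqrt x)^-1) oW) => //.
  by move=> p Wp; apply: is_derive1_sqrt; exact: F0.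
apply: Ck_inv => //.
  by move=> p Wp; rewrite mulf_neq0 // gt_eqF // sqrtr_gt0 F0.
apply: CkM => //; first exact: Ck_cst.
by apply: IH; exact: Ck_le.
Qed.

Lemma Ck_ln k W F : open W -> (forall p, W p -> 0 < F p) -> Ck k W F ->
  Ck k W (fun p => ln (F p)).
Proof.
move=> oW F0; case: k => [|k] CF.
  by apply: Ck0_comp CF => p Wp; apply: continuous_ln; exact: F0.
apply: (@Ck_comp k W F (@ln R) (fun x => x^-1) oW) => //.
  by move=> p Wp; apply: is_derive1_ln; exact: F0.
apply: Ck_inv => //; first by move=> p Wp; rewrite gt_eqF // F0.
exact: Ck_le.
Qed.

(** A joint induction, as each function is the derivative of the other up to sign. *)
Lemma Ck_cos_sin k W F : open W -> Ck k W F ->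
  Ck k W (fun p => cos (F p)) /\ Ck k W (fun p => sin (F p)).
Proof.
move=> oW; elim: k => [|k IH] CF.
  by split; apply: Ck0_comp CF => p Wp; [exact: continuous_cos|exact: continuous_sin].
have [cC sC] := IH (Ck_le CF); split.
  apply: (@Ck_comp k W F (@cos R) (fun x => - 1 * sin x) oW) => //.
    by move=> p Wp; rewrite mulN1r; exact: is_derive_cos.
  by apply: CkM => //; exact: Ck_cst.
by apply: (@Ck_comp k W F (@sin R) (@cos R) oW).
Qed.

(** Leaf derivatives only move z, so those of a function which locally depends on t alone are 0. *)
Lemma Ck_transverse k W F : open W -> (forall p, W p -> {for p, continuous F}) ->
  (forall p, W p -> exists W', [/\ open W', W' p & exists G : T -> R, forall q, W' q -> F q = G q.2]) ->
  Ck k W F.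
Proof.
move=> oW cF locF; case: k => [|k]; first by split.
apply: (@Ck_intro k _ _ (fun _ _ => 0) oW) => // [u p Wp|u]; last exact: Ck_cst.
have [W' [oW' W'p [G FG]]] := locF p Wp.
apply: (@leafD_near W' (fun q => G q.2)) => //; first by move=> q /FG.
exact: (is_derive_cst (G p.2)).
Qed.

End Ck.

(** * Curves, symmetry of second derivatives and flat functions *)

Section ChainRule.
Variables (R : realType) (n : nat).
Notation V := 'rV[CC R]_n.
Implicit Types (G : V -> R) (z w u v : V).

Lemma line_add w v (s t : R) : line (line w v s) v t = line w v (s + t).
Proof. by rewrite /line realCD scalerDl addrA. Qed.

Lemma line_comm w u v (s t : R) : line (line w u s) v t = line (line w v t) u s.
Proof. by rewrite /line addrAC. Qed.

Lemma line_is_derive G w v t : derivable (fun h => G (line (line w v t) v h)) 0 1 ->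
  is_derive t (1 : R) (fun h => G (line w v h)) (Dreal G (line w v t) v).
Proof.
move=> dG; rewrite /Dreal derive1E.
have H0 := derivableP dG.
have Hs : is_derive t (1 : R) (fun h : R => h - t) 1.
  have := is_deriveB (is_derive_id t (1:R)) (is_derive_cst t t (1:R)).
  by rewrite subr0.
rewrite -{1}(subrr t) in H0.
have E : (fun h => G (line w v h)) =
    (fun h => G (line (line w v t) v h)) \o (fun h : R => h - t).
  by apply/funext => h /=; rewrite line_add addrC subrK.
rewrite E -[X in is_derive _ _ _ X]mulr1; exact: is_derive1_comp.
Qed.

Lemma MVT_line G w v (a : R) :
  (forall t, `|t| <= `|a| -> derivable (fun h => G (line (line w v t) v h)) 0 1) ->
  exists2 t, `|t| <= `|a| & G (line w v a) - G w = a * Dreal G (line w v t) v.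
Proof.
move=> dG.
have dG' t : `|t| <= `|a| ->
    is_derive t (1 : R) (fun h => G (line w v h)) (Dreal G (line w v t) v).
  by move=> /dG /line_is_derive.
have cG t : `|t| <= `|a| -> {for t, continuous (fun h => G (line w v h))}.
  move=> /dG'[dt _]; exact/differentiable_continuous/derivable1_diffP.
rewrite -{2}(line0 w v).
case: (leP 0 a) => [a0|/ltW a0].
  have sub t : t \in `[0, a] -> `|t| <= `|a|.
    by rewrite in_itv /= => /andP[t0 ta]; rewrite !ger0_norm.
  have [t /sub ta E] := @MVT_segment R (fun h => G (line w v h)) (fun t => Dreal G (line w v t) v)
    0 a a0 (fun t ta => dG' t (sub t (subset_itv_oo_cc ta)))
    (continuous_in_subspaceT (fun t ta => cG t (sub t (set_mem ta)))).
  by exists t => //; rewrite E subr0 mulrC.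
have sub t : t \in `[a, 0] -> `|t| <= `|a|.
  by rewrite in_itv /= => /andP[t0 ta]; rewrite !ler0_norm // lerN2.
have [t /sub ta E] := @MVT_segment R (fun h => G (line w v h)) (fun t => Dreal G (line w v t) v)
  a 0 a0 (fun t ta => dG' t (sub t (subset_itv_oo_cc ta)))
  (continuous_in_subspaceT (fun t ta => cG t (sub t (set_mem ta)))).
by exists t => //; rewrite -opprB E sub0r mulrN opprK mulrC.
Qed.

Lemma near_line2 (c : R -> V) v (A : set V) : {for 0, continuous c} -> nbhs (c 0) A ->
  exists2 d : R, 0 < d & forall h t, `|h| < d -> `|t| < d -> A (line (c h) v t).
Proof.
move=> cc nA.
have : (fun p : R * R => line (c p.1) v p.2) @ nbhs ((0 : R), (0 : R)) --> c 0.
  rewrite -[X in _ --> X](line0 (c 0) v) /line; apply: cvgD.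
    by apply: (@cvg_comp _ _ _ fst c _ (nbhs (0 : R))); [exact: cvg_fst|exact: cc].
  apply: cvgZr_tmp; apply: (@cvg_comp _ _ _ snd (@realC R) _ (nbhs (0 : R))).
    exact: cvg_snd.
  exact: realC_cont.
move=> /(_ A nA) [[U U'] /= [/nbhs_ballP[d /= d0 dU] /nbhs_ballP[e /= e0 eU']] UU'].
exists (Num.min d e); first by rewrite lt_min d0.
move=> h t; rewrite !lt_min => /andP[hd _] /andP[_ te].
apply: (UU' (h, t)); split; [apply: dU|apply: eU'];
  by rewrite -ball_normE /= sub0r normrN.
Qed.

(** By the mean value theorem the increment is s h times the derivative of G in direction v at a
    point between the two ends, which tends to c 0 with h; continuity of that derivative
    concludes. *)
Lemma is_derive_step G (c : R -> V) v (s : R -> R) (s' : R) :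
  {for 0, continuous c} -> is_derive (0 : R) 1 s s' -> s 0 = 0 ->
  (\forall w \near c 0, derivable (fun h => G (line w v h)) 0 1) ->
  {for c 0, continuous (fun w => Dreal G w v)} ->
  is_derive (0 : R) 1 (fun h => G (line (c h) v (s h)) - G (c h)) (s' * Dreal G (c 0) v).
Proof.
move=> cc /is_derive1_caratheodory[q [sE cq q0]] s0 dG cD.
have cs : {for 0, continuous s}.
  rewrite (_ : s = fun h => q h * h).
    apply: continuousM => //; exact: cvg_id.
  by apply/funext => h; have := sE h; rewrite s0 !subr0.
(* The difference quotient of G in direction v, completed by its limit where [s] vanishes, so that
   [m h * q h] is a slope in Caratheodory's criterion for every h. *)
pose m h := if s h == 0 then Dreal G (c 0) v else (G (line (c h) v (s h)) - G (c h)) / s h.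
apply/is_derive1_caratheodory; exists (fun h => m h * q h); split; last first.
  by rewrite q0 /m s0 eqxx mulrC.
- apply: continuousM => //.
  have m0 : m 0 = Dreal G (c 0) v by rewrite /m s0 eqxx.
  rewrite /prop_for /continuous_at m0; apply/cvgrPdist_lt => e e0.
  have cD' := (@cvgrPdist_lt _ _ _ _ (nbhs_filter (c 0)) _ _).1 cD _ e0.
  have [d d0 dP] := near_line2 v cc (filterI dG cD').
  have : \forall h \near 0, `|s h| < d.
    by have /cvgrPdist_lt/(_ _ d0) := cs; apply: filterS => h; rewrite s0 sub0r normrN.
  have : \forall h \near (0:R), `|h| < d.
    by apply/nbhs_ballP; exists d => //= h; rewrite -ball_normE /= sub0r normrN.
  apply: filterS2 => h hd shd; rewrite /m; case: eqP => [_|/eqP sh0].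
    by rewrite subrr normr0.
  have [|t tsh ->] := @MVT_line G (c h) v (s h).
    by move=> t tsh; have [] := dP h t hd (le_lt_trans tsh shd).
  have [_ ] := dP h t hd (le_lt_trans tsh shd).
  by rewrite mulrAC divff // mul1r.
- move=> h; rewrite s0 line0 subrr !subr0.
  have := sE h; rewrite s0 !subr0 => shE.
  rewrite -mulrA -shE /m; case: eqP => [->|/eqP sh0]; last by rewrite divfK.
  by rewrite line0 subrr mulr0.
Qed.

(** Chain rule from continuous partial derivatives: the total increment telescopes into one
    increment per direction, each starting from a point moved by the remaining directions, as in
    [is_derive_step]. *)
Lemma is_derive_curve G z (l : seq (V * (R -> R) * R)) :
  (forall x, List.In x l -> [/\ is_derive (0 : R) 1 x.1.2 x.2, x.1.2 0 = 0,
    \forall w \near z, derivable (fun h => G (line w x.1.1 h)) 0 1 &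
    {for z, continuous (fun w => Dreal G w x.1.1)}]) ->
  is_derive (0 : R) 1 (fun h => G (z + \sum_(x <- l) realC (x.1.2 h) *: x.1.1))
    (\sum_(x <- l) x.2 * Dreal G z x.1.1).
Proof.
have cl (m : seq (V * (R -> R) * R)) :
    (forall x, List.In x m -> is_derive (0 : R) 1 x.1.2 x.2 /\ x.1.2 0 = 0) ->
    let c := fun h => z + \sum_(x <- m) realC (x.1.2 h) *: x.1.1 in
    {for 0, continuous c} /\ c 0 = z.
  elim: m => [|x m IH] lP c.
    have -> : c = fun=> z by apply/funext => h; rewrite /c big_nil addr0.
    by split => //; exact: cst_continuous.
  have [|cc c0] := IH; first by move=> y ym; apply: lP; right.
  have -> : c = fun h => line (z + \sum_(y <- m) realC (y.1.2 h) *: y.1.1) x.1.1 (x.1.2 h).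
    by apply/funext => h; rewrite /c big_cons /line addrCA addrC.
  have [dx x0] := lP x (or_introl erefl).
  split; last by rewrite x0 line0.
  rewrite /line; apply: continuousD; first exact: cc.
  apply: cvgZr_tmp; apply: (@continuous_comp _ _ _ x.1.2 (@realC R)).
    by apply/differentiable_continuous/derivable1_diffP; case: dx.
  exact: realC_cont.
elim: l => [|x l IH] lP.
  rewrite big_nil; under eq_fun do rewrite big_nil addr0.
  exact: is_derive_cst.
have [dx x0 dG cG] := lP x (or_introl erefl).
have [|cc c0] := cl l; first by move=> y yl; have [] := lP y (or_intror yl).
have IH' := IH (fun y yl => lP y (or_intror yl)).
have := @is_derive_step G _ x.1.1 x.1.2 x.2 cc dx x0.
rewrite c0 => /(_ dG cG) H.
have := is_deriveD H IH'; rewrite big_cons.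
rewrite (_ : _ + _ = fun h => G (z + \sum_(y <- x :: l) realC (y.1.2 h) *: y.1.1)) //.
by apply/funext => h /=; rewrite [LHS]/= big_cons /line subrK addrCA [in RHS]addrC.
Qed.

(** Two mean value theorems: in direction u for the increment of G in direction v, then in direction
    v for the derivative of G along u. *)
Lemma second_difference G z u v (h : R) :
  (forall s t, `|s| <= `|h| -> `|t| <= `|h| ->
    let w := line (line z u s) v t in
    derivable (fun k => G (line w u k)) 0 1 /\
    derivable (fun k => Dreal G (line w v k) u) 0 1) ->
  exists s t, [/\ `|s| <= `|h|, `|t| <= `|h| &
    G (line (line z u h) v h) - G (line z u h) - (G (line z v h) - G z) =
    h * (h * Dreal (fun w => Dreal G w u) (line (line z u s) v t) v)].
Proof.
move=> dG; pose K w := G (line w v h) - G w.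
have dG0 s : `|s| <= `|h| -> derivable (fun k => G (line (line z u s) u k)) 0 1.
  have h0 : `|0 : R| <= `|h| by rewrite normr0.
  by move=> sh; have [] := dG s 0 sh h0; rewrite line0.
have dGh s : `|s| <= `|h| -> derivable (fun k => G (line (line (line z u s) v h) u k)) 0 1.
  by move=> sh; have [] := dG s h sh (lexx _).
have EK s : (fun k => K (line (line z u s) u k)) =
    (fun k => G (line (line (line z u s) v h) u k) - G (line (line z u s) u k)).
  by apply/funext => k; congr (G _ - _); exact: line_comm.
have [|s sh KE] := @MVT_line K z u h.
  by move=> s sh; rewrite EK; apply: derivableB (dGh s sh) (dG0 s sh).
have [|t th DE] := @MVT_line (fun w => Dreal G w u) (line z u s) v h.
  by move=> t th; have [] := dG s t sh th.
exists s, t; split => //; rewrite -DE -[LHS]/(K (line z u h) - K z) KE; congr (_ * _).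
rewrite /Dreal !derive1E EK; exact: (deriveB (dGh s sh) (dG0 s sh)).
Qed.

(** The second difference is symmetric in u and v, so the two mixed derivatives agree at some pair
    of points near z; by continuity they differ by at most e at z, for every positive e. *)
Lemma schwarz G z u v :
  (\forall w \near z, [/\ derivable (fun h => G (line w u h)) 0 1,
     derivable (fun h => G (line w v h)) 0 1,
     derivable (fun h => Dreal G (line w v h) u) 0 1 &
     derivable (fun h => Dreal G (line w u h) v) 0 1]) ->
  {for z, continuous (fun w => Dreal (fun w' => Dreal G w' u) w v)} ->
  {for z, continuous (fun w => Dreal (fun w' => Dreal G w' v) w u)} ->
  Dreal (fun w => Dreal G w u) z v = Dreal (fun w => Dreal G w v) z u.
Proof.
have aux2 (a b x e : R) : `|a - x| < e / 2 -> `|b - x| < e / 2 -> `|a - b| <= e.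
  by rewrite !ltr_norml ler_norml => /andP[? ?] /andP[? ?]; apply/andP; split; lra.
move=> dG c1 c2; apply/eqP; rewrite -subr_eq0 -normr_le0.
apply/ler_addgt0Pr => e e0; rewrite add0r.
have e20 : 0 < e / 2 by rewrite divr_gt0.
have c1' := (@cvgrPdist_lt _ _ _ _ (nbhs_filter z) _ _).1 c1 _ e20.
have c2' := (@cvgrPdist_lt _ _ _ _ (nbhs_filter z) _ _).1 c2 _ e20.
have := @filterI _ _ (nbhs_filter z) _ _ dG (@filterI _ _ (nbhs_filter z) _ _ c1' c2').
rewrite -{1}(line0 z u) => /(near_line2 v (@line_cont _ _ z u 0))[d d0 dP].
have d20 : d / 2 != 0 by exact: lt0r_neq0 (divr_gt0 d0 (ltr0Sn _ 1)).
have d2 : `|d / 2| < d by rewrite ger0_norm ?divr_ge0 ?(ltW d0) // ltr_pdivrMr // mulr_natr mulr2n ltrDr.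
have [|s [t [sh th E]]] := @second_difference G z u v (d / 2).
  move=> s t sh th w.
  have [[d1 _ d3 _] _] := dP s t (le_lt_trans sh d2) (le_lt_trans th d2).
  by split; [exact: d1|exact: d3].
have [|s' [t' [sh' th' E']]] := @second_difference G z v u (d / 2).
  move=> s' t' sh' th' w; rewrite /w line_comm.
  have [[_ d1 _ d3] _] := dP t' s' (le_lt_trans th' d2) (le_lt_trans sh' d2).
  by split; [exact: d1|exact: d3].
have [_ [P1 _]] := dP s t (le_lt_trans sh d2) (le_lt_trans th d2).
have [_ [_ P2]] := dP t' s' (le_lt_trans th' d2) (le_lt_trans sh' d2).
rewrite line_comm in E'.
have aux (a b c f : R) : a - b - (c - f) = a - c - (b - f) by ring.
have EE := etrans (esym E) (etrans (aux _ _ _ _) E').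
clear dG dP c1 c2 c1' c2'.
have {}EE := mulfI d20 (mulfI d20 EE).
rewrite (line_comm z v u s' t') in EE.
move: P1 P2 EE; set a := Dreal _ z v; set b := Dreal _ z u.
set x := Dreal _ _ _; set y := Dreal _ _ _ => P1 P2 EE; rewrite -EE in P2.
exact: aux2 P1 P2.
Qed.

End ChainRule.

Section Bump.
Variable R : realType.
Implicit Types x : R.

(* The derivatives of the flat function [bump 0] are combinations of the [bump m]. *)
Definition bump (m : nat) x : R :=
  if 0 < x then x^-1 ^+ m * expR (- x^-1) else 0.

Lemma bump_ge0 m x : 0 <= bump m x.
Proof.
rewrite /bump; case: ifP => // x0.
by rewrite mulr_ge0 ?expR_ge0 // exprn_ge0 // invr_ge0 ltW.
Qed.

Lemma bump_gt0 m x : (0 < bump m x) = (0 < x).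
Proof.
rewrite /bump; case: ifP => [x0|]; last by rewrite ltxx.
by rewrite mulr_gt0 ?expR_gt0 // exprn_gt0 // invr_gt0.
Qed.

Lemma bumpS m x : bump m x = bump m.+1 x * x.
Proof.
rewrite /bump; case: ifP => x0; last by rewrite mul0r.
rewrite exprS [RHS]mulrC !mulrA divff ?gt_eqF //.
by rewrite mul1r.
Qed.

(** With y = 1/x, the exponential of y is the power m + 1 of that of y / (m + 1), which exceeds y /
    (m + 1). *)
Lemma bump_le m x : `|bump m x| <= m.+1%:R ^+ m.+1 * `|x|.
Proof.
rewrite ger0_norm ?bump_ge0 // /bump; case: ifP => x0; last first.
  by rewrite mulr_ge0 // exprn_ge0.
have y0 : 0 < x^-1 by rewrite invr_gt0.
set y := x^-1 in y0 *; rewrite (gtr0_norm x0) -(invrK x) -/y expRN.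
rewrite ler_pdivrMr ?expR_gt0 // mulrAC ler_pdivlMr // -exprSr.
rewrite -{1}(divfK (_ : m.+1%:R != 0) y) ?pnatr_eq0 // exprMn mulrC ler_wpM2l ?exprn_ge0 //.
rewrite -[in leRHS](divfK (_ : m.+1%:R != 0) y) ?pnatr_eq0 // expRM_natr.
apply: lerXn2r; rewrite ?nnegrE ?expR_ge0 ?divr_ge0 ?(ltW y0) //.
by apply: le_trans (expR_ge1Dx _); rewrite lerDr.
Qed.

Lemma bump0_cont m : {for 0, continuous (bump m)}.
Proof.
apply/cvgrPdist_le => e e0.
have b0 : bump m 0 = 0 by rewrite /bump ltxx.
have C0 : 0 < m.+1%:R ^+ m.+1 :> R by rewrite exprn_gt0 // ltr0n.
have d0 : 0 < e / m.+1%:R ^+ m.+1 by rewrite divr_gt0.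
apply/nbhs_ballP; exists (e / m.+1%:R ^+ m.+1) => //= x.
rewrite b0 /ball_ /= !sub0r !normrN => xd.
by apply: le_trans (bump_le m x) _; rewrite mulrC -ler_pdivlMr // ltW.
Qed.

Lemma is_derive_bump m x :
  is_derive x 1 (bump m) ((- m%:R) * bump m.+1 x + bump m.+2 x).
Proof.
have [x0|x0|->] := ltgtP x 0.
- rewrite {2 3}/bump !ltNge (ltW x0) /= mulr0 addr0.
  apply: (@near_eq_is_derive _ _ _ (cst 0)).
  have : \forall y \near x, y < 0 by apply: (@lt_nbhsl); rewrite //.
  by apply: filterS => y y0; rewrite /bump ltNge (ltW y0).
- apply: (@near_eq_is_derive _ _ _ (fun y : R => y^-1 ^+ m * expR (- y^-1))).
    have : \forall y \near x, 0 < y by exact: lt_nbhsr.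
    by apply: filterS => y y0; rewrite /bump y0.
  have xn0 : x != 0 by rewrite gt_eqF.
  have dV := is_deriveV xn0 (is_derive_id x (1:R)).
  have dE := @is_derive1_comp _ expR (fun y => - y^-1) x _ _ (is_derive_expR _) (is_deriveN dV).
  have := is_deriveM (is_deriveX m dV) dE.
  rewrite (_ : _ * _ = (fun y : R => y^-1 ^+ m * expR (- y^-1))); last first.
    by apply/funext => y; rewrite /GRing.mul /= exprfctE.
  move=> H; apply: (is_derive_eq H).
  rewrite /bump x0 /GRing.scale /= exprfctE; case: m {H} => [|m].
    by rewrite -!exprVn; ring.
  by rewrite /= -!exprVn !exprS; ring.
- rewrite {2 3}/bump ltxx mulr0 addr0.
  (* By [bumpS], the slope of [bump m] from 0 is [bump m.+1], which is continuous at 0 with value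
     0. *)
  apply/is_derive1_caratheodory; exists (bump m.+1); split.
  + by move=> y; rewrite {2}/bump ltxx !subr0 bumpS.
  + exact: bump0_cont.
  + by rewrite /bump ltxx.
Qed.

Lemma Ck_bump n (T : topologicalType) k m (W : set ('rV[CC R]_n * T)) F :
  open W -> Ck k W F -> Ck k W (fun p => bump m (F p)).
Proof.
move=> oW; elim: k m => [|k IH] m CF.
  apply: Ck0_comp CF => p Wp.
  have [d _] := is_derive_bump m (F p).
  by apply/differentiable_continuous/derivable1_diffP.
apply: (@Ck_comp _ _ _ k W F (bump m) (fun x => - m%:R * bump m.+1 x + bump m.+2 x)) => //.
  by move=> p _; exact: is_derive_bump.
apply: CkD => //; last by apply: IH; exact: Ck_le.
by apply: CkM => //; [exact: Ck_cst|apply: IH; exact: Ck_le].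
Qed.

End Bump.

(** * Smooth and holomorphic functions on a lamination *)

Definition chart_set (R : realType) (X : topologicalType) (n : nat) (c : chart R X n)
    (V : set X) : set ('rV[CC R]_n * transv c) :=
  [set p | box p /\ V (psi c p)].
Arguments chart_set {R X n} c V p : rename.

Section Charts.
Variables (R : realType) (X : topologicalType) (n : nat) (L : lamination R X n).
Implicit Types (V : set X) (f g : X -> R) (c : chart R X n).

Lemma phi_cont c x : dom c x -> {for x, continuous (phi c)}.
Proof.
move=> cx; have := @phi_continuous R X n c.
rewrite continuous_open_subspace; last exact: dom_open.
by apply; rewrite inE.
Qed.

Lemma psi_cont c p : box p -> {for p, continuous (psi c)}.
Proof.
move=> cp; have := @psi_continuous R X n c.
rewrite continuous_open_subspace; last exact: box_open.
by apply; rewrite inE.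
Qed.

Lemma within_cont V (U : topologicalType) (f : X -> U) : open V ->
  {within V, continuous f} <-> forall x, V x -> {for x, continuous f}.
Proof.
move=> oV; rewrite continuous_open_subspace //.
by split=> cf x Vx; [apply: cf; rewrite inE|apply: cf; rewrite -inE].
Qed.

Lemma chart_set_open c V : open V -> open (chart_set c V).
Proof.
move=> oV; rewrite openE => p [bp Vp].
apply: filterI; first exact: open_nbhs_nbhs (conj (@box_open R n (transv c)) bp).
exact: psi_cont bp _ (open_nbhs_nbhs (conj oV Vp)).
Qed.

Lemma smoothP V f : smooth L V f <->
  forall c, atlas L c -> forall k, Ck k (chart_set c V) (fun p => f (psi c p)).
Proof. by split=> sf c Lc; apply/smooth_boxP; exact: sf. Qed.

Lemma smooth_eq V f g : open V -> (forall x, V x -> f x = g x) ->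
  smooth L V f -> smooth L V g.
Proof.
move=> oV fg /smoothP sf; apply/smoothP => c Lc k.
apply: Ck_eq (sf c Lc k); first exact: chart_set_open.
by move=> p [_ /fg].
Qed.

Lemma smooth_sub V V' f : V' `<=` V -> smooth L V f -> smooth L V' f.
Proof.
move=> V'V /smoothP sf; apply/smoothP => c Lc k.
by apply: Ck_sub (sf c Lc k) => p [bp /V'V].
Qed.

Lemma smooth_local V f : (forall x, V x -> exists2 V', V' x & smooth L V' f) ->
  smooth L V f.
Proof.
move=> loc; apply/smoothP => c Lc k; apply: Ck_local => p [bp /loc[V' V'p /smoothP sf]].
by exists (chart_set c V'); [split|exact: sf].
Qed.

Lemma smooth_cont V f x : open V -> smooth L V f -> V x -> {for x, continuous f}.
Proof.
move=> oV /smoothP sf Vx; have [c Lc cx] := atlas_cover L x.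
have bx := phi_box cx.
have cf : {for phi c x, continuous (fun p => f (psi c p))}.
  by apply: (Ck_cont (sf c Lc 0%N)); split => //; rewrite phiK.
have := @continuous_comp _ _ _ (phi c) (fun p => f (psi c p)) x (phi_cont cx) cf.
rewrite /prop_for /continuous_at /= phiK // => H; apply: cvg_trans H; apply: near_eq_cvg.
apply: filterS (open_nbhs_nbhs (conj (dom_open c) cx)) => y cy.
by rewrite /= phiK.
Qed.

Lemma smooth_cst V a : smooth L V (fun=> a).
Proof. by apply/smoothP => c Lc k; exact: Ck_cst. Qed.

Lemma smoothD V f g : open V -> smooth L V f -> smooth L V g ->
  smooth L V (fun x => f x + g x).
Proof.
move=> oV /smoothP sf /smoothP sg; apply/smoothP => c Lc k.
by apply: CkD (sf c Lc k) (sg c Lc k); exact: chart_set_open.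
Qed.

Lemma smoothM V f g : open V -> smooth L V f -> smooth L V g ->
  smooth L V (fun x => f x * g x).
Proof.
move=> oV /smoothP sf /smoothP sg; apply/smoothP => c Lc k.
by apply: CkM (sf c Lc k) (sg c Lc k); exact: chart_set_open.
Qed.

Lemma smoothN V f : open V -> smooth L V f -> smooth L V (fun x => - f x).
Proof.
move=> oV sf; apply: (@smooth_eq V (fun x => -1 * f x)) => // [x _|].
  by rewrite mulN1r.
by apply: smoothM => //; exact: smooth_cst.
Qed.

Lemma smoothB V f g : open V -> smooth L V f -> smooth L V g ->
  smooth L V (fun x => f x - g x).
Proof. by move=> oV sf sg; apply: smoothD => //; exact: smoothN. Qed.

Lemma smoothX V f m : open V -> smooth L V f -> smooth L V (fun x => f x ^+ m).
Proof.
move=> oV sf; elim: m => [|m IH].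
  by apply: (@smooth_eq V (fun=> 1)) => //; exact: smooth_cst.
apply: (@smooth_eq V (fun x => f x * f x ^+ m)) => // [x _|]; first by rewrite exprS.
exact: smoothM.
Qed.

Lemma smooth_sum V (I : Type) (r : seq I) (F : I -> X -> R) : open V ->
  (forall i, smooth L V (F i)) -> smooth L V (fun x => \sum_(i <- r) F i x).
Proof.
move=> oV sF; elim: r => [|i r IH].
  by apply: (@smooth_eq V (fun=> 0)) => // [x _|]; [rewrite big_nil|exact: smooth_cst].
apply: (@smooth_eq V (fun x => F i x + \sum_(j <- r) F j x)) => // [x _|].
  by rewrite big_cons.
exact: smoothD.
Qed.

Lemma smooth_inv V f : open V -> (forall x, V x -> f x != 0) -> smooth L V f ->
  smooth L V (fun x => (f x)^-1).
Proof.
move=> oV f0 /smoothP sf; apply/smoothP => c Lc k; apply: Ck_inv (sf c Lc k).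
- exact: chart_set_open.
- by move=> p [_ /f0].
Qed.

Lemma smooth_sqrt V f : open V -> (forall x, V x -> 0 < f x) -> smooth L V f ->
  smooth L V (fun x => Num.sqrt (f x)).
Proof.
move=> oV f0 /smoothP sf; apply/smoothP => c Lc k; apply: Ck_sqrt (sf c Lc k).
- exact: chart_set_open.
- by move=> p [_ /f0].
Qed.

Lemma smooth_ln V f : open V -> (forall x, V x -> 0 < f x) -> smooth L V f ->
  smooth L V (fun x => ln (f x)).
Proof.
move=> oV f0 /smoothP sf; apply/smoothP => c Lc k; apply: Ck_ln (sf c Lc k).
- exact: chart_set_open.
- by move=> p [_ /f0].
Qed.

Lemma smooth_cos_sin V f : open V -> smooth L V f ->
  smooth L V (fun x => cos (f x)) /\ smooth L V (fun x => sin (f x)).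
Proof.
move=> oV /smoothP sf; split; apply/smoothP => c Lc k;
  by have [] := Ck_cos_sin (@chart_set_open c V oV) (sf c Lc k).
Qed.

Lemma smooth_bump V f m : open V -> smooth L V f ->
  smooth L V (fun x => bump m (f x)).
Proof.
move=> oV /smoothP sf; apply/smoothP => c Lc k; apply: Ck_bump (sf c Lc k).
exact: chart_set_open.
Qed.

(** Compatibility makes the transverse coordinate of c locally a function of that of any other
    chart, so continuity is enough by [Ck_transverse]. *)
Lemma smooth_transverse c (K : transv c -> R) : atlas L c ->
  (forall x, dom c x -> {for x, continuous (fun y => K (phi c y).2)}) ->
  smooth L (dom c) (fun x => K (phi c x).2).
Proof.
move=> Lc cK; apply/smoothP => d Ld k.
have oW := @chart_set_open d (dom c) (dom_open c).
apply: Ck_transverse => // p [bp cp].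
  exact: (@continuous_comp _ _ _ (psi d) (fun y => K (phi c y).2) p (psi_cont bp) (cK _ cp)).
have [_ [t' /nbhs_interior t'P]] := atlas_compatible Ld Lc (conj bp cp).
have /open_nbhs_nbhs nW : open_nbhs p (chart_set d (dom c)) by [].
exists (interior [set q | overlap c q -> (phi c (psi d q)).2 = t' q.2] `&` chart_set d (dom c)).
split; first by apply: openI => //; exact: open_interior.
  by split => //; exact: nbhs_singleton t'P.
by exists (K \o t') => q [/nbhs_singleton qt' Wq] /=; rewrite qt'.
Qed.

End Charts.

Section Holomorphic.
Variables (R : realType) (X : topologicalType) (n : nat) (L : lamination R X n).
Implicit Types (V : set X) (f g : X -> CC R) (c : chart R X n).

Lemma holomorphic_sub V V' f : open V -> open V' -> V' `<=` V ->
  holomorphic L V f -> holomorphic L V' f.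
Proof.
move=> oV oV' V'V [cf hf]; split; last by move=> c Lc p bp /V'V; exact: hf.
by apply/within_cont => // x /V'V; move: x; apply/within_cont.
Qed.

Lemma holomorphicM V f g : open V -> holomorphic L V f -> holomorphic L V g ->
  holomorphic L V (fun x => f x * g x).
Proof.
move=> oV [/within_cont cf hf] [/within_cont cg hg]; split.
  apply/within_cont => // x Vx; apply: continuousM; [exact: cf|exact: cg].
move=> c Lc p bp Vp.
exact: (@differentiableM (CC R) _ (fun z => f (psi c (z, p.2))) (fun z => g (psi c (z, p.2)))
  p.1 (hf c Lc p bp Vp) (hg c Lc p bp Vp)).
Qed.

Lemma holomorphicDr V f a : open V -> holomorphic L V f ->
  holomorphic L V (fun x => f x + a).
Proof.
move=> oV [/within_cont cf hf]; split.
  apply/within_cont => // x Vx; apply: continuousD; [exact: cf|exact: cst_continuous].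
move=> c Lc p bp Vp.
exact: (@differentiableD (CC R) _ _ (fun z => f (psi c (z, p.2))) (fun z => a)
  p.1 (hf c Lc p bp Vp) (differentiable_cst _ _)).
Qed.

Lemma holomorphic_coord c j : atlas L c -> holomorphic L (dom c) (fun x => (phi c x).1 0 j).
Proof.
move=> Lc; split.
  apply/within_cont; first exact: dom_open.
  move=> x cx; apply: (@continuous_comp _ _ _ (fun x => (phi c x).1) (fun z : 'rV[CC R]_n => z 0 j)).
    apply: (@continuous_comp _ _ _ (phi c) fst); first exact: phi_cont.
    exact: cvg_fst.
  exact: coordC_cont.
move=> d Ld p bp cp.
have [dz _] := atlas_compatible Ld Lc (conj bp cp).
exact: (@differentiable_comp _ _ _ _ (fun z => (phi c (psi d (z, p.2))).1)
  (fun z : 'rV[CC R]_n => z 0 j) _ dz (@differentiable_coord _ _ _ _ 0 j)).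
Qed.

End Holomorphic.

(** * Complex differentiability along real lines *)

Section CauchyRiemann.
Variables (R : realType) (n : nat).
Implicit Types (F : 'rV[CC R]_n -> CC R).

Lemma ReC_realM (a : R) (z : CC R) : ReC (realC a * z) = a * ReC z.
Proof. by rewrite !ReImE mul0r subr0. Qed.
Lemma ImC_realM (a : R) (z : CC R) : ImC (realC a * z) = a * ImC z.
Proof. by rewrite !ReImE mul0r addr0. Qed.
Lemma realCV (a : R) : realC (a^-1) = (realC a)^-1.
Proof.
have [->|a0] := eqVneq a 0; first by rewrite invr0 !realC0 (invr0 (CC R)).
have ra0 : realC a != 0 by rewrite -absC_eq0 absC_real normr_eq0.
by apply: (mulfI ra0); rewrite -realCM !divff.
Qed.

Lemma differentiable_curve F z u : differentiable F z ->
  is_derive (0 : R) 1 (fun h => ReC (F (line z u h))) (ReC ('d F z u)) /\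
  is_derive (0 : R) 1 (fun h => ImC (F (line z u h))) (ImC ('d F z u)).
Proof.
move=> dF.
have H : (fun h : CC R => h^-1 *: ((F \o shift z) (h *: u) - F z)) @ 0^' --> 'd F z u.
  have := @diff_derivable _ _ _ F z u dF; rewrite /derivable => /cvg_ex[l Hl].
  have E : l = 'd F z u.
    rewrite -(deriveE u dF); apply: esym; exact: (cvg_lim (@norm_hausdorff _ _) Hl).
  rewrite -E; exact: Hl.
(* Real increments form a special case of the complex ones, so the limit of the complex difference
   quotient may be restricted to them. *)
have rc : realC h @[h --> (0 : R)^'] --> (0 : CC R)^'.
  move=> A nA; have := @realC_cont R 0 _ nA; rewrite !nbhs_simpl /= => nA'.
  apply: filterS nA' => h hA h0; apply: hA.
  by apply: contra_neq h0 => rh; have := congr1 (@ReC R) rh.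
have h1 (h : R) : h%:A + 0 = h :> R by rewrite addr0 /GRing.scale /= mulr1.
have auxReC (h : R) : ReC ((realC h)^-1 * (F (realC h *: u + z) - F z)) =
    h^-1 * (ReC (F (line z u (h%:A + 0))) - ReC (F (line z u 0))).
  by rewrite -realCV ReC_realM h1 line0 /line (addrC _ z) ReCD ReCN.
have auxImC (h : R) : ImC ((realC h)^-1 * (F (realC h *: u + z) - F z)) =
    h^-1 * (ImC (F (line z u (h%:A + 0))) - ImC (F (line z u 0))).
  by rewrite -realCV ImC_realM h1 line0 /line (addrC _ z) ImCD ImCN.
have H' := @cvg_comp _ _ _ (@realC R) _ _ _ _ rc H.
have HR := @cvg_comp _ _ _ _ (@ReC R) _ _ _ H' (@ReC_cont R _).
have HI := @cvg_comp _ _ _ _ (@ImC R) _ _ _ H' (@ImC_cont R _).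
split.
  have HR' : (fun h : R => h^-1 *: (((fun h => ReC (F (line z u h))) \o shift 0) (h *: 1) - ReC (F (line z u 0)))) @ 0^' --> ReC ('d F z u).
    apply: cvg_trans HR; apply: near_eq_cvg; apply: nearW => h /=.
    exact: (auxReC h).
  by apply: DeriveDef; [apply/cvg_ex; eexists; exact: HR'|exact: (cvg_lim _ HR')].
have HI' : (fun h : R => h^-1 *: (((fun h => ImC (F (line z u h))) \o shift 0) (h *: 1) - ImC (F (line z u 0)))) @ 0^' --> ImC ('d F z u).
  apply: cvg_trans HI; apply: near_eq_cvg; apply: nearW => h /=.
  exact: (auxImC h).
by apply: DeriveDef; [apply/cvg_ex; eexists; exact: HI'|exact: (cvg_lim _ HI')].
Qed.

Lemma differentiable_CR F z u : differentiable F z -> exists a b : R,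
  [/\ is_derive (0 : R) 1 (fun h => ReC (F (line z u h))) a,
      is_derive (0 : R) 1 (fun h => ImC (F (line z u h))) b,
      is_derive (0 : R) 1 (fun h => ReC (F (line z (imC R *: u) h))) (- b) &
      is_derive (0 : R) 1 (fun h => ImC (F (line z (imC R *: u) h))) a].
Proof.
move=> dF; have [Ru Iu] := differentiable_curve u dF.
have [Riu Iiu] := differentiable_curve (imC R *: u) dF.
have E : 'd F z (imC R *: u) = imC R * 'd F z u by rewrite linearZ.
rewrite E !ReImE !mul0r mul1r sub0r in Riu; rewrite E !ReImE !mul0r mul1r add0r in Iiu.
by exists (ReC ('d F z u)), (ImC ('d F z u)); split.
Qed.

End CauchyRiemann.

(** * Holomorphic functions are smooth *)

Section LeafDerivatives.
Variables (R : realType) (X : topologicalType) (n : nat) (L : lamination R X n).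
Implicit Types (V : set X) (c d : chart R X n).

Definition dl c (f : X -> R) (p : 'rV[CC R]_n * transv c) (u : 'rV[CC R]_n) : R :=
  leaf_derivative u (fun q => f (psi c q)) p.

Lemma smooth_leafD V (f : X -> R) c p u : smooth L V f -> atlas L c ->
  chart_set c V p -> leafD (fun q => f (psi c q)) p u (dl f p u).
Proof. by move=> /smoothP sf Lc; apply: CkS_leafD (sf c Lc 1%N). Qed.

Lemma holomorphic_CR V (f : X -> CC R) c p u : holomorphic L V f -> atlas L c ->
  chart_set c V p ->
  dl (fun x => ReC (f x)) p (imC R *: u) = - dl (fun x => ImC (f x)) p u /\
  dl (fun x => ImC (f x)) p (imC R *: u) = dl (fun x => ReC (f x)) p u.
Proof.
move=> [_ hf] Lc [bp Vp]; have df := hf c Lc p bp Vp.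
have [a [b [Ru Iu Riu Iiu]]] := differentiable_CR u df.
rewrite /dl (leafDE (Riu : leafD (fun q => ReC (f (psi c q))) p _ _)).
rewrite (leafDE (Iiu : leafD (fun q => ImC (f (psi c q))) p _ _)).
rewrite (leafDE (Ru : leafD (fun q => ReC (f (psi c q))) p _ _)).
by rewrite (leafDE (Iu : leafD (fun q => ImC (f (psi c q))) p _ _)).
Qed.

End LeafDerivatives.

Section HolomorphicSmooth.
Variables (R : realType) (X : topologicalType) (n : nat) (L : lamination R X n).
Variables (g : cocycle L) (h : co_index g -> X -> R).
Hypotheses (h_metric : hermitian_metric h) (h_smooth : smooth_metric h).
Implicit Types (V : set X).

Lemma co_fun_id i x : co_set g i x -> co_fun g i i x = 1.
Proof.
move=> ix; have := co_mul ix ix ix; rewrite -[LHS]mulr1 => /mulfI H.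
by apply/esym/H/co_neq0.
Qed.

(** The hypothesis on the metric is applied to the section whose coordinate in the frame i is f,
    transported to the other frames by the cocycle. *)
Lemma norm_smooth V (f : X -> CC R) i : open V -> V `<=` co_set g i ->
  holomorphic L V f -> (forall x, V x -> f x != 0) ->
  smooth L V (fun x => h i x * absC (f x)).
Proof.
move=> oV Vi hf f0.
have oVj j : open (V `&` co_set g j) by apply: openI => //; exact: co_open.
have ns : nonvanishing_section V (fun j x => co_fun g j i x * f x).
  split=> // [j|j x Vx jx|j k x Vx jx kx].
  - apply: holomorphicM => //; last first.
      by apply: (holomorphic_sub oV _ _ hf) => // x [].
    apply: (holomorphic_sub _ _ _ (co_holomorphic j i)) => //.
      by apply: openI; exact: co_open.
    by move=> x [Vx jx]; split => //; exact: Vi.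
  - by apply: mulf_neq0; [apply: co_neq0 => //; exact: Vi|exact: f0].
  - by rewrite mulrA -co_mul //; exact: Vi.
have := @h_smooth _ _ ns i; rewrite (setIidl Vi); apply: smooth_eq => // x Vx.
by rewrite /section_norm co_fun_id ?mul1r //; exact: Vi.
Qed.

Lemma h_pos i x : co_set g i x -> 0 < h i x.
Proof. by move=> ix; have [+ _] := h_metric; apply. Qed.

Lemma metric_smooth i : smooth L (co_set g i) (h i).
Proof.
have h1 : holomorphic L (co_set g i) (fun=> 1 : CC R).
  split=> [|c Lc p _ _]; last exact: differentiable_cst.
  by apply: continuous_subspaceT; exact: cst_continuous.
have := @norm_smooth _ _ i (co_open i) (@subset_refl _ _) h1 (fun x _ => oner_neq0 _).
by apply: smooth_eq => [|x _]; [exact: co_open|rewrite absC1 mulr1].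
Qed.

(** The norm of the frame itself is smooth, by the case f = 1, and dividing by it isolates |f +
    a|. *)
Lemma sqr_abs_shift_smooth V (f : X -> CC R) i a : open V -> V `<=` co_set g i ->
  holomorphic L V f -> (forall x, V x -> f x + a != 0) ->
  smooth L V (fun x => absC (f x + a) ^+ 2).
Proof.
move=> oV Vi hf fa.
have hi0 x : V x -> h i x != 0 by move=> /Vi/h_pos; exact: lt0r_neq0.
have s1 := norm_smooth oV Vi (holomorphicDr a oV hf) fa.
have s2 := smooth_inv oV hi0 (smooth_sub Vi (@metric_smooth i)).
apply: smooth_eq (smoothX 2 oV (smoothM oV s1 s2)) => // x Vx.
by rewrite mulrAC divff ?mul1r //; exact: hi0.
Qed.

(* For a constant [a] with [|a| > |f|], the section [f + a] does not vanish, so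
   that [|f + a|^2] is smooth, and [|f + a|^2 - |f - a|^2] is linear in [f]. *)
Lemma holomorphic_smooth V (f : X -> CC R) : open V -> holomorphic L V f ->
  smooth L V (fun x => ReC (f x)) /\ smooth L V (fun x => ImC (f x)).
Proof.
move=> oV hf.
suff H x : V x -> exists V', [/\ V' x, smooth L V' (fun x => ReC (f x)) &
    smooth L V' (fun x => ImC (f x))].
  by split; apply: smooth_local => x /H[V' [? ? ?]]; exists V'.
move=> Vx; have [i ix] := co_cover g x.
(* Since M >= 1, the condition |f|^2 < M, which holds near x, gives |f| < M without a square
   root. *)
pose M := absC (f x) ^+ 2 + 1.
have cf y : V y -> {for y, continuous f}.
  by move: y; apply/within_cont => //; case: hf.
have cN y : V y -> {for y, continuous (fun y => ReC (f y) ^+ 2 + ImC (f y) ^+ 2)}.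
  move=> Vy; apply: continuousD; apply: sqr_cont.
    exact: (@continuous_comp _ _ _ f (@ReC R) _ (cf y Vy) (@ReC_cont R _)).
  exact: (@continuous_comp _ _ _ f (@ImC R) _ (cf y Vy) (@ImC_cont R _)).
pose V' := V `&` co_set g i `&` [set y | ReC (f y) ^+ 2 + ImC (f y) ^+ 2 < M].
have oV' : open V'.
  rewrite openE => y [[Vy iy] fy]; apply: filterI; first by apply: filterI;
    apply: open_nbhs_nbhs; split => //; exact: co_open.
  by apply: (cN y Vy [set r | r < M]); apply: open_nbhs_nbhs; split => //; exact: open_lt.
have V'V : V' `<=` V by move=> y [[]].
have V'i : V' `<=` co_set g i by move=> y [[]].
have hf' := holomorphic_sub oV oV' V'V hf.
have M1 : 1 <= M by rewrite lerDr sqr_ge0.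
have M0 : 0 < M by exact: lt_le_trans M1.
have MM : M <= M ^+ 2 by rewrite expr2 ler_peMl // ltW.
have fa a : absC a = M -> forall y, V' y -> f y + a != 0.
  move=> aM y [_ /= fy]; apply/eqP => /eqP; rewrite addr_eq0 => /eqP fya.
  have : absC (f y) ^+ 2 = absC a ^+ 2.
    by rewrite fya !absCE !ReImE !sqrrN.
  rewrite absCE aM => E; move: fy; rewrite E.
  by rewrite ltNge MM.
have s a : absC a = M -> smooth L V' (fun x => absC (f x + a) ^+ 2).
  by move=> aM; apply: (sqr_abs_shift_smooth oV' V'i hf'); exact: fa.
have aR : absC (realC M) = M by rewrite absC_real gtr0_norm.
have aR' : absC (realC (- M)) = M by rewrite absC_real normrN gtr0_norm.
have ai : absC (imC R) = 1 by rewrite /absC !ReImE expr0n add0r expr1n sqrtr1.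
have aI : absC (imC R * realC M) = M by rewrite absCM ai aR mul1r.
have aI' : absC (imC R * realC (- M)) = M by rewrite absCM ai aR' mul1r.
have Mn0 : M != 0 by rewrite gt_eqF.
exists V'; split.
- split; first by split.
  by rewrite /= /M -absCE ltrDl.
(* |f + M|^2 - |f - M|^2 = 4 M Re f; the shifts by iM and -iM give 4 M Im f in the same way. *)
- have := smoothM oV' (smoothB oV' (s _ aR) (s _ aR')) (@smooth_cst _ _ _ L V' (4 * M)^-1).
  by apply: smooth_eq => // y _; rewrite !absCE !ReImE; field.
- have := smoothM oV' (smoothB oV' (s _ aI) (s _ aI')) (@smooth_cst _ _ _ L V' (4 * M)^-1).
  by apply: smooth_eq => // y _; rewrite !absCE !ReImE; field.
Qed.

End HolomorphicSmooth.

(** * Smoothness under changes of charts *)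

Section Transfer.
Variables (R : realType) (X : topologicalType) (n : nat) (L : lamination R X n).
Hypothesis hol_smooth : forall V (f : X -> CC R), open V -> holomorphic L V f ->
  smooth L V (fun x => ReC (f x)) /\ smooth L V (fun x => ImC (f x)).
Implicit Types (V : set X) (a c d : chart R X n).

Definition rdir (l : 'I_n * bool) : 'rV[CC R]_n :=
  (if l.2 then imC R else 1) *: delta_mx 0 l.1.

Definition rcoord c (l : 'I_n * bool) (x : X) : R :=
  if l.2 then ImC ((phi c x).1 0 l.1) else ReC ((phi c x).1 0 l.1).

Lemma rcoord_smooth c l : atlas L c -> smooth L (dom c) (rcoord c l).
Proof.
move=> Lc; have [sR sI] := hol_smooth (dom_open c) (holomorphic_coord l.1 Lc).
by rewrite /rcoord; case: l.2.
Qed.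

Lemma rV_decomp (z : 'rV[CC R]_n) : z =
  \sum_(l : 'I_n * bool) realC (if l.2 then ImC (z 0 l.1) else ReC (z 0 l.1)) *: rdir l.
Proof.
rewrite -(pair_bigA _ (fun j b => realC (if b then ImC (z 0 j) else ReC (z 0 j)) *: rdir (j, b))) /=.
rewrite [LHS]row_sum_delta; apply: eq_bigr => j _.
rewrite big_bool /rdir /= !scalerA -scalerDl; congr (_ *: _).
by apply: CC_ext; rewrite !ReImE; ring.
Qed.

Lemma In_map (A B : Type) (F : A -> B) (r : seq A) x :
  List.In x [seq F i | i <- r] -> exists i, x = F i.
Proof. by elim: r => [//|i r IH] /= [<-|/IH//]; exists i. Qed.

(** A real line of the chart d is seen in the chart a as a curve which, for small h, stays in one
    plaque and whose real components are the [rcoord a l]; [is_derive_curve] applies to it. *)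
Lemma chart_change V (f : X -> R) a d (p : 'rV[CC R]_n * transv d) u :
  atlas L a -> atlas L d ->
  open V -> V `<=` dom a -> Ck 1 (chart_set a V) (fun q => f (psi a q)) ->
  chart_set d V p ->
  leafD (fun q => f (psi d q)) p u
    (\sum_l dl (rcoord a l) p u * dl f (phi a (psi d p)) (rdir l)).
Proof.
move=> La Ld oV Va CF Vp; have [bp Vpp] := Vp; have ap := Va _ Vpp.
have [_ [t' t'P]] := atlas_compatible Ld La (conj bp ap).
have t0 : (phi a (psi d p)).2 = t' p.2 by exact: (nbhs_singleton t'P (conj bp ap)).
set x0 := psi d p in Vpp ap t0 *.
pose G z := f (psi a (z, (phi a x0).2)).
pose S l h := rcoord a l (psi d (line p.1 u h, p.2)) - rcoord a l x0.
pose ls := [seq (rdir l, S l, dl (rcoord a l) p u) | l <- enum {: 'I_n * bool}].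
have oW := @chart_set_open _ _ _ a V oV.
have Wx0 : chart_set a V (phi a x0) by split; [exact: phi_box|rewrite phiK].
have pairE (q : 'rV[CC R]_n * transv a) : (q.1, q.2) = q by case: q.
have cpair : {for (phi a x0).1, continuous (fun w : 'rV[CC R]_n => (w, (phi a x0).2))}.
  by apply: (@cvg_pair _ _ _ (nbhs (phi a x0).1) (nbhs (phi a x0).1) (nbhs (phi a x0).2));
    [exact: cvg_id|exact: cvg_cst].
have nW : \forall w \near (phi a x0).1, chart_set a V (w, (phi a x0).2).
  by apply: cpair; rewrite pairE; exact: open_nbhs_nbhs.
have lsP x : List.In x ls -> [/\ is_derive (0 : R) 1 x.1.2 x.2, x.1.2 0 = 0,
    \forall w \near (phi a x0).1, derivable (fun h => G (line w x.1.1 h)) 0 1 &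
    {for (phi a x0).1, continuous (fun w => Dreal G w x.1.1)}].
  move=> xls; have [l ->] := In_map xls; split.
  - have := smooth_leafD u (rcoord_smooth l La) Ld (conj bp ap).
    move=> /(fun H => is_deriveB H (is_derive_cst (rcoord a l x0) (0 : R) (1 : R))).
    by rewrite subr0.
  - by rewrite /= /S line0 -surjective_pairing subrr.
  - apply: filterS nW => w Ww.
    by have [_ /(_ (rdir l))[dF _]] := CF; exact: dF Ww.
  - have cD := Ck_cont (CkS_D (rdir l) CF) Wx0.
    rewrite -(pairE (phi a x0)) in cD.
    exact: (@continuous_comp _ _ _ (fun w : 'rV[CC R]_n => (w, (phi a x0).2))
      (leaf_derivative (rdir l) (fun q => f (psi a q))) _ cpair cD).
have := is_derive_curve lsP; rewrite big_map big_enum /=.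
apply: near_eq_is_derive.
have Wh := near_line u (@chart_set_open _ _ _ d V oV) Vp.
(* Along the line p.2 is fixed, hence so is the transverse coordinate t' p.2 in the chart a as long
   as the line stays in the region where t' is valid. *)
have : \forall h \near (0 : R), interior [set q | overlap a q ->
    (phi a (psi d q)).2 = t' q.2] (line p.1 u h, p.2).
  by apply: near_line; [exact: open_interior|exact: t'P].
apply: filterS2 Wh => h [bh Vh] /nbhs_singleton ih.
have ah := Va _ Vh; have {}ih := ih (conj bh ah).
rewrite big_map big_enum /= /G.
have -> : (phi a x0).1 + \sum_l realC (S l h) *: rdir l = (phi a (psi d (line p.1 u h, p.2))).1.
  rewrite [RHS]rV_decomp (rV_decomp (phi a x0).1) -big_split /=.
  by apply: eq_bigr => l _; rewrite -scalerDl -realCD /S addrC subrK.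
by rewrite t0 -ih pairE phiK.
Qed.

Lemma Ck_sum (T : topologicalType) k (W : set ('rV[CC R]_n * T)) (I : Type) (r : seq I)
    (F : I -> 'rV[CC R]_n * T -> R) : open W ->
  (forall i, Ck k W (F i)) -> Ck k W (fun p => \sum_(i <- r) F i p).
Proof.
move=> oW CF; elim: r => [|i r IH].
  by apply: (@Ck_eq _ _ _ _ _ (fun=> 0)) => // [p _|]; [rewrite big_nil|exact: Ck_cst].
apply: (@Ck_eq _ _ _ _ _ (fun p => F i p + \sum_(j <- r) F j p)) => // [p _|].
  by rewrite big_cons.
exact: CkD.
Qed.

(** Needed for the coefficients of the connection form, which are derivatives taken in one chart.
    Each differentiation in d brings in derivatives of the coordinates of a, which are smooth as
    real and imaginary parts of holomorphic functions. *)
Lemma smooth_in_chart V (f : X -> R) a : atlas L a -> open V -> V `<=` dom a ->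
  (forall k, Ck k (chart_set a V) (fun q => f (psi a q))) -> smooth L V f.
Proof.
move=> La oV Va CF; apply/smoothP => d Ld k.
have oW := @chart_set_open _ _ _ d V oV.
have cont (f' : X -> R) p : Ck 0 (chart_set a V) (fun q => f' (psi a q)) ->
    chart_set d V p -> {for p, continuous (fun q => f' (psi d q))}.
  move=> CF' [bp Vp]; have ap := Va _ Vp.
  have cf : {for phi a (psi d p), continuous (fun q => f' (psi a q))}.
    by apply: (Ck_cont CF'); split; [exact: phi_box|rewrite phiK].
  have cpf : {for p, continuous (fun q => phi a (psi d q))}.
    exact: (@continuous_comp _ _ _ (psi d) (phi a) _ (psi_cont bp) (phi_cont ap)).
  have := @continuous_comp _ _ _ (fun q => phi a (psi d q)) (fun q => f' (psi a q)) p cpf cf.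
  apply: (cont_near oW) => // q [bq Vq] /=.
  by rewrite phiK //; exact: Va.
elim: k f CF => [|k IH] f CF; first by split=> // p; exact: cont.
apply: (@Ck_intro _ _ _ k _ _ (fun u p =>
  \sum_l dl (rcoord a l) p u * dl f (phi a (psi d p)) (rdir l)) oW).
- by move=> p; exact: cont.
- by move=> u p; exact: chart_change.
- move=> u; apply: Ck_sum => // l; apply: CkM => //.
    have /smoothP := smooth_sub Va (rcoord_smooth l La).
    by move=> /(_ d Ld k.+1)/(CkS_D u).
  (* The derivative of f in the chart a is regarded as a function on X, so that the induction
     hypothesis covers it. *)
  apply: (IH (fun x => dl f (phi a x) (rdir l))) => m.
  apply: Ck_eq (CkS_D (rdir l) (CF m.+1)); first exact: chart_set_open.
  by move=> q [bq _]; rewrite psiK.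
Qed.

End Transfer.

(** * The Fubini-Study form *)

Section Curves.
Variable R : realType.
Implicit Types (f g : R -> R).

Lemma crv_cst (k : R) : is_derive (0 : R) (1 : R) (fun=> k) 0.
Proof. exact: is_derive_cst. Qed.

Lemma crv_id : is_derive (0 : R) (1 : R) (fun h => h) 1.
Proof. exact: is_derive_id. Qed.

Lemma crvD f g a b : is_derive (0 : R) 1 f a -> is_derive (0 : R) 1 g b ->
  is_derive (0 : R) 1 (fun h => f h + g h) (a + b).
Proof. by move=> fa gb; exact: is_deriveD. Qed.

Lemma crvM f g a b : is_derive (0 : R) 1 f a -> is_derive (0 : R) 1 g b ->
  is_derive (0 : R) 1 (fun h => f h * g h) (f 0 * b + a * g 0).
Proof.
move=> fa gb; have := is_deriveM fa gb.
by rewrite /GRing.scale /= (mulrC a).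
Qed.

Lemma crvV f a : f 0 != 0 -> is_derive (0 : R) 1 f a ->
  is_derive (0 : R) 1 (fun h => (f h)^-1) (- (f 0) ^- 2 * a).
Proof. by move=> f0 fa; exact: is_deriveV. Qed.

End Curves.

Section DelBar.
Variables (R : realType) (m : nat).
Notation V := 'rV[CC R]_m.
Implicit Types (phi : V -> R) (z u v : V).

Lemma DrealZ (k : R) phi z u : derivable (fun h => phi (line z u h)) 0 1 ->
  Dreal (fun w => k * phi w) z u = k * Dreal phi z u.
Proof.
move=> d; rewrite /Dreal !derive1E.
by have := @deriveZ _ _ _ (fun h => phi (line z u h)) k 0 1 d.
Qed.

Lemma Dreal_cst (k : R) z u : Dreal (fun=> k) z u = 0.
Proof. by rewrite /Dreal derive1E; have [_ ->] := @is_derive_cst R R R k 0 1. Qed.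

Lemma half_realC : (2^-1 : CC R) = realC (2^-1).
Proof. by rewrite realCV (realCD 1 1). Qed.

Lemma del_realE phi z u : del (fun w => realC (phi w)) z u =
  realC (2^-1 * Dreal phi z u) - imC R * realC (2^-1 * Dreal phi z (imC R *: u)).
Proof.
rewrite /del /Dcplx half_realC; under eq_fun do rewrite ReC_real.
by apply: CC_ext; rewrite !ReImE !Dreal_cst; ring.
Qed.

(** The curvature and the Fubini-Study form are imaginary multiples of [delbar_del], so this
    imaginary part determines their real parts. *)
Lemma ImC_delbar_del phi z u v :
  (forall a b, derivable (fun h => Dreal phi (line z a h) b) 0 1) ->
  let DD a b := Dreal (fun w => Dreal phi w b) z a in
  ImC (delbar_del (fun w => realC (phi w)) z u v) =
  4^-1 * (DD (imC R *: u) v - DD u (imC R *: v) - DD (imC R *: v) u + DD v (imC R *: u)).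
Proof.
move=> dphi DD.
have E a b : ImC (delbar (fun w => del (fun w' => realC (phi w')) w b) z a) =
    4^-1 * (DD (imC R *: a) b - DD a (imC R *: b)).
  pose F w := del (fun w' => realC (phi w')) w b.
  have FR : (fun w => ReC (F w)) = (fun w => 2^-1 * Dreal phi w b).
    by apply/funext => w; rewrite /F del_realE !ReImE; ring.
  have FI : (fun w => ImC (F w)) = (fun w => - 2^-1 * Dreal phi w (imC R *: b)).
    by apply/funext => w; rewrite /F del_realE !ReImE; ring.
  rewrite /delbar /Dcplx half_realC -/F FR FI.
  rewrite !DrealZ; [|exact: dphi|exact: dphi|exact: dphi|exact: dphi].
  have alg (A B C D : R) : ImC (realC 2^-1 * (realC (2^-1 * A) + imC R * realC (- 2^-1 * B)
      + imC R * (realC (2^-1 * C) + imC R * realC (- 2^-1 * D)))) = 4^-1 * (C - B).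
    by rewrite !ReImE; field.
  exact: alg.
have alg (A B C D : R) : 4^-1 * (A - B) - 4^-1 * (C - D) = 4^-1 * (A - B - C + D) by ring.
by rewrite /delbar_del ImCD ImCN -alg; congr (_ - _); exact: E.
Qed.

End DelBar.

Section FubiniStudy.
Variables (R : realType) (m : nat).
Notation V := 'rV[CC R]_m.
Implicit Types (w a b u v : V).

Definition cj (z : CC R) : CC R := Complex (ReC z) (- ImC z).

Lemma Re_cj z : ReC (cj z) = ReC z. Proof. by []. Qed.
Lemma Im_cj z : ImC (cj z) = - ImC z. Proof. by []. Qed.

Lemma cjM x y : cj (x * y) = cj x * cj y.
Proof. by apply: CC_ext; rewrite ReImE /cj /= !ReImE /ReC /ImC /=; ring. Qed.

Lemma cjD x y : cj (x + y) = cj x + cj y.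
Proof. by apply: CC_ext; rewrite ReImE /cj /= !ReImE /ReC /ImC /=; ring. Qed.

Lemma mul_cj x : x * cj x = realC (absC x ^+ 2).
Proof. by apply: CC_ext; rewrite !ReImE ?absCE /ReC /ImC /=; ring. Qed.

Definition herm a b : CC R := \sum_j b 0 j * cj (a 0 j).

Lemma herm_comb (x y x' y' : CC R) a b w :
  herm (x *: a + y *: w) (x' *: b + y' *: w) =
  cj x * x' * herm a b + cj x * y' * herm a w + cj y * x' * herm w b + cj y * y' * herm w w.
Proof.
rewrite /herm !mulr_sumr -!big_split /=; apply: eq_bigr => j _.
by rewrite !mxE cjD !cjM; ring.
Qed.

Lemma Re_herm a b : ReC (herm a b) =
  \sum_j (ReC (a 0 j) * ReC (b 0 j) + ImC (a 0 j) * ImC (b 0 j)).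
Proof.
by rewrite /herm ReC_sum; apply: eq_bigr => j _; rewrite !ReImE /cj /ReC /ImC /=; ring.
Qed.

Lemma Im_herm a b : ImC (herm a b) =
  \sum_j (ReC (a 0 j) * ImC (b 0 j) - ImC (a 0 j) * ReC (b 0 j)).
Proof.
by rewrite /herm ImC_sum; apply: eq_bigr => j _; rewrite !ReImE /cj /ReC /ImC /=; ring.
Qed.

Definition nrm2 w : R := \sum_j absC (w 0 j) ^+ 2.

Lemma herm_nrm2 w : herm w w = realC (nrm2 w).
Proof.
rewrite /herm /nrm2 (big_morph (@realC R) (@realCD R) (realC0 R)).
by apply: eq_bigr => j _; rewrite mul_cj.
Qed.

(** The numerator of the Fubini-Study hermitian form on the cone: its imaginary part over |w|^4 is
    the real part of [fubini_study] for nonzero w. *)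
Definition fs_form w a b : CC R := herm a b * herm w w - herm w b * herm a w.

(** Projective invariance: multiples of w are in the kernel of the form. In use, x is the inverse of
    an affine denominator, and y, y' come from differentiating it. *)
Lemma fs_form_scale (x y y' : CC R) w a b :
  fs_form (x *: w) (x *: a + y *: w) (x *: b + y' *: w) =
  realC (absC x ^+ 4) * fs_form w a b.
Proof.
have h1 c : herm (x *: w) c = herm (x *: w + 0 *: w) (1 *: c + 0 *: w).
  by rewrite scale1r !scale0r !addr0.
have h2 c : herm c (x *: w) = herm (1 *: c + 0 *: w) (x *: w + 0 *: w).
  by rewrite scale1r !scale0r !addr0.
have cj0 : cj 0 = 0 by apply: CC_ext; rewrite /cj /ReC /ImC /= ?oppr0.
have cj1 : cj 1 = 1 by apply: CC_ext; rewrite /cj /ReC /ImC /= ?oppr0.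
rewrite /fs_form (_ : absC x ^+ 4 = absC x ^+ 2 * absC x ^+ 2); last by ring.
rewrite realCM -!mul_cj herm_comb.
have -> : herm (x *: w) (x *: w) = x * cj x * herm w w.
  by rewrite -{1}(addr0 (x *: w)) -{2}(addr0 (x *: w)) -(scale0r w) herm_comb cj0; ring.
have -> : herm (x *: w) (x *: b + y' *: w) = cj x * (x * herm w b + y' * herm w w).
  by rewrite -(addr0 (x *: w)) -[in LHS](scale0r w) herm_comb cj0; ring.
have -> : herm (x *: a + y *: w) (x *: w) = x * (cj x * herm a w + cj y * herm w w).
  by rewrite -(addr0 (x *: w)) -[in LHS](scale0r w) herm_comb; ring.
ring.
Qed.

Lemma hermZl (x : CC R) a b : herm (x *: a) b = cj x * herm a b.
Proof.
by rewrite /herm mulr_sumr; apply: eq_bigr => j _; rewrite !mxE cjM; ring.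
Qed.

Lemma hermZr (x : CC R) a b : herm a (x *: b) = x * herm a b.
Proof.
by rewrite /herm mulr_sumr; apply: eq_bigr => j _; rewrite !mxE; ring.
Qed.

Lemma hermDl a b c : herm (a + b) c = herm a c + herm b c.
Proof.
by rewrite /herm -big_split /=; apply: eq_bigr => j _; rewrite !mxE cjD; ring.
Qed.

Lemma hermDr a b c : herm a (b + c) = herm a b + herm a c.
Proof.
by rewrite /herm -big_split /=; apply: eq_bigr => j _; rewrite !mxE; ring.
Qed.

Lemma hermC a b : herm b a = cj (herm a b).
Proof.
apply: CC_ext; rewrite ?Re_cj ?Im_cj ?Re_herm ?Im_herm ?sumrN -?sumrN; apply: eq_bigr => j _; ring.
Qed.

Lemma cj_real (x : R) : cj (realC x) = realC x.
Proof. by apply: CC_ext; rewrite /cj /ReC /ImC /= ?oppr0. Qed.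

Lemma cj_im : cj (imC R) = - imC R.
Proof. by apply: CC_ext; rewrite /cj /ReC /ImC /= ?oppr0. Qed.

Lemma Re_herm_line w a b (h : R) :
  ReC (herm (line w a h) b) = ReC (herm w b) + h * ReC (herm a b).
Proof. by rewrite /line hermDl hermZl cj_real !ReImE mul0r subr0. Qed.

Lemma nrm2_herm w : nrm2 w = ReC (herm w w).
Proof. by rewrite herm_nrm2. Qed.

Lemma nrm2_line w a (h : R) :
  nrm2 (line w a h) = nrm2 w + (h * (2 * ReC (herm w a)) + h * (h * nrm2 a)).
Proof.
rewrite !nrm2_herm Re_herm_line /line !hermDr !hermZr !ReImE (hermC w a).
by rewrite Re_cj; ring.
Qed.

Lemma nrm2_line_is_derive w a :
  is_derive (0 : R) 1 (fun h => nrm2 (line w a h)) (2 * ReC (herm w a)).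
Proof.
have E : (fun h => nrm2 (line w a h)) =
    (fun h => nrm2 w + (h * (2 * ReC (herm w a)) + h * (h * nrm2 a))).
  by apply/funext => h; exact: nrm2_line.
have := crvD (crv_cst (nrm2 w)) (crvD (crvM (crv_id R) (crv_cst (2 * ReC (herm w a))))
  (crvM (crv_id R) (crvM (crv_id R) (crv_cst (nrm2 a))))).
rewrite -E [X in is_derive _ _ _ X -> _](_ : _ = 2 * ReC (herm w a)); last by ring.
exact.
Qed.

Lemma ln_nrm2_is_derive w a : 0 < nrm2 w ->
  is_derive (0 : R) 1 (fun h => ln (nrm2 (line w a h)))
    (2 * ReC (herm w a) / nrm2 w).
Proof.
move=> w0; rewrite [X in is_derive _ _ _ X]mulrC.
apply: (@is_derive1_comp _ (@ln R) (fun h => nrm2 (line w a h))).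
  by rewrite line0; exact: is_derive1_ln.
exact: nrm2_line_is_derive.
Qed.

Lemma Dreal_ln_nrm2 w b : 0 < nrm2 w ->
  Dreal (fun w => ln (nrm2 w)) w b = 2 * ReC (herm w b) / nrm2 w.
Proof. by move=> w0; rewrite /Dreal derive1E; have [_ ->] := ln_nrm2_is_derive b w0. Qed.

Lemma DDreal_ln_nrm2 w a b : 0 < nrm2 w ->
  is_derive (0 : R) 1 (fun h => Dreal (fun w => ln (nrm2 w)) (line w a h) b)
    (2 * ReC (herm a b) / nrm2 w
     - 4 * ReC (herm w b) * ReC (herm w a) / nrm2 w ^+ 2).
Proof.
move=> w0; have w0' : nrm2 w != 0 by rewrite gt_eqF.
apply: (@near_eq_is_derive _ _ _ (fun h : R =>
    2 * (ReC (herm w b) + h * ReC (herm a b)) * (nrm2 (line w a h))^-1)).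
  have cN : {for (0 : R), continuous (fun h => nrm2 (line w a h))}.
    apply/differentiable_continuous/derivable1_diffP.
    by have [] := nrm2_line_is_derive w a.
  have : nbhs (nrm2 (line w a 0)) [set r | 0 < r].
    by apply: open_nbhs_nbhs; split; [exact: open_gt|rewrite /= line0].
  move=> nb; have {}nb : \forall h \near (0 : R), 0 < nrm2 (line w a h) := cN _ nb.
  apply: filterS nb => h h0.
  by rewrite Dreal_ln_nrm2 // Re_herm_line.
have N0 : nrm2 (line w a 0) != 0 by rewrite line0.
have := crvM (crvM (crv_cst 2) (crvD (crv_cst (ReC (herm w b)))
  (crvM (crv_id R) (crv_cst (ReC (herm a b)))))) (crvV N0 (nrm2_line_is_derive w a)).
rewrite line0; move: (ReC (herm w b)) (ReC (herm a b)) (ReC (herm w a)) (nrm2 w) w0' => A B C N N0'.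
have -> : 2 * (A + 0 * B) * (- N ^- 2 * (2 * C)) +
    (2 * (0 + (0 * 0 + 1 * B)) + 0 * (A + 0 * B)) * N^-1 = 2 * B / N - 4 * A * C / N ^+ 2 by field.
exact.
Qed.

Lemma Re_delbar_del_ln w a b : 0 < nrm2 w ->
  2^-1 * ImC (delbar_del (fun w => realC (ln (nrm2 w))) w a b) =
  ImC (fs_form w a b) / nrm2 w ^+ 2.
Proof.
move=> w0; have w0' : nrm2 w != 0 by rewrite gt_eqF.
have DDE u v : Dreal (fun w' => Dreal (fun w => ln (nrm2 w)) w' v) w u =
    2 * ReC (herm u v) / nrm2 w - 4 * ReC (herm w v) * ReC (herm w u) / nrm2 w ^+ 2.
  by rewrite {1}/Dreal derive1E; have [_ ->] := DDreal_ln_nrm2 u v w0.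
rewrite ImC_delbar_del; last by move=> u v; have [] := DDreal_ln_nrm2 u v w0.
pose K u v := 2 * ReC (herm u v) / nrm2 w - 4 * ReC (herm w v) * ReC (herm w u) / nrm2 w ^+ 2.
transitivity (2^-1 * (4^-1 * (K (imC R *: a) b - K a (imC R *: b) - K (imC R *: b) a +
    K b (imC R *: a)))).
  by congr (_ * (_ * (_ - _ - _ + _))); exact: DDE.
rewrite {}/K.
rewrite (hermZl (imC R) a b) (hermZr (imC R) a b) (hermZl (imC R) b a) (hermZr (imC R) b a).
rewrite (hermZr (imC R) w a) (hermZr (imC R) w b) cj_im /fs_form herm_nrm2.
rewrite (hermC w a) (hermC a b).
move: (herm a b) (herm w a) (herm w b) (nrm2 w) w0' => A B C N N0.
by rewrite !ReImE !Re_cj !Im_cj; field.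
Qed.

End FubiniStudy.

(** * Connection forms and curvature *)

(** The algebra behind [conn_fs_form], with v = iu: [s] is |w|^2, [b] and [q] are the real and
    imaginary parts of the products of w with its derivatives, [om] is the imaginary part for the
    two derivatives, [e] and [l] are derivatives of [ell] of orders 1 and 2. The terms [- eu] and
    [- luu] come from iv = -u. *)
Lemma conn_algebra (R : realType)
    (rab om s bu bv eu ev qu qv duqv dvqu dus dvs luu lvv : R) :
  dus = 2 * bu -> dvs = 2 * bv -> duqv - dvqu = 2 * om ->
  2 * duqv = - (dus * - eu + s * - luu) -> 2 * dvqu = - (dvs * ev + s * lvv) ->
  2 * qv = - (s * - eu) -> 2 * qu = - (s * ev) ->
  rab * 0 + om * s - (bv * - qu + qv * bu) = 4^-1 * s ^+ 2 * (luu + lvv).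
Proof.
move=> -> -> e1 e2 e3 e4 e5.
have -> : om = 4^-1 * ((2 * bu * eu + s * luu) + (2 * bv * ev + s * lvv)) by lra.
have -> : qv = 2^-1 * (s * eu) by lra.
have -> : qu = - 2^-1 * (s * ev) by lra.
by field.
Qed.

Section Connection.
Variables (R : realType) (n : nat) (T : topologicalType).
Variable W : set ('rV[CC R]_n * T).
Hypothesis oW : open W.
Implicit Types F G : 'rV[CC R]_n * T -> R.

Lemma leafD_sum (I : Type) (r : seq I) (F : I -> 'rV[CC R]_n * T -> R) p u (d : I -> R) :
  (forall i, leafD (F i) p u (d i)) ->
  leafD (fun q => \sum_(i <- r) F i q) p u (\sum_(i <- r) d i).
Proof.
move=> Fd; elim: r => [|i r IH].
  rewrite big_nil (_ : (fun q => _) = fun=> 0); first exact: leafD_cst.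
  by apply/funext => q; rewrite big_nil.
rewrite big_cons (_ : (fun q => _) = fun q => F i q + \sum_(j <- r) F j q).
  exact: leafDD.
by apply/funext => q; rewrite big_cons.
Qed.

(** Directional derivatives are taken one direction at a time; oddness in the direction serves i(iu)
    = -u. *)
Lemma leafD_oppdir F p u d : leafD F p u d -> leafD F p (- u) (- d).
Proof.
move=> Fd; have H : is_derive (0 : R) (1 : R) (fun h : R => - h) (- 1).
  exact: is_deriveNid.
rewrite -mulrN1 /leafD.
rewrite (_ : (fun h => _) = (fun h => F (line p.1 u h, p.2)) \o (fun h : R => - h)).
  by apply: is_derive1_comp => //; rewrite oppr0.
by apply/funext => h /=; rewrite /line realCN scalerN scaleNr.
Qed.

Lemma leaf_schwarz F p u v : (forall k, Ck k W F) -> W p ->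
  leaf_derivative v (leaf_derivative u F) p = leaf_derivative u (leaf_derivative v F) p.
Proof.
move=> CF Wp.
have pairE (q : 'rV[CC R]_n * T) : (q.1, q.2) = q by case: q.
have cpair : {for p.1, continuous (fun w : 'rV[CC R]_n => (w, p.2))}.
  by apply: (@cvg_pair _ _ _ (nbhs p.1) (nbhs p.1) (nbhs p.2)); [exact: cvg_id|exact: cvg_cst].
have nW : \forall w \near p.1, W (w, p.2).
  by apply: cpair; rewrite pairE; exact: open_nbhs_nbhs.
have dF G w a : (forall k, Ck k W G) -> W (w, p.2) ->
    derivable (fun h => G (line w a h, p.2)) 0 1.
  by move=> CG Ww; have [_ /(_ a)[dG _]] := CG 1%N; exact: dG Ww.
have cF a b : {for p.1, continuous (fun w => leaf_derivative a (leaf_derivative b F) (w, p.2))}.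
  have cD := Ck_cont (CkS_D a (CkS_D b (CF 2%N))) Wp; rewrite -(pairE p) in cD.
  exact: (@continuous_comp _ _ _ (fun w : 'rV[CC R]_n => (w, p.2)) _ _ cpair cD).
apply: (@schwarz R n (fun z => F (z, p.2)) p.1 u v _ (cF v u) (cF u v)).
apply: filterS nW => w Ww; split; [exact: dF|exact: dF| |].
- by apply: (dF (leaf_derivative u F)) => // k; exact: CkS_D.
- by apply: (dF (leaf_derivative v F)) => // k; exact: CkS_D.
Qed.

Variables (m : nat) (x y : 'I_m -> 'rV[CC R]_n * T -> R) (ell : 'rV[CC R]_n * T -> R).
Hypotheses (Cx : forall j k, Ck k W (x j)) (Cy : forall j k, Ck k W (y j)).
Hypothesis Cell : forall k, Ck k W ell.
Notation D := leaf_derivative.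

Let S q := \sum_j (x j q * x j q + y j q * y j q).
Let Q v q := \sum_j (D v (y j) q * x j q - D v (x j) q * y j q).

(* The family [w = x + iy] has the connection form [A (v) = - D_{iv} ell / 2]. *)
Hypothesis conn : forall q v, W q -> 2 * Q v q = - (S q * D (imC R *: v) ell q).

Lemma Q_deriv u v p : W p -> leafD (Q v) p u
  (\sum_j ((D u (D v (y j)) p * x j p + D v (y j) p * D u (x j) p)
          - (D u (D v (x j)) p * y j p + D v (x j) p * D u (y j) p))).
Proof.
move=> Wp; apply: leafD_sum => j; apply: leafDD; last apply: leafDN.
  apply: leafDM; first exact: (CkS_leafD u (CkS_D v (Cy j 2)) Wp).
  exact: (CkS_leafD u (Cx j 1) Wp).
apply: leafDM; first exact: (CkS_leafD u (CkS_D v (Cx j 2)) Wp).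
exact: (CkS_leafD u (Cy j 1) Wp).
Qed.

Lemma S_deriv u p : W p -> leafD S p u
  (2 * \sum_j (x j p * D u (x j) p + y j p * D u (y j) p)).
Proof.
move=> Wp; rewrite mulr_sumr; apply: leafD_sum => j.
have Ex := leafDM (CkS_leafD u (Cx j 1) Wp) (CkS_leafD u (Cx j 1) Wp).
have Ey := leafDM (CkS_leafD u (Cy j 1) Wp) (CkS_leafD u (Cy j 1) Wp).
have alg (a b a' b' : R) : a' * a + a * a' + (b' * b + b * b') = 2 * (a * a' + b * b') by ring.
by rewrite -alg; exact: leafDD Ex Ey.
Qed.

Lemma conn_deriv u v p : W p ->
  2 * D u (Q v) p = - (D u S p * D (imC R *: v) ell p + S p * D u (D (imC R *: v) ell) p).
Proof.
move=> Wp.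
have dQ := leafDM (leafD_cst 2 p u) (Q_deriv u v Wp).
have dS := leafDN (leafDM (S_deriv u Wp) (CkS_leafD u (CkS_D (imC R *: v) (Cell 2)) Wp)).
have dQ' : leafD (fun q => 2 * Q v q) p u
    (- (2 * (\sum_j (x j p * D u (x j) p + y j p * D u (y j) p)) * D (imC R *: v) ell p +
     S p * D u (D (imC R *: v) ell) p)).
  apply: (leafD_near oW Wp _ dS) => q Wq; exact/esym/conn.
rewrite (leafDE (S_deriv u Wp)) -(leafDE dQ') (leafDE dQ) (leafDE (Q_deriv u v Wp)).
by rewrite mul0r add0r.
Qed.

(** Differentiate [conn] for v along u and for u along v, and subtract. The second derivatives of x
    and y cancel by symmetry, leaving twice the imaginary part of the product of the two derivatives
    of w; on the other side those of [ell] form a Laplacian. The terms of first order are exactly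
    those subtracted in [fs_form]. *)
Lemma conn_fs_form p u : W p ->
  let v := imC R *: u in
  ImC (fs_form (\row_j (Complex (x j p) (y j p) : CC R))
       (\row_j (Complex (D u (x j) p) (D u (y j) p) : CC R))
       (\row_j (Complex (D v (x j) p) (D v (y j) p) : CC R))) =
  4^-1 * S p ^+ 2 * (D u (D u ell) p + D v (D v ell) p).
Proof.
move=> Wp v.
have ivE : imC R *: v = - u by rewrite /v scalerA imCK scaleN1r.
have duN : D u (D (imC R *: v) ell) p = - D u (D u ell) p.
  rewrite ivE; apply: leafDE.
  apply: (leafD_near oW Wp (F := fun q => - D u ell q)).
    move=> q Wq; apply: esym; apply: leafDE; apply: leafD_oppdir.
    exact: CkS_leafD (Cell 1) Wq.
  exact: leafDN (CkS_leafD u (CkS_D u (Cell 2)) Wp).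
have dN : D (imC R *: v) ell p = - D u ell p.
  by rewrite ivE; apply: leafDE; apply: leafD_oppdir; exact: CkS_leafD (Cell 1) Wp.
have c1 := conn_deriv u v Wp; have c2 := conn_deriv v u Wp.
have q1 := conn v Wp; have q2 := conn u Wp.
rewrite duN dN in c1; rewrite dN in q1; rewrite -/v in c2 q2.
have eS1 := leafDE (S_deriv u Wp); have eS2 := leafDE (S_deriv v Wp).
have eQ1 := leafDE (Q_deriv u v Wp); have eQ2 := leafDE (Q_deriv v u Wp).
pose Om := \sum_j (D u (x j) p * D v (y j) p - D u (y j) p * D v (x j) p).
have eQ : D u (Q v) p - D v (Q u) p = 2 * Om.
  rewrite eQ1 eQ2 /Om mulr_sumr -sumrB; apply: eq_bigr => j _.
  have alg (a a' b b' X Y xu xv yu yv : R) : a' = a -> b' = b ->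
      a * X + yv * xu - (b * Y + xv * yu) - (a' * X + yu * xv - (b' * Y + xu * yv)) =
      2 * (xu * yv - yu * xv) by move=> -> ->; ring.
  exact: alg (leaf_schwarz u v (Cy j) Wp) (leaf_schwarz u v (Cx j) Wp).
pose B a := \sum_j (x j p * D a (x j) p + y j p * D a (y j) p).
rewrite -/(B u) in eS1; rewrite -/(B v) in eS2.
set w := \row_j _; set a := \row_j _; set b := \row_j _.
have Iab : ImC (herm a b) = Om by rewrite Im_herm; apply: eq_bigr => j _; rewrite !mxE.
have Rww : ReC (herm w w) = S p by rewrite Re_herm; apply: eq_bigr => j _; rewrite !mxE.
have Iww : ImC (herm w w) = 0 by rewrite herm_nrm2.
have Rwb : ReC (herm w b) = B v by rewrite Re_herm; apply: eq_bigr => j _; rewrite !mxE.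
have Iwb : ImC (herm w b) = Q v p.
  by rewrite Im_herm; apply: eq_bigr => j _; rewrite !mxE [in RHS]mulrC [X in _ - X]mulrC.
have Raw : ReC (herm a w) = B u.
  by rewrite Re_herm; apply: eq_bigr => j _; rewrite !mxE mulrC [X in _ + X]mulrC.
have Iaw : ImC (herm a w) = - Q u p.
  by rewrite Im_herm -sumrN; apply: eq_bigr => j _; rewrite !mxE opprB.
rewrite /fs_form !ReImE Iab Rww Iww Rwb Iwb Raw Iaw.
exact: conn_algebra eS1 eS2 eQ c1 c2 q1 q2.
Qed.

End Connection.

(** * Maps to the projective space *)

Section ComplexSmooth.
Variables (R : realType) (X : topologicalType) (n : nat) (L : lamination R X n).
Implicit Types (V : set X) (f : X -> CC R) (c : chart R X n).

Definition csmooth V f :=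
  smooth L V (fun x => ReC (f x)) /\ smooth L V (fun x => ImC (f x)).

Lemma csmooth_eq V f (f' : X -> CC R) : open V -> (forall x, V x -> f x = f' x) ->
  csmooth V f -> csmooth V f'.
Proof.
by move=> oV ff' [sR sI]; split; [apply: smooth_eq sR|apply: smooth_eq sI] => // x Vx; rewrite ff'.
Qed.

Lemma csmooth_sub V V' f : V' `<=` V -> csmooth V f -> csmooth V' f.
Proof. by move=> V'V [sR sI]; split; exact: smooth_sub V'V _. Qed.

Lemma csmooth_local V f : (forall x, V x -> exists2 V', V' x & csmooth V' f) -> csmooth V f.
Proof.
by move=> loc; split; apply: smooth_local => x /loc[V' V'x [sR sI]]; exists V'.
Qed.

Lemma csmooth_cst V a : csmooth V (fun=> a).
Proof. by split; exact: smooth_cst. Qed.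

Lemma csmooth_real V (f : X -> R) : smooth L V f -> csmooth V (fun x => realC (f x)).
Proof. by move=> sf; split => //; exact: smooth_cst. Qed.

Lemma csmoothM V f (f' : X -> CC R) : open V -> csmooth V f -> csmooth V f' ->
  csmooth V (fun x => f x * f' x).
Proof.
move=> oV [fR fI] [fR' fI']; split.
  apply: (smooth_eq oV _ (smoothB oV (smoothM oV fR fR') (smoothM oV fI fI'))) => x _.
  by rewrite !ReImE.
apply: (smooth_eq oV _ (smoothD oV (smoothM oV fR fI') (smoothM oV fI fR'))) => x _.
by rewrite !ReImE.
Qed.

Lemma absC_inv (z : CC R) : z != 0 -> z^-1 = realC (absC z ^- 2) * cj z.
Proof.
move=> z0; apply: (mulfI z0); rewrite divff // mulrCA mul_cj -realCM mulVf //.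
by rewrite expf_neq0 // absC_eq0.
Qed.

Lemma csmooth_inv V f : open V -> (forall x, V x -> f x != 0) -> csmooth V f ->
  csmooth V (fun x => (f x)^-1).
Proof.
move=> oV f0 [fR fI].
have sN : smooth L V (fun x => (absC (f x) ^+ 2)^-1).
  apply: smooth_inv => // [x Vx|]; first by rewrite expf_neq0 // absC_eq0 f0.
  apply: (smooth_eq oV _ (smoothD oV (smoothX 2 oV fR) (smoothX 2 oV fI))) => x _.
  by rewrite absCE.
split.
  apply: (smooth_eq oV _ (smoothM oV sN fR)) => x Vx.
  by rewrite absC_inv ?f0 // ReC_realM Re_cj.
apply: (smooth_eq oV _ (smoothM oV sN (smoothN oV fI))) => x Vx.
by rewrite absC_inv ?f0 // ImC_realM Im_cj.
Qed.

Lemma csmooth_cont V f x : open V -> csmooth V f -> V x -> \forall y \near x, f x != 0 -> f y != 0.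
Proof.
move=> oV [fR fI] Vx; have [f0|f0] := eqVneq (f x) 0; first exact: nearW.
have cN : {for x, continuous (fun y => ReC (f y) ^+ 2 + ImC (f y) ^+ 2)}.
  by apply: continuousD; apply: sqr_cont; [exact: smooth_cont oV fR Vx|exact: smooth_cont oV fI Vx].
have : nbhs (ReC (f x) ^+ 2 + ImC (f x) ^+ 2) [set r : R | 0 < r].
  apply: open_nbhs_nbhs; split; first exact: open_gt.
  by rewrite /= -absCE exprn_gt0 // absC_gt0.
move=> nb; have {}nb : \forall y \near x, 0 < ReC (f y) ^+ 2 + ImC (f y) ^+ 2 := cN _ nb.
apply: filterS nb => y; rewrite -absCE => yP _; apply/eqP => y0.
by move: yP; rewrite y0 absCE !ReImE expr0n addr0 ltxx.
Qed.

Definition dC c f (p : 'rV[CC R]_n * transv c) (u : 'rV[CC R]_n) : CC R :=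
  Complex (dl (fun x => ReC (f x)) p u) (dl (fun x => ImC (f x)) p u).

Lemma dC_eq V f (f' : X -> CC R) c p u : open V -> @chart_set R X n c V p ->
  (forall x, V x -> f x = f' x) -> dC f p u = dC f' p u.
Proof.
move=> oV Vp ff'; have oW := @chart_set_open _ _ _ c V oV.
by congr Complex; apply: (leaf_derivative_near _ oW Vp) => q [bq Vq]; rewrite ff'.
Qed.

Lemma dCM V f (f' : X -> CC R) c p u : csmooth V f -> csmooth V f' -> atlas L c ->
  @chart_set R X n c V p ->
  dC (fun x => f x * f' x) p u = dC f p u * f' (psi c p) + f (psi c p) * dC f' p u.
Proof.
move=> [fR fI] [fR' fI'] Lc Vp.
have dR := smooth_leafD u fR Lc Vp; have dI := smooth_leafD u fI Lc Vp.
have dR' := smooth_leafD u fR' Lc Vp; have dI' := smooth_leafD u fI' Lc Vp.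
have HR : leafD (fun q => ReC (f (psi c q) * f' (psi c q))) p u
    (ReC (dC f p u * f' (psi c p) + f (psi c p) * dC f' p u)).
  rewrite (_ : (fun q => _) = (fun q => ReC (f (psi c q)) * ReC (f' (psi c q))
    + - (ImC (f (psi c q)) * ImC (f' (psi c q))))); last first.
    by apply/funext => q; rewrite !ReImE.
  have := leafDD (leafDM dR dR') (leafDN (leafDM dI dI')).
  set a := (X in leafD _ _ _ X -> _); set b := (X in _ -> leafD _ _ _ X).
  by rewrite (_ : a = b) // /a /b !ReImE /=; ring.
have HI : leafD (fun q => ImC (f (psi c q) * f' (psi c q))) p u
    (ImC (dC f p u * f' (psi c p) + f (psi c p) * dC f' p u)).
  rewrite (_ : (fun q => _) = (fun q => ReC (f (psi c q)) * ImC (f' (psi c q))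
    + ImC (f (psi c q)) * ReC (f' (psi c q)))); last first.
    by apply/funext => q; rewrite !ReImE.
  have := leafDD (leafDM dR dI') (leafDM dI dR').
  set a := (X in leafD _ _ _ X -> _); set b := (X in _ -> leafD _ _ _ X).
  by rewrite (_ : a = b) // /a /b !ReImE /=; ring.
by apply: CC_ext; rewrite -?(leafDE HR) -?(leafDE HI).
Qed.

End ComplexSmooth.

Section FubiniStudyForm.
Variables (R : realType) (N : nat).

Lemma Re_imM (z : CC R) : ReC (imC R * z) = - ImC z.
Proof. by rewrite ReCM ReC_im ImC_im mul0r mul1r sub0r. Qed.

Lemma DcplxE m (F : 'rV[CC R]_m -> CC R) z u :
  Dcplx F z u = Complex (Dreal (fun w => ReC (F w)) z u) (Dreal (fun w => ImC (F w)) z u).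
Proof.
rewrite /Dcplx; move: (Dreal _ z u) (Dreal _ z u) => a b.
by apply: CC_ext; rewrite !ReImE ?mul0r ?mul1r ?mulr0 ?subr0 ?addr0 ?add0r.
Qed.

Lemma Re_fubini_study (w a b : 'rV[CC R]_N.+1) : 0 < nrm2 w ->
  ReC (fubini_study w a b) = ImC (fs_form w a b) / nrm2 w ^+ 2.
Proof.
move=> w0; rewrite -Re_delbar_del_ln // /fubini_study half_realC.
set Z := delbar_del _ _ _ _.
by rewrite mulNr ReCN -mulrA Re_imM opprK ImC_realM.
Qed.

Lemma nrm2_gt0 (w : 'rV[CC R]_N.+1) : w != 0 -> 0 < nrm2 w.
Proof.
move=> w0; have [j wj] : exists j, w 0 j != 0.
  by apply/rV0Pn.
rewrite /nrm2 (bigD1 j) //= ltr_pwDl ?exprn_gt0 ?absC_gt0 //.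
by apply: sumr_ge0 => k _; rewrite sqr_ge0.
Qed.

End FubiniStudyForm.

Lemma laplacian_algebra (R : realType) (a b a' b' : R) : a = a' -> b = b' ->
  0 < - (4^-1 * (b' - - a' - - a' + b')) -> a + b < 0.
Proof. by move=> -> ->; lra. Qed.

(** * From functions with the prescribed connection form to the embedding *)

Section Embedding.
Variables (R : realType) (X : topologicalType) (n : nat) (L : lamination R X n).
Variables (g : cocycle L) (h : co_index g -> X -> R).
Hypotheses (h_metric : hermitian_metric h) (h_smooth : smooth_metric h).
Hypothesis h_positive : forall V s, nonvanishing_section V s -> forall i c, atlas L c ->
  forall p, box p -> V (psi c p) -> co_set g i (psi c p) ->
  forall u, u != 0 -> 0 < curvature (section_norm h s i) p u (imC R *: u).

Definition lnh i (x : X) : R := ln (h i x ^+ 2).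

Lemma lnh_smooth i : smooth L (co_set g i) (lnh i).
Proof.
have oi := @co_open _ _ _ _ g i; apply: smooth_ln => // [x ix|].
  by rewrite exprn_gt0 // (h_pos h_metric ix).
by apply: smoothX => //; exact: (@metric_smooth _ _ _ _ _ _ h_smooth).
Qed.

(** Positivity is applied to the frame i itself, whose coordinates are the [co_fun g j i] and whose
    norm is h i: its curvature on (u, iu) is minus half of this Laplacian. *)
Lemma laplacian_neg c i p (u : 'rV[CC R]_n) :
  atlas L c -> chart_set c (co_set g i) p -> u != 0 ->
  leaf_derivative u (leaf_derivative u (fun q => lnh i (psi c q))) p
  + leaf_derivative (imC R *: u) (leaf_derivative (imC R *: u) (fun q => lnh i (psi c q))) p < 0.
Proof.
move=> Lc Wp u0; have [bp ip] := Wp; have oi := @co_open _ _ _ _ g i.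
have ns : nonvanishing_section (co_set g i) (fun j x => co_fun g j i x).
  split=> // [j|j x ix jx|j k x ix jx kx].
  - apply: (holomorphic_sub _ _ _ (co_holomorphic j i)); last by move=> x [].
    + by apply: openI; exact: co_open.
    + by apply: openI; exact: co_open.
  - exact: co_neq0.
  - exact: co_mul.
have oW := @chart_set_open _ _ _ c (co_set g i) oi.
pose F q := lnh i (psi c q).
pose G q := ln (section_norm h (fun j x => co_fun g j i x) i (psi c q) ^+ 2).
have FG q : chart_set c (co_set g i) q -> F q = G q.
  by move=> [_ iq]; rewrite /G /section_norm co_fun_id // absC1 mulr1.
have CF k : Ck k (chart_set c (co_set g i)) F by have /smoothP := @lnh_smooth i; apply.
have CG k : Ck k (chart_set c (co_set g i)) G by exact: Ck_eq FG (CF k).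
have DE a b q : chart_set c (co_set g i) q ->
    leaf_derivative a (leaf_derivative b F) q = leaf_derivative a (leaf_derivative b G) q.
  move=> Wq; apply: (leaf_derivative_near _ oW Wq) => q' Wq'.
  exact: (leaf_derivative_near _ oW Wq' FG).
pose v := imC R *: u.
have ivE : imC R *: v = - u by rewrite /v scalerA imCK scaleN1r.
have dphi a b : derivable (fun h => Dreal (fun z => G (z, p.2)) (line p.1 a h) b) 0 1.
  by have [_ /(_ a)[dG _]] := CkS_D b (CG 2%N); exact: dG Wp.
have E := @ImC_delbar_del R n (fun z => G (z, p.2)) p.1 u v dphi.
have H : 0 < ReC (imC R * delbar_del (fun z => realC (G (z, p.2))) p.1 u v).
  by have [+ _] := ltC_real (@h_positive _ _ ns i c Lc p bp ip ip u u0).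
pose DD a b := leaf_derivative a (leaf_derivative b G) p.
have Ex : ImC (delbar_del (fun z => realC (G (z, p.2))) p.1 u v) =
    4^-1 * (DD v v - DD u (imC R *: v) - DD (imC R *: v) u + DD v v) := E.
rewrite Re_imM Ex ivE in H.
have e1 : DD u (- u) = - DD u u.
  apply: leafDE.
  apply: (leafD_near oW Wp (F := fun q => - leaf_derivative u G q)).
    move=> q Wq; apply: esym; apply: leafDE; apply: leafD_oppdir.
    exact: CkS_leafD (CG 1%N) Wq.
  exact: leafDN (CkS_leafD u (CkS_D u (CG 2%N)) Wp).
have e2 : DD (- u) u = - DD u u.
  by apply: leafDE; apply: leafD_oppdir; exact: CkS_leafD u (CkS_D u (CG 2%N)) Wp.
rewrite e1 e2 in H; exact: laplacian_algebra (DE u u p Wp) (DE v v p Wp) H.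
Qed.

Variables (N : nat) (w : co_index g -> 'I_N.+1 -> X -> CC R).
Hypothesis w_smooth : forall i j, csmooth L (co_set g i) (w i j).
Hypothesis w_glue : forall i i' x, co_set g i x -> co_set g i' x ->
  exists2 l : CC R, l != 0 & forall j, w i' j x = l * w i j x.
Hypothesis w_conn : forall c, atlas L c -> forall i p u, chart_set c (co_set g i) p ->
  2 * ImC (\sum_j dC (w i j) p u * cj (w i j (psi c p))) =
  - (\sum_j absC (w i j (psi c p)) ^+ 2) * dl (lnh i) p (imC R *: u).
Hypothesis w_neq0 : forall i x, co_set g i x -> exists j, w i j x != 0.
Hypothesis w_inj : forall i i' x y (l : CC R), co_set g i x -> co_set g i' y -> l != 0 ->
  (forall j, w i' j y = l * w i j x) -> x = y.

Let idx x : co_index g := projT1 (cid (co_cover g x)).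
Let idxP x : co_set g (idx x) x := projT2 (cid (co_cover g x)).

Definition wvec i x : 'rV[CC R]_N.+1 := \row_j w i j x.

Lemma wvec_neq0 i x : co_set g i x -> wvec i x != 0.
Proof.
move=> /w_neq0[j wj]; apply: contra wj => /eqP/rowP/(_ j).
by rewrite !mxE => ->.
Qed.

Lemma wline_dim x : \dim <[wvec (idx x) x]>%VS == 1%N.
Proof. by rewrite dim_vline wvec_neq0 //; exact: idxP. Qed.

Definition wmap x : CP R N := exist _ <[wvec (idx x) x]>%VS (wline_dim x).

(** The line of [wmap] uses a chosen index [idx x]; by [w_glue] any admissible index spans the same
    line, of which [vpick] returns some nonzero vector. *)
Lemma wmap_homogeneous i x : co_set g i x ->
  exists2 l : CC R, l != 0 & homogeneous (wmap x) = l *: wvec i x.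
Proof.
move=> ix; have [l l0 wl] := w_glue ix (idxP x).
have wE : wvec (idx x) x = l *: wvec i x by apply/rowP => j; rewrite !mxE wl.
have /vlineP[k kE] := memv_pick <[wvec (idx x) x]>%VS.
have := vpick0 <[wvec (idx x) x]>%VS.
exists (k * l); last by rewrite /homogeneous /= kE wE scalerA.
rewrite mulf_neq0 //; apply/eqP => k0.
have := vpick0 <[wvec (idx x) x]>%VS; rewrite kE k0 scale0r eqxx => /esym/eqP E0.
by have := wline_dim x; rewrite E0 dimv0.
Qed.

Lemma wmap_affine_open i k x : co_set g i x -> affine_open k (wmap x) <-> w i k x != 0.
Proof.
move=> ix; have [l l0 E] := wmap_homogeneous ix.
by rewrite /affine_open /= E !mxE mulf_eq0 (negbTE l0).
Qed.

Lemma wmap_affine i k x : co_set g i x -> w i k x != 0 ->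
  affine k (wmap x) = (w i k x)^-1 *: wvec i x.
Proof.
move=> ix wk; have [l l0 E] := wmap_homogeneous ix.
rewrite /affine E !mxE scalerA; congr (_ *: _).
by rewrite invfM mulrAC mulVf // mul1r.
Qed.

Lemma wmap_inj : injective wmap.
Proof.
move=> x y /(congr1 val) /= E.
have : wvec (idx y) y \in <[wvec (idx x) x]>%VS by rewrite E memv_line.
move=> /vlineP[l lE]; apply: (w_inj (idxP x) (idxP y) (l := l)).
  apply/eqP => l0; have := wvec_neq0 (idxP y).
  by rewrite lE l0 scale0r eqxx.
by move=> j; have := congr1 (fun v : 'rV[CC R]_N.+1 => v 0 j) lE; rewrite !mxE.
Qed.

Definition nonzero_set i k := co_set g i `&` [set y | w i k y != 0].

Lemma nonzero_set_open i k : open (nonzero_set i k).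
Proof.
rewrite openE => y [iy wy]; apply: filterI.
  by apply: open_nbhs_nbhs; split => //; exact: co_open.
have := csmooth_cont (@co_open _ _ _ _ g i) (w_smooth i k) iy.
by apply: filterS => z; apply.
Qed.

Lemma wratio_smooth i j k : csmooth L (nonzero_set i k) (fun x => w i j x / w i k x).
Proof.
have sub : nonzero_set i k `<=` co_set g i by move=> x [].
have oU := @nonzero_set_open i k.
apply: csmoothM => //; first exact: csmooth_sub sub (w_smooth i j).
apply: csmooth_inv => //; first by move=> x [].
exact: csmooth_sub sub (w_smooth i k).
Qed.

Lemma wmap_smooth : smooth_CP L wmap.
Proof.
move=> k; split.
  rewrite openE => x kx; have [i ix] := co_cover g x.
  have /open_nbhs_nbhs : open_nbhs x (nonzero_set i k).
    by split; [exact: nonzero_set_open|split => //; exact/wmap_affine_open].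
  by apply: filterS => y [iy wy]; exact/(wmap_affine_open k iy).
move=> j.
suff [] : csmooth L (wmap @^-1` affine_open k) (fun x => affine k (wmap x) 0 j) by [].
apply: csmooth_local => x kx; have [i ix] := co_cover g x.
exists (nonzero_set i k); first by split => //; exact/wmap_affine_open.
apply: csmooth_eq (wratio_smooth i j k); first exact: nonzero_set_open.
by move=> y [iy wy]; rewrite (wmap_affine iy wy) !mxE mulrC.
Qed.

(** The derivative of the denominator only produces a multiple of w, whose coefficient y may stay
    unspecified thanks to [fs_form_scale]. *)
Lemma wmap_leaf_diff c i k p u : atlas L c -> chart_set c (nonzero_set i k) p ->
  exists y : CC R, leaf_diff k wmap p u =
  (w i k (psi c p))^-1 *: (\row_j dC (w i j) p u) + y *: wvec i (psi c p).
Proof.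
move=> Lc Wp; have [bp [ip wk]] := Wp.
have oU := @nonzero_set_open i k.
have sub : nonzero_set i k `<=` co_set g i by move=> x [].
exists (- (w i k (psi c p))^-1 ^+ 2 * dC (w i k) p u).
apply/rowP => j; rewrite !mxE.
have -> : Dcplx (fun z => affine k (wmap (psi c (z, p.2))) 0 j) p.1 u =
    dC (fun x => affine k (wmap x) 0 j) p u.
  exact: DcplxE.
have -> : dC (fun x => affine k (wmap x) 0 j) p u = dC (fun x => w i j x / w i k x) p u.
  apply: (dC_eq u oU Wp) => x [ix wx].
  by rewrite (wmap_affine ix wx) !mxE mulrC.
(* The quotient rule is read off the product rule for (w_j / w_k) w_k = w_j. *)
have := dCM u (wratio_smooth i j k) (csmooth_sub sub (w_smooth i k)) Lc Wp.
rewrite (_ : dC _ p u = dC (w i j) p u); last first.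
  by apply: (dC_eq u oU Wp) => x [ix wx]; rewrite divfK.
have wk1 : w i k (psi c p) != 0 := wk.
move=> ->; move: (dC _ p u) (dC _ p u) (w i j _) (w i k _) wk1 => A B wj wk' wk0.
by field.
Qed.

Lemma wvec_fs_form c i p u : atlas L c -> chart_set c (co_set g i) p -> u != 0 ->
  ImC (fs_form (wvec i (psi c p)) (\row_j dC (w i j) p u)
    (\row_j dC (w i j) p (imC R *: u))) != 0.
Proof.
move=> Lc Wp u0; have oi := @co_open _ _ _ _ g i.
have oW := @chart_set_open _ _ _ c (co_set g i) oi.
pose x j q := ReC (w i j (psi c q)); pose y j q := ImC (w i j (psi c q)).
have Cx j k : Ck k (chart_set c (co_set g i)) (x j).
  by have [/smoothP sR _] := w_smooth i j; exact: sR.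
have Cy j k : Ck k (chart_set c (co_set g i)) (y j).
  by have [_ /smoothP sI] := w_smooth i j; exact: sI.
have Cl k : Ck k (chart_set c (co_set g i)) (fun q => lnh i (psi c q)).
  by have /smoothP := @lnh_smooth i; apply.
have conn q v : chart_set c (co_set g i) q ->
    2 * (\sum_j (leaf_derivative v (y j) q * x j q - leaf_derivative v (x j) q * y j q)) =
    - ((\sum_j (x j q * x j q + y j q * y j q)) *
       leaf_derivative (imC R *: v) (fun q => lnh i (psi c q)) q).
  move=> Wq; have := w_conn Lc v Wq; rewrite ImC_sum mulNr.
  have -> : \sum_j ImC (dC (w i j) q v * cj (w i j (psi c q))) =
    \sum_j (leaf_derivative v (y j) q * x j q - leaf_derivative v (x j) q * y j q).
    by apply: eq_bigr => j _; rewrite ImCM Re_cj Im_cj mulrN addrC.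
  have -> // : \sum_j absC (w i j (psi c q)) ^+ 2 =
    \sum_j (x j q * x j q + y j q * y j q).
  by apply: eq_bigr => j _; rewrite absCE !expr2.
have := conn_fs_form oW Cx Cy Cl conn u Wp.
have -> : \row_j (Complex (x j p) (y j p) : CC R) = wvec i (psi c p).
  by apply/rowP => j; rewrite !mxE; apply: CC_ext.
move=> E; rewrite [X in X != 0]E.
have S0 : \sum_j (x j p * x j p + y j p * y j p) != 0.
  have := nrm2_gt0 (wvec_neq0 Wp.2) => /lt0r_neq0.
  rewrite /nrm2 (eq_bigr (fun j => x j p * x j p + y j p * y j p)) // => j _.
  by rewrite !mxE absCE !expr2.
rewrite !mulf_neq0 ?invr_eq0 ?pnatr_eq0 ?expf_neq0 //.
by rewrite lt_eqF // laplacian_neg.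
Qed.

Lemma Re_wmap_FS c k p u : atlas L c -> box p -> affine_open k (wmap (psi c p)) ->
  u != 0 -> ReC (pullback_FS k wmap p u (imC R *: u)) != 0.
Proof.
move=> Lc bp kp u0; have [i ip] := co_cover g (psi c p).
have wk : w i k (psi c p) != 0 by exact/(wmap_affine_open k ip).
have Wp : chart_set c (nonzero_set i k) p by [].
have Wp' : chart_set c (co_set g i) p by [].
have [y Ey] := wmap_leaf_diff u Lc Wp.
have [y' Ey'] := wmap_leaf_diff (imC R *: u) Lc Wp.
have wk' : (w i k (psi c p))^-1 != 0 by rewrite invr_eq0.
have n0 : 0 < nrm2 ((w i k (psi c p))^-1 *: wvec i (psi c p)).
  by apply: nrm2_gt0; rewrite scaler_eq0 negb_or wk' wvec_neq0.
rewrite /pullback_FS (wmap_affine ip wk) Ey Ey' Re_fubini_study // fs_form_scale ImC_realM.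
rewrite !mulf_neq0 ?invr_eq0 ?expf_neq0 ?absC_eq0 ?(gt_eqF n0) //.
exact: wvec_fs_form.
Qed.

Lemma embedding : symplectic_embedding L wmap.
Proof.
split; [exact: wmap_smooth|exact: wmap_inj|] => c Lc p k bp kp.
split=> u; last first.
  move=> u0; exists (imC R *: u); apply/eqP => E.
  by have := Re_wmap_FS Lc bp kp u0; rewrite E eqxx.
(* Immersivity comes from nondegeneracy: if the differential killed u, the form would vanish on (u,
   iu). *)
move=> du; apply: contrapT => /eqP u0.
have := Re_wmap_FS Lc bp kp u0; have [i ip] := co_cover g (psi c p).
have wk : w i k (psi c p) != 0 by exact/(wmap_affine_open k ip).
have wk' : (w i k (psi c p))^-1 != 0 by rewrite invr_eq0.
have n0 : 0 < nrm2 ((w i k (psi c p))^-1 *: wvec i (psi c p)).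
  by apply: nrm2_gt0; rewrite scaler_eq0 negb_or wk' wvec_neq0.
rewrite /pullback_FS (wmap_affine ip wk) du Re_fubini_study // /fs_form.
have h0 (b : 'rV[CC R]_N.+1) : herm 0 b = 0.
  by rewrite -(scale0r b) hermZl (cj_real 0) mul0r.
by rewrite !h0 mul0r mulr0 subr0 mul0r eqxx.
Qed.

End Embedding.

(** * Cut-off functions *)

Section BumpFunctions.
Variables (R : realType) (X : topologicalType) (n : nat) (L : lamination R X n).
Hypothesis hol_smooth : forall V (f : X -> CC R), open V -> holomorphic L V f ->
  smooth L V (fun x => ReC (f x)) /\ smooth L V (fun x => ImC (f x)).
Variables (m : nat) (e : X -> 'rV[R]_m).
Hypotheses (e_cont : continuous e).
Hypothesis e_open : forall U : set X, open U ->
  exists2 V : set 'rV[R]_m, open V & U = e @^-1` V.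

Definition dist2 (a b : 'rV[R]_m) : R := \sum_j (a 0 j - b 0 j) ^+ 2.

Lemma dist2_cont (T : topologicalType) (f : T -> 'rV[R]_m) b t :
  {for t, continuous f} -> {for t, continuous (fun y => dist2 (f y) b)}.
Proof.
move=> cf; apply: sum_continuous => j; apply: sqr_cont; apply: continuousB.
  apply: (@continuous_comp _ _ _ f (fun z : 'rV[R]_m => z 0 j)) => //.
  exact: coord_continuous.
exact: cst_continuous.
Qed.

Lemma dist2_nbhs (a : 'rV[R]_m) (A : set 'rV[R]_m) : nbhs a A ->
  exists2 d : R, 0 < d & forall b, dist2 b a < d -> A b.
Proof.
move=> /nbhs_ballP[d /= d0 dA]; exists (d ^+ 2); first by rewrite exprn_gt0.
move=> b bd; apply: dA; split => // i j; rewrite (ord1 i) -ball_normE /=.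
rewrite -(@ltr_pXn2r _ 2) ?nnegrE ?(ltW d0) // real_normK ?num_real //.
apply: le_lt_trans bd; rewrite /dist2 (bigD1 j) //= -opprB sqrrN lerDl.
by apply: sumr_ge0 => k _; rewrite sqr_ge0.
Qed.

Lemma e_nbhs x (U : set X) : open U -> U x ->
  exists2 d : R, 0 < d & forall y, dist2 (e y) (e x) < d -> U y.
Proof.
move=> /e_open[V oV ->] Vx.
have [d d0 dV] := dist2_nbhs (open_nbhs_nbhs (conj oV Vx)).
by exists d => // y yd; exact: dV.
Qed.

(* The euclidean coordinates of the point of the plaque of [x] over a fixed [z]: they
   only depend on the transverse coordinate of [x], hence are smooth. *)
Definition trans (c : chart R X n) (z : 'rV[CC R]_n) (x : X) : 'rV[R]_m :=
  e (psi c (z, (phi c x).2)).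

Lemma trans_smooth c z j : atlas L c -> unit_ball z ->
  smooth L (dom c) (fun x => trans c z x 0 j).
Proof.
move=> Lc bz; apply: (@smooth_transverse _ _ _ L c (fun t => e (psi c (z, t)) 0 j)) => // x cx.
have ct : {for x, continuous (fun y => (z, (phi c y).2))}.
  apply: (@cvg_pair _ _ _ (nbhs x) (nbhs z) (nbhs (phi c x).2)); first exact: cvg_cst.
  by apply: (@continuous_comp _ _ _ (phi c) snd); [exact: phi_cont|exact: cvg_snd].
have cp : {for x, continuous (fun y => psi c (z, (phi c y).2))}.
  exact: (@continuous_comp _ _ _ (fun y => (z, (phi c y).2)) (psi c) _ ct (@psi_cont _ _ _ c (z, (phi c x).2) bz)).
have ce : {for x, continuous (fun y => e (psi c (z, (phi c y).2)))}.
  exact: (@continuous_comp _ _ _ (fun y => psi c (z, (phi c y).2)) e _ cp (@e_cont _)).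
exact: (@continuous_comp _ _ _ (fun y => e (psi c (z, (phi c y).2))) (fun w : 'rV[R]_m => w 0 j) _ ce (@coord_continuous _ _ _ 0 j _)).
Qed.

Definition zdist c (z : 'rV[CC R]_n) (x : X) : R :=
  \sum_(l : 'I_n * bool) (rcoord c l x - (if l.2 then ImC (z 0 l.1) else ReC (z 0 l.1))) ^+ 2.

Lemma zdistE c z x : zdist c z x = \sum_j absC ((phi c x).1 0 j - z 0 j) ^+ 2.
Proof.
rewrite /zdist -(pair_bigA _ (fun j b => (rcoord c (j, b) x - (if b then ImC (z 0 j) else ReC (z 0 j))) ^+ 2)) /=.
by apply: eq_bigr => j _; rewrite big_bool absCE /rcoord /= !ReImE addrC.
Qed.

(** A function of [e] alone would not be smooth along the leaves, so a flat function of the leaf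
    coordinate is multiplied by one of [trans]. Its nonzero locus is forced into a set F closed in X
    and contained in O, so that the extension by 0 stays smooth. *)
Lemma bump_function c x0 (O : set X) : atlas L c -> open O -> O `<=` dom c -> O x0 ->
  exists (r : X -> R) (F : set X),
    [/\ smooth L setT r, 0 < r x0, closed F, F `<=` O & forall x, r x != 0 -> F x].
Proof.
move=> Lc oO Oc Ox0; have cx0 := Oc _ Ox0.
have bx0 : unit_ball (phi c x0).1 := phi_box cx0.
set z0 := (phi c x0).1 in bx0 *.
have [d0 d00 d0O] := e_nbhs oO Ox0.
pose F : set X := [set x | dist2 (e x) (e x0) <= d0 / 2].
have FO : F `<=` O.
  by move=> x Fx; apply: d0O; apply: le_lt_trans Fx _; rewrite ltr_pdivrMr // ltr_pMr // ltrDr.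
have cF : closed F.
  rewrite -[X in closed X]/((fun x => dist2 (e x) (e x0)) @^-1` [set y | y <= d0 / 2]).
  apply: closed_comp; last exact: closed_le.
  by move=> x _; apply: dist2_cont; exact: e_cont.
have dist0 x : dist2 (e x) (e x) = 0.
  by rewrite /dist2 big1 // => j _; rewrite subrr expr0n.
have nF : nbhs x0 F.
  have : nbhs (dist2 (e x0) (e x0)) [set y | y < d0 / 2].
    by apply: open_nbhs_nbhs; split; [exact: open_lt|rewrite /= dist0 divr_gt0].
  move=> nb; have {}nb : \forall x \near x0, dist2 (e x) (e x0) < d0 / 2.
    exact: (@dist2_cont _ e (e x0) x0 (@e_cont x0) _ nb).
  by apply: filterS nb => x; exact: ltW.
have nP : nbhs (phi c x0) (psi c @^-1` F).
  by apply: psi_cont; [exact: bx0|rewrite phiK].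
(* A product neighbourhood in the chart lying over F: the two flat factors will force z into A and t
   into B. *)
have [[A B] /= [nA nB] AB] : exists2 Q : set 'rV[CC R]_n * set (transv c),
    nbhs (phi c x0).1 Q.1 /\ nbhs (phi c x0).2 Q.2 & Q.1 `*` Q.2 `<=` psi c @^-1` F.
  by move: nP; case: (phi c x0).
have [d1 d10 d1A] := nbhs_rV nA.
pose U := dom c `&` [set x | B° (phi c x).2].
have oU : open U.
  rewrite openE => x [cx Bx]; apply: filterI; first exact: open_nbhs_nbhs (conj (dom_open c) cx).
  have ct : {for x, continuous (fun y => (phi c y).2)}.
    by apply: (@continuous_comp _ _ _ (phi c) snd); [exact: phi_cont|exact: cvg_snd].
  by apply: ct; apply: open_nbhs_nbhs; split => //; exact: open_interior.
(* Applied to the point over z0 in the plaque of x: if it is that close to x0, then the transverse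
   coordinate of x is in B. *)
have [d2 d20 d2U] := e_nbhs oU (conj cx0 nB).
pose f x := bump 0 (d1 - zdist c z0 x) * bump 0 (d2 - dist2 (trans c z0 x) (e x0)).
pose r x := if `[<dom c x>] then f x else 0.
have rF x : r x != 0 -> F x.
  rewrite /r; case: asboolP => [cx|_]; last by rewrite eqxx.
  rewrite /f mulf_eq0 negb_or => /andP[b1 b2].
  have {}b1 : 0 < bump 0 (d1 - zdist c z0 x) by rewrite lt0r b1 bump_ge0.
  have {}b2 : 0 < bump 0 (d2 - dist2 (trans c z0 x) (e x0)) by rewrite lt0r b2 bump_ge0.
  move: b1 b2; rewrite !bump_gt0 !subr_gt0 zdistE => /d1A Az /d2U[_ /=].
  rewrite psiK // => /nbhs_singleton Bt.
  have := AB ((phi c x).1, (phi c x).2) (conj Az Bt).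
  by rewrite /= -surjective_pairing phiK.
have oc := dom_open c.
have fs : smooth L (dom c) f.
  apply: smoothM => //; apply: smooth_bump => //; apply: smoothB => //.
  - exact: smooth_cst.
  - apply: smooth_sum => // l; apply: smoothX => //; apply: smoothB => //.
      exact: rcoord_smooth.
    exact: smooth_cst.
  - exact: smooth_cst.
  - apply: smooth_sum => // j; apply: smoothX => //; apply: smoothB => //.
      exact: trans_smooth.
    exact: smooth_cst.
exists r, F; split => //.
- apply: smooth_local => x _; case: (pselect (dom c x)) => cx.
    exists (dom c) => //; apply: (smooth_eq oc _ fs) => y cy.
    by rewrite /r asboolT.
  exists (~` F); first by move=> /FO/Oc.
  apply: (@smooth_eq _ _ _ _ _ (fun=> 0)); first exact: closed_openC.
    by move=> y Fy; apply/esym/eqP; apply/negPn/negP => /rF.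
  exact: smooth_cst.
- rewrite /r asboolT // /f mulr_gt0 // bump_gt0 subr_gt0.
    rewrite zdistE big1 // => j _.
    by rewrite subrr absCE !ReImE expr0n addr0.
  by rewrite /trans -surjective_pairing phiK // dist0.
Qed.

End BumpFunctions.

(** * A local family with prescribed connection form *)

Lemma sum_unit_sum (R : realType) (A : finType) (F : unit + A -> R) :
  \sum_k F k = F (inl tt) + \sum_a F (inr a).
Proof. by rewrite big_sumType (big_pred1 tt). Qed.

Lemma sum_pair_bool (R : realType) (A : finType) (F : A * bool -> R) :
  \sum_a F a = \sum_a (F (a, true) + F (a, false)).
Proof.
rewrite (eq_bigr (fun a => F (a.1, a.2))); last by case.
by rewrite -(pair_bigA _ (fun a b => F (a, b))) /=; apply: eq_bigr => a _; rewrite big_bool.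
Qed.

Section LocalFamily.
Variables (R : realType) (X : topologicalType) (n : nat) (L : lamination R X n).
Variables (g : cocycle L) (h : co_index g -> X -> R).
Hypotheses (h_metric : hermitian_metric h) (h_smooth : smooth_metric h).
Hypothesis hol_smooth : forall V (f : X -> CC R), open V -> holomorphic L V f ->
  smooth L V (fun x => ReC (f x)) /\ smooth L V (fun x => ImC (f x)).
Variables (c : chart R X n) (i : co_index g).
Hypothesis Lc : atlas L c.

Let V0 := dom c `&` co_set g i.
Let oV0 : open V0.
Proof. by apply: openI; [exact: dom_open|exact: co_open]. Qed.
Let V0c : V0 `<=` dom c. Proof. by move=> x []. Qed.
Let V0i : V0 `<=` co_set g i. Proof. by move=> x []. Qed.

(** The values of A_i on the real basis e_j, i e_j of the chart c. The sign changes for i e_j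
    because multiplying it by i gives - e_j. *)
Definition conn_coef (l : 'I_n * bool) (x : X) : R :=
  if l.2 then 2^-1 * dl (lnh h i) (phi c x) (rdir R (l.1, false))
  else - (2^-1 * dl (lnh h i) (phi c x) (rdir R (l.1, true))).

Lemma lnh_in_chart k : Ck k (chart_set c V0) (fun q => lnh h i (psi c q)).
Proof.
have /smoothP := smooth_sub V0i (@lnh_smooth _ _ _ _ _ _ h_metric h_smooth i).
exact.
Qed.

Lemma conn_coef_smooth l : smooth L V0 (conn_coef l).
Proof.
have s v : smooth L V0 (fun x => dl (lnh h i) (phi c x) v).
  apply: (smooth_in_chart hol_smooth Lc oV0 V0c) => k.
  apply: Ck_eq (CkS_D v (lnh_in_chart k.+1)); first exact: chart_set_open.
  by move=> q [bq _]; rewrite psiK.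
rewrite /conn_coef; case: l.2.
  by apply: smoothM => //; exact: smooth_cst.
by apply: smoothN => //; apply: smoothM => //; exact: smooth_cst.
Qed.

(** The chain rule expands D_{iu} (ln h_i^2) in the coordinates of c, and the Cauchy-Riemann
    equations for these coordinates turn their derivatives along iu into derivatives along u. *)
Lemma lnh_conn d (p : 'rV[CC R]_n * transv d) u : atlas L d -> chart_set d V0 p ->
  2 * (\sum_l conn_coef l (psi d p) * dl (rcoord c l) p u) =
  - dl (lnh h i) p (imC R *: u).
Proof.
move=> Ld Vp; have [bp [cp ip]] := Vp.
have := leafDE (chart_change hol_smooth (imC R *: u) Lc Ld oV0 V0c (lnh_in_chart 1) Vp).
rewrite -[leaf_derivative _ _ _]/(dl (lnh h i) p (imC R *: u)) => ->.
rewrite -(pair_bigA _ (fun j b => conn_coef (j, b) (psi d p) * dl (rcoord c (j, b)) p u)) /=.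
rewrite -(pair_bigA _ (fun j b => dl (rcoord c (j, b)) p (imC R *: u) *
  dl (lnh h i) (phi c (psi d p)) (rdir R (j, b)))) /=.
rewrite mulr_sumr -sumrN; apply: eq_bigr => j _; rewrite !big_bool.
have [e1 e2] := holomorphic_CR u (holomorphic_coord j Lc) Ld (conj bp cp).
have {}e1 : dl (rcoord c (j, false)) p (imC R *: u) = - dl (rcoord c (j, true)) p u := e1.
have {}e2 : dl (rcoord c (j, true)) p (imC R *: u) = dl (rcoord c (j, false)) p u := e2.
rewrite e1 e2 /conn_coef /=.
have alg (A B C D : R) :
  2 * (2^-1 * A * B + - (2^-1 * C) * D) = - (D * C + - B * A) by field.
exact: alg.
Qed.

(** The [unit] member is the constant 1, which excludes common zeros and later exposes scalar
    factors. The last boolean is the sign: the weights of opposite signs add up to 2, which keeps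
    the norm constant. *)
Definition fam_index := (unit + ('I_n * bool) * bool)%type.

Variable M : R.
Hypothesis M0 : 0 < M.

Let kappa : R := 1 + 2 * #|{: 'I_n * bool}|%:R.
Let sg (s : bool) : R := if s then 1 else -1.

Definition fam_weight (l : 'I_n * bool) s x : R := 1 + sg s * (conn_coef l x / M).
Definition fam_angle (l : 'I_n * bool) s x : R := sg s * (kappa * M / 2) * rcoord c l x.

(* The connection form [\sum_l conn_coef l * d (rcoord l)] of the frame [i] is that of
   the family formed by [1] and the [sqrt (1 +- conn_coef l / M) * exp (+- 'i C rcoord l)],
   whose squared norm is [kappa], for [C = kappa M / 2]. *)
Definition fam (k : fam_index) (x : X) : CC R :=
  match k with
  | inl _ => 1
  | inr a => Complex (Num.sqrt (fam_weight a.1 a.2 x) * cos (fam_angle a.1 a.2 x))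
                     (Num.sqrt (fam_weight a.1 a.2 x) * sin (fam_angle a.1 a.2 x))
  end.

Definition fam_dom := V0 `&` [set x | \sum_l conn_coef l x ^+ 2 < M ^+ 2].

Lemma fam_dom_open : open fam_dom.
Proof.
rewrite openE => x [Vx Mx]; apply: filterI; first exact: open_nbhs_nbhs (conj oV0 Vx).
have cS : {for x, continuous (fun y => \sum_l conn_coef l y ^+ 2)}.
  by apply: sum_continuous => l; apply: sqr_cont; exact: smooth_cont oV0 (conn_coef_smooth l) Vx.
have nb : nbhs (\sum_l conn_coef l x ^+ 2) [set y | y < M ^+ 2].
  by apply: open_nbhs_nbhs; split; [exact: open_lt|exact: Mx].
exact: (cS _ nb).
Qed.

Let oO := fam_dom_open.
Let OV0 : fam_dom `<=` V0. Proof. by move=> x []. Qed.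

Lemma fam_weight_gt0 l s x : fam_dom x -> 0 < fam_weight l s x.
Proof.
move=> [_ /= xM].
have : `|conn_coef l x| < M.
  rewrite -(@ltr_pXn2r _ 2) ?nnegrE ?(ltW M0) // real_normK ?num_real //.
  apply: le_lt_trans xM; rewrite (bigD1 l) //= lerDl.
  by apply: sumr_ge0 => l' _; rewrite sqr_ge0.
rewrite ltr_norml /fam_weight => /andP[a1 a2].
have b1 : -1 < conn_coef l x / M by rewrite ltr_pdivlMr // mulN1r.
have b2 : conn_coef l x / M < 1 by rewrite ltr_pdivrMr // mul1r.
by move: b1 b2; rewrite /sg; case: s => b1 b2; lra.
Qed.

Lemma fam_weight_smooth l s : smooth L fam_dom (fam_weight l s).
Proof.
apply: smoothD => //; first exact: smooth_cst.
apply: smoothM => //; first exact: smooth_cst.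
apply: smoothM => //; last exact: smooth_cst.
exact: smooth_sub OV0 (conn_coef_smooth l).
Qed.

Lemma fam_angle_smooth l s : smooth L fam_dom (fam_angle l s).
Proof.
apply: smoothM => //; first exact: smooth_cst.
by apply: smooth_sub (rcoord_smooth hol_smooth l Lc) => x [/V0c].
Qed.

Lemma fam_smooth k : csmooth L fam_dom (fam k).
Proof.
case: k => [t|[l s]]; first exact: csmooth_cst.
have sr := smooth_sqrt oO (@fam_weight_gt0 l s) (fam_weight_smooth l s).
have [sc ss] := smooth_cos_sin oO (fam_angle_smooth l s).
by split; exact: smoothM.
Qed.

Lemma fam_norm l s x : fam_dom x -> absC (fam (inr (l, s)) x) ^+ 2 = fam_weight l s x.
Proof.
move=> Ox; rewrite absCE /ReC /ImC /= !exprMn -mulrDr cos2Dsin2 mulr1.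
by rewrite sqr_sqrtr // ltW // fam_weight_gt0.
Qed.

(** In polar form Im (dw conj w) is the squared modulus times the derivative of the angle; the
    derivative of the modulus contributes a real number. *)
Lemma fam_dC l s d (p : 'rV[CC R]_n * transv d) u : atlas L d -> chart_set d fam_dom p ->
  ImC (dC (fam (inr (l, s))) p u * cj (fam (inr (l, s)) (psi d p))) =
  fam_weight l s (psi d p) * (sg s * (kappa * M / 2) * dl (rcoord c l) p u).
Proof.
move=> Ld Op; have [bp Opp] := Op.
have sr := smooth_sqrt oO (@fam_weight_gt0 l s) (fam_weight_smooth l s).
have dr := smooth_leafD u sr Ld Op.
have da := smooth_leafD u (fam_angle_smooth l s) Ld Op.
have dcos := leafD_comp (is_derive_cos (fam_angle l s (psi d p))) da.
have dsin := leafD_comp (is_derive_sin (fam_angle l s (psi d p))) da.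
have eR := leafDE (leafDM dr dcos); have eI := leafDE (leafDM dr dsin).
have ea : dl (fam_angle l s) p u = sg s * (kappa * M / 2) * dl (rcoord c l) p u.
  have cp : chart_set d (dom c) p by split => //; case: Opp => -[].
  have := leafDM (leafD_cst (sg s * (kappa * M / 2)) p u)
    (smooth_leafD u (rcoord_smooth hol_smooth l Lc) Ld cp).
  by move=> /leafDE; rewrite mul0r add0r.
have sW : Num.sqrt (fam_weight l s (psi d p)) ^+ 2 = fam_weight l s (psi d p).
  by rewrite sqr_sqrtr // ltW // fam_weight_gt0.
have cs := cos2Dsin2 (fam_angle l s (psi d p)).
rewrite -ea ImCM Re_cj Im_cj.
rewrite [ReC (dC _ _ _)]eR [ImC (dC _ _ _)]eI /ReC /ImC /= -[in RHS]sW.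
have alg (C S r x y : R) : C ^+ 2 + S ^+ 2 = 1 ->
    (y * C + r * (- S * x)) * - (r * S) + (y * S + r * (C * x)) * (r * C) = r ^+ 2 * x.
  by move=> CS; rewrite -[RHS]mulr1 -CS; ring.
exact: alg cs.
Qed.

Lemma fam_conn d (p : 'rV[CC R]_n * transv d) u : atlas L d -> chart_set d fam_dom p ->
  2 * ImC (\sum_k dC (fam k) p u * cj (fam k (psi d p))) =
  - (\sum_k absC (fam k (psi d p)) ^+ 2) * dl (lnh h i) p (imC R *: u).
Proof.
move=> Ld Op; have [bp Opp] := Op.
have kappaE : \sum_k absC (fam k (psi d p)) ^+ 2 = kappa.
  rewrite sum_unit_sum absC1 expr1n; congr (_ + _); rewrite sum_pair_bool.
  rewrite (eq_bigr (fun=> 2)); first by rewrite sumr_const mulr_natr.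
  move=> l _; rewrite (fam_norm l true Opp) (fam_norm l false Opp) /fam_weight /sg /=.
  by ring.
have Op' : chart_set d V0 p by split => //; exact: OV0.
rewrite kappaE mulNr -mulrN -lnh_conn // ImC_sum sum_unit_sum.
have -> : ImC (dC (fun=> 1) p u * cj 1) = 0.
  have -> : dC (fun=> 1) p u = 0 by apply: CC_ext; exact: leafDE (leafD_cst _ _ _).
  by rewrite mul0r.
rewrite add0r sum_pair_bool.
rewrite mulrCA; congr (_ * _); rewrite mulr_sumr; apply: eq_bigr => l _.
(* With C = kappa M / 2 and a the coefficient, the two signs contribute (1 + a/M) C - (1 - a/M) C =
   kappa a. *)
rewrite !fam_dC // /fam_weight /sg.
have M0' : M != 0 by rewrite gt_eqF.
by field.
Qed.

End LocalFamily.

(** * The global family *)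

(** O and the complement of F cover X, and on the latter the product is 0 whatever the values of
    f. *)
Lemma smooth_extend (R : realType) (X : topologicalType) (n : nat) (L : lamination R X n)
    (V O F : set X) (r f : X -> R) :
  open V -> open O -> closed F -> F `<=` O -> smooth L V r -> (forall x, r x != 0 -> F x) ->
  smooth L (V `&` O) f -> smooth L V (fun x => r x * f x).
Proof.
move=> oV oO cF FO sr rF sf; apply: smooth_local => x Vx.
have [Ox|Ox] := pselect (O x).
  exists (V `&` O) => //; apply: smoothM => //; first exact: openI.
  by apply: smooth_sub sr => y [].
exists (V `&` ~` F); first by split => // /FO.
apply: (@smooth_eq _ _ _ _ _ (fun=> 0)); last exact: smooth_cst.
  by apply: openI => //; exact: closed_openC.
move=> y [_ Fy]; have -> : r y = 0; last by rewrite mul0r.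
by apply/eqP/negPn/negP => /rF.
Qed.

Lemma sum_tensor (R : realType) (K B : finType) (r : R) (q : B -> R) (f : K -> R)
    (F : K -> B -> R) : (forall k b, F k b = r * q b * f k) ->
  \sum_k \sum_b F k b = r * (\sum_b q b) * \sum_k f k.
Proof.
move=> FE; rewrite mulr_sumr; apply: eq_bigr => k _.
by rewrite mulr_sumr mulr_suml; apply: eq_bigr => b _; exact: FE.
Qed.

Section Assembly.
Variables (R : realType) (X : topologicalType) (n : nat) (L : lamination R X n).
Variables (g : cocycle L) (h : co_index g -> X -> R).
Hypotheses (h_metric : hermitian_metric h) (h_smooth : smooth_metric h).
Hypothesis h_positive : forall V s, nonvanishing_section V s -> forall i c, atlas L c ->
  forall p, box p -> V (psi c p) -> co_set g i (psi c p) ->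
  forall u, u != 0 -> 0 < curvature (section_norm h s i) p u (imC R *: u).
Variables (m : nat) (e : X -> 'rV[R]_m).
Hypotheses (e_inj : injective e) (e_cont : continuous e).
Hypothesis e_open : forall U : set X, open U ->
  exists2 V : set 'rV[R]_m, open V & U = e @^-1` V.

Let hol_smooth := holomorphic_smooth h_metric h_smooth.

Definition sep_index := ('I_n * bool + 'I_m)%type.

(** All that the compactness argument takes from one point, packed together so that a single choice
    function [ld] supplies it coherently. *)
Record local_data (x0 : X) := LocalData {
  ld_i : co_index g;
  ld_O : set X;
  ld_F : set X;
  ld_r : X -> R;
  ld_f : fam_index n -> X -> CC R;
  ld_q : sep_index -> X -> R;
  ld_open : open ld_O;
  ld_closed : closed ld_F;
  ld_FO : ld_F `<=` ld_O;
  ld_Oi : ld_O `<=` co_set g ld_i;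
  ld_rF : forall x, ld_r x != 0 -> ld_F x;
  ld_r0 : ld_r x0 != 0;
  ld_r_smooth : smooth L setT ld_r;
  ld_f_smooth : forall k, csmooth L ld_O (ld_f k);
  ld_f1 : forall x, ld_f (inl tt) x = 1;
  ld_q_smooth : forall k, smooth L setT (ld_q k);
  ld_sep : forall x y, ld_r x != 0 -> ld_r x = ld_r y ->
    (forall k, ld_q k x = ld_q k y) -> x = y;
  ld_conn : forall d, atlas L d -> forall p u, chart_set d ld_O p ->
    2 * ImC (\sum_k dC (ld_f k) p u * cj (ld_f k (psi d p))) =
    - (\sum_k absC (ld_f k (psi d p)) ^+ 2) * dl (lnh h ld_i) p (imC R *: u) }.

Lemma local_data_exists x0 : exists _ : local_data x0, True.
Proof.
have [c Lc cx0] := atlas_cover L x0; have [i ix0] := co_cover g x0.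
(* The sum of squares at x0 is less than M, hence less than M^2 because M >= 1; so x0 lies in
   [fam_dom]. *)
pose M : R := \sum_l conn_coef h c i l x0 ^+ 2 + 1.
have S0 : 0 <= \sum_l conn_coef h c i l x0 ^+ 2 by apply: sumr_ge0 => l _; rewrite sqr_ge0.
have M1 : 1 <= M by rewrite lerDr.
have M0 : 0 < M by exact: lt_le_trans M1.
pose O := fam_dom h c i M.
have oO : open O by exact: fam_dom_open.
have Oc : O `<=` dom c by move=> x [[]].
have Oi : O `<=` co_set g i by move=> x [[]].
have Ox0 : O x0.
  split; first by split.
  apply: (@lt_le_trans _ _ M); first by rewrite /= ltrDl.
  by rewrite expr2 ler_peMl // ltW.
have [r [F [sr r0 cF FO rF]]] := bump_function hol_smooth e_cont e_open Lc oO Oc Ox0.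
have bz : unit_ball (phi c x0).1 := phi_box cx0.
(* The factor r makes the coordinates global; where r x = r y is not 0, it can be cancelled to
   recover them. *)
pose q (k : sep_index) (x : X) : R := r x *
  (match k with inl l => rcoord c l x | inr j => trans e c (phi c x0).1 x 0 j end).
have sq k : smooth L setT (q k).
  apply: (smooth_extend openT oO cF FO sr rF); rewrite setTI.
  apply: smooth_sub Oc _; case: k => [l|j]; first exact: rcoord_smooth.
  exact: trans_smooth.
have sep x y : r x != 0 -> r x = r y -> (forall k, q k x = q k y) -> x = y.
  move=> rx rxy qxy; have ry : r y != 0 by rewrite -rxy.
  have cx := Oc _ (FO _ (rF _ rx)); have cy := Oc _ (FO _ (rF _ ry)).
  have zE l : rcoord c l x = rcoord c l y.
    by have := qxy (inl l); rewrite /q -rxy => /(mulfI rx).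
  have tE : trans e c (phi c x0).1 x = trans e c (phi c x0).1 y.
    by apply/rowP => j; have := qxy (inr j); rewrite /q -rxy => /(mulfI rx).
  have z1 : (phi c x).1 = (phi c y).1.
    apply/rowP => j; apply: CC_ext; [exact: zE (j, false)|exact: zE (j, true)].
  have t1 : (phi c x).2 = (phi c y).2.
    have := e_inj tE => /(congr1 (phi c)).
    by rewrite !psiK // => -[].
  rewrite -(phiK cx) -(phiK cy); congr (psi c _).
  by rewrite [LHS]surjective_pairing z1 t1 -surjective_pairing.
have r0' : r x0 != 0 by rewrite gt_eqF.
unshelve eexists; last by [].
refine (@LocalData x0 i O F r (fam h c i M) q oO cF FO Oi rF r0' sr _ _ sq sep _).
- exact: fam_smooth.
- by [].
- by move=> d Ld p u; exact: fam_conn.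
Qed.

Definition ld x : local_data x := projT1 (cid (local_data_exists x)).

Variables (A : finType) (pt : A -> X).
Hypothesis pt_cover : forall x, exists a, ld_r (ld (pt a)) x != 0.

Let r_ a := ld_r (ld (pt a)).
Let i_ a := ld_i (ld (pt a)).
Let f_ a := ld_f (ld (pt a)).
Let O_ a := ld_O (ld (pt a)).

(** The constant 1 normalises the projective factor; the cut-offs are listed as well because
    [ld_sep] compares them at the two points. *)
Definition sep_family (b : unit + (A + A * sep_index)) (x : X) : R :=
  match b with
  | inl _ => 1
  | inr (inl a) => r_ a x
  | inr (inr a) => ld_q (ld (pt a.1)) a.2 x
  end.

Lemma sep_family_smooth b : smooth L setT (sep_family b).
Proof.
case: b => [t|[a|[a k]]]; [exact: smooth_cst|exact: ld_r_smooth|exact: ld_q_smooth].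
Qed.

Definition wfam (i : co_index g) (j : A * (fam_index n * (unit + (A + A * sep_index)))) (x : X) : CC R :=
  realC (r_ j.1 x) * (co_fun g (i_ j.1) i x * (f_ j.1 j.2.1 x * realC (sep_family j.2.2 x))).

Lemma co_fun_csmooth i i' : csmooth L (co_set g i `&` co_set g i') (co_fun g i i').
Proof.
by apply: hol_smooth; [apply: openI; exact: co_open|exact: co_holomorphic].
Qed.

Lemma r_O a x : r_ a x != 0 -> O_ a x.
Proof. by move=> /(@ld_rF _ (ld (pt a)))/(@ld_FO _ (ld (pt a))). Qed.

Lemma wfactor_smooth i a k b :
  csmooth L (co_set g i `&` O_ a)
    (fun x => co_fun g (i_ a) i x * (f_ a k x * realC (sep_family b x))).
Proof.
have oU : open (co_set g i `&` O_ a) by apply: openI; [exact: co_open|exact: ld_open].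
apply: csmoothM => //.
  apply: csmooth_sub (co_fun_csmooth (i_ a) i) => x [ix Ox].
  by split => //; exact: ld_Oi Ox.
apply: csmoothM => //; first by apply: csmooth_sub (ld_f_smooth _ k) => x [].
by apply: csmooth_real; apply: smooth_sub (sep_family_smooth b).
Qed.

Lemma wfam_smooth i j : csmooth L (co_set g i) (wfam i j).
Proof.
case: j => a [k b]; have [sR sI] := wfactor_smooth i a k b.
have oi := @co_open _ _ _ _ g i.
have ext := smooth_extend oi (@ld_open _ (ld (pt a))) (@ld_closed _ (ld (pt a)))
  (@ld_FO _ (ld (pt a))) (smooth_sub (@subsetT _ _) (@ld_r_smooth _ (ld (pt a)))) (@ld_rF _ (ld (pt a))).
split.
  by apply: (smooth_eq oi _ (ext _ sR)) => x _; rewrite /wfam /= ReC_realM.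
by apply: (smooth_eq oi _ (ext _ sI)) => x _; rewrite /wfam /= ImC_realM.
Qed.

Lemma wfam_glue i i' x : co_set g i x -> co_set g i' x ->
  exists2 l : CC R, l != 0 & forall j, wfam i' j x = l * wfam i j x.
Proof.
move=> ix i'x; exists (co_fun g i i' x); first exact: co_neq0.
move=> [a [k b]]; rewrite /wfam /=.
have [->|ra] := eqVneq (r_ a x) 0; first by rewrite realC0 !mul0r mulr0.
have ax : co_set g (i_ a) x := ld_Oi (r_O ra).
rewrite (co_mul ax ix i'x); move: (co_fun _ _ _ _) (co_fun _ _ _ _) => B C.
by ring.
Qed.

Lemma wfam_neq0 i x : co_set g i x -> exists j, wfam i j x != 0.
Proof.
move=> ix; have [a ra] := pt_cover x; exists (a, (inl tt, inl tt)).
have ax : co_set g (i_ a) x := ld_Oi (r_O ra).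
rewrite /wfam /= /f_ ld_f1 realC1 !mulr1 mulf_neq0 //; last exact: co_neq0.
by rewrite -absC_eq0 absC_real normr_eq0.
Qed.

Lemma realC_inj : injective (@realC R).
Proof. by move=> a b /(congr1 (@ReC R)). Qed.

(** Fix a with r_a nonzero at x and keep the members where the local family is 1. The member b = 1
    identifies the common nonzero factor, and dividing the others by it shows that all the
    separating functions agree at x and y. *)
Lemma wfam_inj i i' x y (l : CC R) : co_set g i x -> co_set g i' y -> l != 0 ->
  (forall j, wfam i' j y = l * wfam i j x) -> x = y.
Proof.
move=> ix iy l0 E; have [a ra] := pt_cover x.
have ax : co_set g (i_ a) x := ld_Oi (r_O ra).
pose B i x : CC R := realC (r_ a x) * co_fun g (i_ a) i x.
have Eb b : B i' y * realC (sep_family b y) = l * (B i x * realC (sep_family b x)).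
  have := E (a, (inl tt, b)); rewrite /wfam /= /f_ !ld_f1 !mul1r /B => Eb.
  by rewrite -mulrA Eb -(mulrA (realC (r_ a x))).
have Bx : B i x != 0.
  rewrite mulf_neq0 //; last exact: co_neq0.
  by rewrite -absC_eq0 absC_real normr_eq0.
have E1 := Eb (inl tt); rewrite /= realC1 !mulr1 in E1.
have lB : l * B i x != 0 by rewrite mulf_neq0.
have sE b : sep_family b x = sep_family b y.
  by apply: realC_inj; apply: (mulfI lB); rewrite -{2}E1 Eb mulrA.
apply: (@ld_sep _ (ld (pt a))) => //; first exact: sE (inr (inl a)).
by move=> k; exact: sE (inr (inr (a, k))).
Qed.

(** For a nonvanishing holomorphic G, the derivative of arg G along u is minus that of ln |G| along
    iu, and ln |g_ii'|^2 = ln h_i'^2 - ln h_i^2. The computation only uses ln |G|^2, so no branch of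
    the argument is chosen. *)
Lemma co_fun_conn i i' c p u : atlas L c -> chart_set c (co_set g i `&` co_set g i') p ->
  2 * ImC (dC (co_fun g i i') p u * cj (co_fun g i i' (psi c p))) =
  - (absC (co_fun g i i' (psi c p)) ^+ 2 *
     (dl (lnh h i') p (imC R *: u) - dl (lnh h i) p (imC R *: u))).
Proof.
move=> Lc Wp; have [bp [ip i'p]] := Wp; set V := co_set g i `&` co_set g i'.
have oV : open V by apply: openI; exact: co_open.
have oW := @chart_set_open _ _ _ c V oV.
have [sR sI] := co_fun_csmooth i i'.
have [e1 e2] := holomorphic_CR u (co_holomorphic i i') Lc Wp.
have dR := smooth_leafD (imC R *: u) sR Lc Wp; have dI := smooth_leafD (imC R *: u) sI Lc Wp.
rewrite e1 in dR; rewrite e2 in dI.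
have dN := leafDD (leafDM dR dR) (leafDM dI dI).
pose N q := ReC (co_fun g i i' (psi c q)) * ReC (co_fun g i i' (psi c q)) +
  ImC (co_fun g i i' (psi c q)) * ImC (co_fun g i i' (psi c q)).
have NE q : N q = absC (co_fun g i i' (psi c q)) ^+ 2 by rewrite absCE !expr2.
have N0 q : chart_set c V q -> 0 < N q.
  by move=> [bq [iq i'q]]; rewrite NE exprn_gt0 // absC_gt0; exact: co_neq0.
have dln := leafD_comp (is_derive1_ln (N0 _ Wp)) dN.
have ip' : chart_set c (co_set g i) p by [].
have dl1 := smooth_leafD (imC R *: u) (@lnh_smooth _ _ _ _ _ _ h_metric h_smooth i) Lc ip'.
have FE q : chart_set c V q -> lnh h i (psi c q) + ln (N q) = lnh h i' (psi c q).
  move=> Wq; have [bq [iq i'q]] := Wq; have [_ hm] := h_metric.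
  have hq : 0 < h i (psi c q) ^+ 2 by rewrite exprn_gt0 // (h_pos h_metric iq).
  have Nq : 0 < N q by exact: N0.
  by rewrite /lnh (hm _ _ _ iq i'q) exprMn -NE (lnM hq Nq).
have E := leafDE (leafD_near oW Wp FE (leafDD dl1 dln)).
have Np0 : N p != 0 by rewrite gt_eqF // N0.
rewrite -NE ImCM Re_cj Im_cj.
have alg (M x y a b LI LA : R) : M != 0 ->
    LI = LA + M^-1 * (- y * a + a * - y + (x * b + b * x)) ->
    2 * (x * - b + y * a) = - (M * (LI - LA)) by move=> M0 ->; field.
exact: alg Np0 E.
Qed.

(** The terms in r' and q' are real multiples of |G f|^2 and disappear from the imaginary part. *)
Lemma wfam_algebra (r r' q q' : R) (G dG f df : CC R) :
  ImC ((realC r' * (G * (f * realC q)) +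
        realC r * (dG * (f * realC q) + G * (df * realC q + f * realC q'))) *
       cj (realC r * (G * (f * realC q)))) =
  r ^+ 2 * q ^+ 2 * (ImC (dG * cj G) * absC f ^+ 2 + absC G ^+ 2 * ImC (df * cj f)).
Proof. by rewrite !absCE !(ReImE, Re_cj, Im_cj); ring. Qed.

Lemma wfam_conn c : atlas L c -> forall i p u, chart_set c (co_set g i) p ->
  2 * ImC (\sum_j dC (wfam i j) p u * cj (wfam i j (psi c p))) =
  - (\sum_j absC (wfam i j (psi c p)) ^+ 2) * dl (lnh h i) p (imC R *: u).
Proof.
move=> Lc i p u Wp; have [bp ip] := Wp; rewrite ImC_sum.
rewrite -(pair_bigA _ (fun a kb => ImC (dC (wfam i (a, kb)) p u * cj (wfam i (a, kb) (psi c p))))).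
rewrite -(pair_bigA _ (fun a kb => absC (wfam i (a, kb) (psi c p)) ^+ 2)).
rewrite mulr_sumr mulNr mulr_suml -sumrN; apply: eq_bigr => a _.
(* Outside of [O_ a] the local data say nothing, but there r_a vanishes and both sides contain the
   factor w = 0. *)
have [ra|ra] := eqVneq (r_ a (psi c p)) 0.
  have w0 kb : wfam i (a, kb) (psi c p) = 0 by rewrite /wfam ra realC0 mul0r.
  have cj0 : cj (0 : CC R) = 0 := cj_real 0.
  rewrite !big1 ?mul0r ?oppr0 ?mulr0 // => kb _; rewrite w0; last by rewrite cj0 mulr0.
  by rewrite absCE !ReImE expr0n addr0.
have Op := r_O ra; have ap : co_set g (i_ a) (psi c p) := ld_Oi Op.
have WO : chart_set c (O_ a) p by [].
have Wa : chart_set c (co_set g (i_ a) `&` co_set g i) p by [].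
have Wi : chart_set c (co_set g i `&` O_ a) p by [].
have oU : open (co_set g i `&` O_ a) by apply: openI; [exact: co_open|exact: ld_open].
have sG : csmooth L (co_set g i `&` O_ a) (co_fun g (i_ a) i).
  apply: csmooth_sub (co_fun_csmooth (i_ a) i) => x [ix Ox].
  by split => //; exact: ld_Oi Ox.
have sf k : csmooth L (co_set g i `&` O_ a) (f_ a k).
  by apply: csmooth_sub (ld_f_smooth _ k) => x [].
have sr : csmooth L (co_set g i `&` O_ a) (fun x => realC (r_ a x)).
  by apply: csmooth_real; apply: smooth_sub (@ld_r_smooth _ (ld (pt a))).
have sq b : csmooth L (co_set g i `&` O_ a) (fun x => realC (sep_family b x)).
  by apply: csmooth_real; apply: smooth_sub (sep_family_smooth b).
have dreal (v : X -> R) : dC (fun x => realC (v x)) p u = realC (dl v p u).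
  by apply: CC_ext => //; exact: leafDE (leafD_cst _ _ _).
pose x := psi c p; pose G := co_fun g (i_ a) i x; pose dG := dC (co_fun g (i_ a) i) p u.
have term k b : ImC (dC (wfam i (a, (k, b))) p u * cj (wfam i (a, (k, b)) x)) =
    r_ a x ^+ 2 * sep_family b x ^+ 2 *
    (ImC (dG * cj G) * absC (f_ a k x) ^+ 2 + absC G ^+ 2 * ImC (dC (f_ a k) p u * cj (f_ a k x))).
  rewrite -(wfam_algebra _ (dl (r_ a) p u) _ (dl (sep_family b) p u)) -!dreal.
  rewrite -(dCM u (sf k) (sq b) Lc Wi) -(dCM u sG (csmoothM oU (sf k) (sq b)) Lc Wi).
  by rewrite -(dCM u sr (csmoothM oU sG (csmoothM oU (sf k) (sq b))) Lc Wi).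
have norm k b : absC (wfam i (a, (k, b)) x) ^+ 2 =
    r_ a x ^+ 2 * sep_family b x ^+ 2 * (absC G ^+ 2 * absC (f_ a k x) ^+ 2).
  by rewrite /wfam /= !absCM !absC_real !exprMn !real_normK ?num_real //; ring.
rewrite -(pair_bigA _ (fun k b => ImC (dC (wfam i (a, (k, b))) p u * cj (wfam i (a, (k, b)) x)))).
rewrite -(pair_bigA _ (fun k b => absC (wfam i (a, (k, b)) x) ^+ 2)).
pose Sq := \sum_b sep_family b x ^+ 2.
pose Sf := \sum_k absC (f_ a k x) ^+ 2.
pose If := \sum_k ImC (dC (f_ a k) p u * cj (f_ a k x)).
have -> : \sum_k \sum_b ImC (dC (wfam i (a, (k, b))) p u * cj (wfam i (a, (k, b)) x)) =
    r_ a x ^+ 2 * Sq * (ImC (dG * cj G) * Sf + absC G ^+ 2 * If).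
  rewrite (sum_tensor term); congr (_ * _).
  by rewrite big_split /Sf /If !mulr_sumr.
have -> : \sum_k \sum_b absC (wfam i (a, (k, b)) x) ^+ 2 = r_ a x ^+ 2 * Sq * (absC G ^+ 2 * Sf).
  by rewrite (sum_tensor norm) /Sf mulr_sumr.
have cG := co_fun_conn u Lc Wa; have cf := ld_conn Lc u WO.
rewrite ImC_sum -/If -/Sf in cf; rewrite -/x -/G -/dG in cG.
(* The local family carries the form A_a and the cocycle A_i - A_a: the derivative Da cancels. *)
have alg (r2 Gf If' Sf' G2 Di Da : R) : 2 * Gf = - (G2 * (Di - Da)) -> 2 * If' = - Sf' * Da ->
    2 * (r2 * (Gf * Sf' + G2 * If')) = - (r2 * (G2 * Sf') * Di).
  move=> e1 e2; transitivity (r2 * ((2 * Gf) * Sf' + G2 * (2 * If'))); first by ring.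
  by rewrite e1 e2; ring.
exact: alg cG cf.
Qed.

End Assembly.

(** * Finite index sets and the conclusion *)

Lemma sum_enum (V : nmodType) (J : finType) (N : nat) (eN : N = #|J|) (F : J -> V) :
  \sum_(j < N) F (enum_val (cast_ord eN j)) = \sum_j F j.
Proof.
rewrite [RHS](reindex (fun j : 'I_N => enum_val (cast_ord eN j))) //.
apply: onW_bij; exists (fun x => cast_ord (esym eN) (enum_rank x)) => x.
  by rewrite enum_valK cast_ordK.
by rewrite cast_ordKV enum_rankK.
Qed.

Lemma compact_pointwise_subcover (X : topologicalType) (U : X -> set X) :
  compact [set: X] -> (forall x, open (U x)) -> (forall x, U x x) ->
  exists (A : finType) (pt : A -> X), forall x, exists a, U (pt a) x.
Proof.
move=> cX oU Ux; have [[x0 _]|nX] := pselect (exists x : X, True); last first.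
  by exists void, (fun a : void => match a with end) => x; case: nX; exists x.
(* [compact_cover] concerns pointed spaces; x0 provides the base point, and later the default of
   [nth]. *)
pose Xp : ptopologicalType := HB.pack (Topological.sort X) (isPointed.Build X x0).
have: @cover_compact Xp [set: X] by rewrite -compact_cover.
case/(_ X [set: X] U) => [x _||D _ cov]; [exact: oU|by move=> x _; exists x|].
pose s := finmap.enum_fset D.
exists 'I_(size s), (fun i => nth x0 s (nat_of_ord i)) => x; have [y yD Uy] := cov x I.
have ys : (index y s < size s)%N by rewrite index_mem.
by exists (Ordinal ys); rewrite /= nth_index // -index_mem.
Qed.

Theorem mainTheorem4 (R : realType) (X : topologicalType) (n : nat)
    (X_hausdorff : hausdorff_space X) (X_compact : compact [set: X])
    (L : lamination R X n)
    (no_vanishing_cycle : forall g : R -> leafspace L, ~ vanishing_cycle g)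
    (E : line_bundle L) (E_positive : positive E)
    (X_dim : finite_topological_dimension R X) :
  exists (N : nat) (f : X -> CP R N), symplectic_embedding L f.
Proof.
have [g _ [h [h_metric h_smooth h_positive]]] := E_positive.
have [m [e [e_inj e_cont e_open]]] := X_dim.
(* An empty X is set apart, as the index set J could be empty and give no homogeneous coordinate. *)
have [[x0 _]|nX] := pselect (exists x : X, True); last first.
  have abs (x : X) : False by apply: nX; exists x.
  exists 0, (fun x => False_rect _ (abs x)); split.
  - move=> k; split; last by move=> j; split=> c _ us p; case: (abs (psi c p)).
    by rewrite (_ : _ @^-1` _ = set0); [exact: open0|apply/seteqP; split=> x; case: (abs x)].
  - by move=> x; case: (abs x).
  - by move=> c _ p; case: (abs (psi c p)).
pose r x := ld_r (ld h_metric h_smooth e_inj e_cont e_open x).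
have [A [pt pt_cover]] : exists (A : finType) (pt : A -> X), forall x, exists a, r (pt a) x != 0.
  apply: (compact_pointwise_subcover (U := fun x => [set y | r x y != 0]) X_compact) => x; last exact: ld_r0.
  have cr : continuous (r x) by move=> y; exact: smooth_cont openT (@ld_r_smooth _ _ _ _ _ _ _ _ _) I.
  by apply: (@open_comp _ _ (r x) [set y | y != 0]) => [y _|]; [exact: cr|exact: open_neq].
pose w := wfam h_metric h_smooth e_inj e_cont e_open pt.
pose J := (A * (fam_index n * (unit + (A + A * sep_index n m))))%type.
have [a _] := pt_cover x0.
have J0 : (0 < #|{: J}|)%N by apply/card_gt0P; exists (a, (inl tt, inl tt)).
(* [CP R N] has N + 1 homogeneous coordinates, so the cardinal of J, which is positive, is written
   as a successor. *)
pose N := #|{: J}|.-1; have eN : N.+1 = #|{: J}| by rewrite prednK.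
pose el (j : 'I_N.+1) : J := enum_val (cast_ord eN j).
have elK (j : J) : exists k, el k = j.
  by exists (cast_ord (esym eN) (enum_rank j)); rewrite /el cast_ordKV enum_rankK.
have w_neq0 i x : co_set g i x -> exists j, w i (el j) x != 0.
  by move=> /(wfam_neq0 pt_cover)[j wj]; have [k kj] := elK j; exists k; rewrite kj.
exists N, (wmap w_neq0); apply: (embedding h_metric h_smooth h_positive).
- by move=> i j; exact: wfam_smooth.
- move=> i i' x ix i'x; have [l l0 El] := wfam_glue h_metric h_smooth e_inj e_cont e_open pt ix i'x.
  by exists l.
- move=> c Lc i p u Wp.
  rewrite (sum_enum eN (fun j => dC (w i j) p u * cj (w i j (psi c p)))).
  rewrite (sum_enum eN (fun j => absC (w i j (psi c p)) ^+ 2)).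
  exact: (wfam_conn h_metric h_smooth e_inj e_cont e_open pt Lc u Wp).
- move=> i i' x y l ix iy l0 E1; apply: (wfam_inj pt_cover ix iy l0) => j.
  by have [k <-] := elK j; exact: E1.
Qed.
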